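(* There is a unique symplectomorphism $\varkappa:(R,\omega_R)\to(T^*S,\omega_S)$ such that $$\varkappa\circ\rho:\mathscr{J}_{\mathrm{diff}}^{-1}(0)\to T^*S:(t,x,\dot x,0,p_x,p_{\dot x})\mapsto(x,\dot\beta,\dot\alpha,p_x,p_{\dot\beta},p_{\dot\alpha}),$$ where $(\dot\beta,\dot\alpha,p_{\dot\beta},p_{\dot\alpha})$ are related to $(x,\dot x,p_x,p_{\dot x})$ by the spherical coordinates $$\dot x^1=\dot r\sin\dot\beta\cos\dot\alpha,\qquad\dot x^2=\dot r\sin\dot\beta\sin\dot\alpha,\qquad\dot x^3=\dot r\cos\dot\beta$$ and the dual momenta defined by $p_{\dot x}\,d\dot x=p_{\dot r}\,d\dot r+p_{\dot\beta}\,d\dot\beta+p_{\dot\alpha}\,d\dot\alpha$.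
   Context: $J_0^1=\{(t,x,\dot x)\in\mathbf{R}\times\mathbf{R}^3\times\mathbf{R}^3\mid\dot x\ne0\}$, and $T^*J_0^1$ has coordinates $(t,x,\dot x,p_t,p_x,p_{\dot x})$ and canonical symplectic form $\omega=dp_t\wedge dt+dp_x\wedge dx+dp_{\dot x}\wedge d\dot x$. The group $\mathrm{Diff}_+\mathbf{R}$ of orientation preserving diffeomorphisms of $\mathbf{R}$ acts on $J_0^1$ by $(\varphi,(t,x,\dot x))\mapsto(\varphi(t),x,\dot x/\dot\varphi(t))$ and on $T^*J_0^1$ by the cotangent lift. The zero level of its momentum map is $\mathscr{J}_{\mathrm{diff}}^{-1}(0)=\{p_t=0,\ \langle p_{\dot x},\dot x\rangle=0\}\subset T^*J_0^1$. Let $R=\mathscr{J}_{\mathrm{diff}}^{-1}(0)/\mathrm{Diff}_+\mathbf{R}$ be the space of $\mathrm{Diff}_+\mathbf{R}$-orbits in $\mathscr{J}_{\mathrm{diff}}^{-1}(0)$; the orbit through $(t,x,\dot x,0,p_x,p_{\dot x})$ is $\{(u,x,e^s\dot x,0,p_x,e^{-s}p_{\dot x})\mid(u,s)\in\mathbf{R}^2\}$. Let $\rho:\mathscr{J}_{\mathrm{diff}}^{-1}(0)\to R$ be the orbit projection and $\iota:\mathscr{J}_{\mathrm{diff}}^{-1}(0)\to T^*J_0^1$ the inclusion. $R$ carries the quotient manifold structure, and $\omega_R$ is the unique symplectic form on $R$ with $\rho^*\omega_R=\iota^*\omega$. $S=\{(x,\dot x)\in T\mathbf{R}^3\mid|\dot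 x|=1\}$ is the unit sphere bundle over $\mathbf{R}^3$, parametrized by coordinates $(x,\dot\alpha,\dot\beta)$ (with $\dot r=1$). The Liouville form of $T^*S$ is $\theta_S=p_x\,dx+p_{\dot\beta}\,d\dot\beta+p_{\dot\alpha}\,d\dot\alpha$, and $\omega_S=d\theta_S$ is the canonical symplectic form of $T^*S$. (The dots on $\dot r,\dot\alpha,\dot\beta$ are part of the names of the coordinates.) *)

(* Defs.v *)
From HB Require Import structures.
From mathcomp Require Import all_boot all_order all_algebra.
From mathcomp Require Import all_classical all_reals all_analysis.
Set Implicit Arguments.
Unset Strict Implicit.
Unset Printing Implicit Defensive.
Import Order.TTheory GRing.Theory Num.Theory.
Import numFieldNormedType.Exports.
Local Open Scope classical_set_scope.
Local Open Scope ring_scope.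

(* Euclidean inner product.  The library norm of a row vector is the sup norm,
   so Euclidean conditions are written with [dot]. *)
Definition dot {R : realType} {n : nat} (u v : 'rV[R]_n) : R :=
  \sum_(i < n) u 0 i * v 0 i.

Section Smooth.
Context {R : realType} {V W : normedModType R}.

(* [U] is meant to be open and [V] finite dimensional. *)
Fixpoint Ck_on (k : nat) (U : set V) (f : V -> W) : Prop :=
  match k with
  | 0 => forall x, U x -> {for x, continuous f}
  | k'.+1 => (forall x, U x -> differentiable f x) /\
             forall v, Ck_on k' U (fun x => 'd f x v)
  end.

Definition smooth_on (U : set V) (f : V -> W) : Prop := forall k, Ck_on k U f.

End Smooth.

(* A chart of a set [M] is a bijection [fwd] from [dom] to [cod], an open
   subset of R^n, with inverse [bwd]; the values of [fwd] outside [dom] and of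
   [bwd] outside [cod] are irrelevant. *)
Record chart (R : realType) (n : nat) (M : Type) := Chart {
  dom : set M;
  cod : set 'rV[R]_n;
  fwd : M -> 'rV[R]_n;
  bwd : 'rV[R]_n -> M }.

Section Charts.
Context {R : realType}.

Definition chart_bij n (M : Type) (c : chart R n M) : Prop :=
  [/\ open (cod c),
      forall m, dom c m -> cod c (fwd c m) /\ bwd c (fwd c m) = m
    & forall u, cod c u -> dom c (bwd c u) /\ fwd c (bwd c u) = u].

Definition chart_homeo n (M : topologicalType) (c : chart R n M) : Prop :=
  [/\ chart_bij c, open (dom c),
      forall m, dom c m -> {for m, continuous (fwd c)}
    & forall u, cod c u -> {for u, continuous (bwd c)}].

(* The inverse charts are the regular local parametrizations of [X]; [X]
   carries the topology induced by [V]. *)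
Definition submanifold_atlas (V : normedModType R) (X : set V) n :
    set (chart R n X) :=
  [set c | [/\ chart_homeo c, smooth_on (cod c) (set_val \o bwd c)
             & forall u, cod c u -> injective ('d (set_val \o bwd c) u)]].

(* For [N] with the quotient topology along [f : M -> N], these are the charts
   of the unique smooth structure of dimension [n] on [N] for which [f] is a
   smooth submersion, when it exists. *)
Definition quotient_atlas k n (M : Type) (N : topologicalType)
    (A : set (chart R k M)) (f : M -> N) : set (chart R n N) :=
  [set c | chart_homeo c /\ forall d, A d ->
    let U := cod d `&` [set u | dom c (f (bwd d u))] in
    smooth_on U (fwd c \o f \o bwd d) /\
    forall u, U u -> range ('d (fwd c \o f \o bwd d) u) = setT].

Definition smooth_map m n (M N : Type) (A : set (chart R m M))
    (B : set (chart R n N)) (f : M -> N) : Prop :=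
  forall x, exists c d (U : set 'rV[R]_m),
    [/\ A c /\ dom c x, B d /\ dom d (f x), open U /\ U (fwd c x),
        (forall u, U u -> cod c u /\ dom d (f (bwd c u)))
      & smooth_on U (fwd d \o f \o bwd c)].

Definition diffeomorphism m n (M N : Type) (A : set (chart R m M))
    (B : set (chart R n N)) (f : M -> N) : Prop :=
  exists g : N -> M,
    [/\ cancel f g, cancel g f, smooth_map A B f & smooth_map B A g].

(* Differential forms are given by their expressions in charts: [w c u] is the
   form on R^n at [u], relevant for [c] in the atlas and [u] in [cod c]. *)
Definition form1 n (M : Type) := chart R n M -> 'rV[R]_n -> 'rV[R]_n -> R.
Definition form2 n (M : Type) :=
  chart R n M -> 'rV[R]_n -> 'rV[R]_n -> 'rV[R]_n -> R.

(* f^* w = eta *)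
Definition is_pullback m n (M N : Type) (A : set (chart R m M))
    (B : set (chart R n N)) (f : M -> N) (w : form2 n N) (eta : form2 m M) :
    Prop :=
  forall c d x, A c -> B d -> dom c x -> dom d (f x) ->
  forall a b, eta c (fwd c x) a b =
    w d (fwd d (f x)) ('d (fwd d \o f \o bwd c) (fwd c x) a)
                      ('d (fwd d \o f \o bwd c) (fwd c x) b).

Definition ext_d n (M : Type) (theta : form1 n M) : form2 n M :=
  fun c u a b => 'D_a (fun u' => theta c u' b) u -
                 'D_b (fun u' => theta c u' a) u.

(* The last condition is the transformation rule under changes of chart. *)
Definition differential_2form n (M : Type) (A : set (chart R n M))
    (w : form2 n M) : Prop :=
  [/\ forall c a b, A c -> smooth_on (cod c) (fun u => w c u a b : R^o),
      forall c u k a a' b, A c -> cod c u ->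
        w c u (k *: a + a') b = k * w c u a b + w c u a' b,
      forall c u a b, A c -> cod c u -> w c u a b = - w c u b a
    & is_pullback A A id w w].

Definition symplectic_form n (M : Type) (A : set (chart R n M))
    (w : form2 n M) : Prop :=
  [/\ differential_2form A w,
      forall c u a b e, A c -> cod c u ->
        'D_a (fun u' => w c u' b e) u + 'D_b (fun u' => w c u' e a) u +
        'D_e (fun u' => w c u' a b) u = 0
    & forall c u a, A c -> cod c u -> (forall b, w c u a b = 0) -> a = 0].

Definition symplectomorphism m n (M N : Type) (A : set (chart R m M))
    (B : set (chart R n N)) (wM : form2 m M) (wN : form2 n N) (f : M -> N) :
    Prop :=
  diffeomorphism A B f /\ is_pullback A B f wN wM.

(* A covector at [m] is given by its components [p c] in the charts [c] around
   [m]; it is normalized to 0 at the other arguments so that equality of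
   covectors is Leibniz equality. *)
Definition is_covector n (M : Type) (A : set (chart R n M)) (m : M)
    (p : chart R n M -> 'rV[R]_n) : Prop :=
  (forall c, ~ (A c /\ dom c m) -> p c = 0) /\
  (forall c d, A c -> A d -> dom c m -> dom d m -> forall a,
     dot (p c) a = dot (p d) ('d (fwd d \o bwd c) (fwd c m) a)).

Definition cotangent n (M : Type) (A : set (chart R n M)) : Type :=
  set_type [set mp : M * (chart R n M -> 'rV[R]_n) | is_covector A mp.1 mp.2].

(* The point of the cotangent bundle whose coordinates are (q, p) in the
   coordinates induced by [c]. *)
Definition has_coords n (M : Type) (A : set (chart R n M)) (c : chart R n M)
    (s : cotangent A) (q p : 'rV[R]_n) : Prop :=
  [/\ dom c (set_val s).1, fwd c (set_val s).1 = q & (set_val s).2 c = p].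

Definition cotangent_atlas n (M : Type) (A : set (chart R n M)) :
    set (chart R (n + n) (cotangent A)) :=
  [set C | chart_bij C /\ exists2 c, A c &
    [/\ dom C = [set s | dom c (set_val s).1],
        cod C = [set u | cod c (lsubmx u)]
      & forall s, dom C s -> has_coords c s (lsubmx (fwd C s)) (rsubmx (fwd C s))]].

(* theta = p dq, in the charts of [cotangent_atlas]. *)
Definition liouville n (M : Type) (A : set (chart R n M)) :
    form1 (n + n) (cotangent A) :=
  fun _ u a => dot (rsubmx u) (lsubmx a).

Definition cotangent_symplectic n (M : Type) (A : set (chart R n M)) :
    form2 (n + n) (cotangent A) := ext_d (@liouville n M A).

End Charts.

(* Points of R x R^3 x R^3 are (t, x, v), where v stands for the velocity. *)
Notation jet R := (R * 'rV[R]_3 * 'rV[R]_3)%type.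

Section Reduction.
Context {R : realType}.

Definition jet_slit : set (jet R) := [set q | q.2 != 0].

(* The covector p = (p_t, p_x, p_v) is identified with the linear form
   p_t dt + p_x dx + p_v dv. *)
Definition pairing (p q : jet R) : R :=
  p.1.1 * q.1.1 + dot p.1.2 q.1.2 + dot p.2 q.2.

Definition cotangent_jet : set (jet R * jet R) := [set z | jet_slit z.1].

(* dp_t /\ dt + dp_x /\ dx + dp_v /\ dv *)
Definition omega (a b : jet R * jet R) : R :=
  pairing a.2 b.1 - pairing b.2 a.1.

Definition diff_plus (phi : R -> R) : Prop :=
  [/\ smooth_on setT phi, forall t, 0 < derive1 phi t
    & exists psi : R -> R, [/\ cancel phi psi, cancel psi phi
                             & smooth_on setT psi]].

Definition diff_act (phi : R -> R) (q : jet R) : jet R :=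
  (phi q.1.1, q.1.2, (derive1 phi q.1.1)^-1 *: q.2).

Definition cotangent_lift (g : jet R -> jet R) (z z' : jet R * jet R) : Prop :=
  z'.1 = g z.1 /\ forall a, pairing z'.2 ('d g (z.1) a) = pairing z.2 a.

(* The zero level of the momentum map: p_t = 0 and <p_v, v> = 0. *)
Definition zero_level : set (jet R * jet R) :=
  [set z | cotangent_jet z /\ z.2.1.1 = 0 /\ dot z.2.2 z.1.2 = 0].

Definition zero_level_atlas : set (chart R 12 zero_level) :=
  submanifold_atlas (X := zero_level) (n := 12).

Definition orbit (z : zero_level) : set zero_level :=
  [set z' | exists2 phi, diff_plus phi &
              cotangent_lift (diff_act phi) (set_val z) (set_val z')].

Definition orbit_space : Type := set_type (range orbit).

Definition rho (z : zero_level) : orbit_space :=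
  SigSub (mem_set (imageT orbit z)).

HB.instance Definition _ := Choice.on orbit_space.

(* Quotient topology. *)
Definition orbit_space_open (O : set orbit_space) : Prop := open (rho @^-1` O).

Fact orbit_space_openT : orbit_space_open setT.
Proof. by rewrite /orbit_space_open preimage_setT; exact: openT. Qed.

Fact orbit_space_openI (O1 O2 : set orbit_space) :
  orbit_space_open O1 -> orbit_space_open O2 -> orbit_space_open (O1 `&` O2).
Proof. exact: openI. Qed.

Fact orbit_space_open_bigU (I : Type) (F : I -> set orbit_space) :
  (forall i, orbit_space_open (F i)) -> orbit_space_open (\bigcup_i F i).
Proof. by move=> oF; apply: bigcup_open => i _; exact: oF. Qed.

HB.instance Definition _ := isOpenTopological.Build orbit_space
  orbit_space_openT orbit_space_openI orbit_space_open_bigU.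

Definition orbit_space_atlas : set (chart R 10 orbit_space) :=
  quotient_atlas zero_level_atlas rho.

Definition iota_omega : form2 12 zero_level := fun c u a b =>
  omega ('d (set_val \o bwd c) u a) ('d (set_val \o bwd c) u b).

Definition reduced_form (w : form2 10 orbit_space) : Prop :=
  symplectic_form orbit_space_atlas w /\
  is_pullback zero_level_atlas orbit_space_atlas rho w iota_omega.

Definition sphere_bundle : set ('rV[R]_3 * 'rV[R]_3) :=
  [set s | dot s.2 s.2 = 1].

Definition sphere_bundle_atlas : set (chart R 5 sphere_bundle) :=
  submanifold_atlas (X := sphere_bundle) (n := 5).

Definition row2 (a b : R) : 'rV[R]_2 := \row_j [:: a; b]`_j.

(* Arguments (r, beta, alpha). *)
Definition spherical (w : R * R * R) : 'rV[R]_3 :=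
  \row_j [:: w.1.1 * sin w.1.2 * cos w.2;
             w.1.1 * sin w.1.2 * sin w.2;
             w.1.1 * cos w.1.2]`_j.

(* Charts of the sphere bundle with coordinates (x, beta, alpha). *)
Definition spherical_chart (c : chart R 5 sphere_bundle) : Prop :=
  sphere_bundle_atlas c /\
  forall (x : 'rV[R]_3) beta alpha, cod c (row_mx x (row2 beta alpha)) ->
    set_val (bwd c (row_mx x (row2 beta alpha))) =
    (x, spherical (1, beta, alpha)).

(* p_v dv = p_r dr + p_beta dbeta + p_alpha dalpha at v = spherical w. *)
Definition spherical_momenta (w : R * R * R) (pv : 'rV[R]_3)
    (pr pbeta palpha : R) : Prop :=
  forall a : R * R * R,
    dot pv ('d spherical w a) = pr * a.1.1 + pbeta * a.1.2 + palpha * a.2.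

End Reduction.
Arguments orbit_space R : clear implicits.
Arguments zero_level R : clear implicits.
Arguments orbit_space_atlas R : clear implicits.
Arguments sphere_bundle_atlas R : clear implicits.

(* Main.v *)
From HB Require Import structures.
Require Import Defs.
From mathcomp Require Import all_boot all_order all_algebra.
From mathcomp Require Import all_classical all_reals all_analysis.
From mathcomp Require Import ring lra.
Set Implicit Arguments.
Unset Strict Implicit.
Unset Printing Implicit Defensive.
Import Order.TTheory GRing.Theory Num.Theory.
Import numFieldNormedType.Exports.
Local Open Scope classical_set_scope.
Local Open Scope ring_scope.

(** On the zero level p_t = 0 and p_v is orthogonal to the velocity v.  A
    diffeomorphism of time moves t and replaces (v, p_v) by (k v, p_v / k), where
    k > 0 is the inverse of its derivative, and affine diffeomorphisms already
    realize all of these ([orbitP]).  The invariants of the orbits are therefore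
    x, p_x, the unit vector e = v/|v| and |v| p_v, that is, the covector
    p_x dx + |v| p_v de at the point (x, e) of the unit sphere bundle; this is
    [kap], and [kappa] on the quotient.

    As p_v is orthogonal to v, one has |v| p_v de = p_v dv, so [kappa] matches the
    canonical one-forms and hence the symplectic forms.  The symplectic identity is
    required in arbitrary charts of both manifolds.  [cotangent_symplectic_along]
    computes the pullback of the canonical form of a cotangent bundle along any
    map; second derivatives of the parametrization appear and cancel by symmetry
    ([diff_diff_sym]).  [kap_along] then compares the result with the canonical form
    of the zero level, and [kappa_pullback] descends to the quotient along the
    projection, a submersion.

    The compatibility of charts has to be proved, and is derived from that with one
    family of good charts.  For submanifolds this is [chart_lift]: a chart is a
    homeomorphism and an immersion, hence the change of charts from a good chart is
    the continuous inverse of a map with invertible differential, and such an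
    inverse is differentiable ([is_diff_inverse]).  The same argument for the
    orbit space is [orbit_transition].  Good charts of the sphere bundle are the
    gnomonic ones, with coordinates y_j = v_j / v_i: the conjugate momenta are
    v_i p_j, so that everything is rational on the zero level, polynomial sections
    exist, and the poles are covered.  Transporting them by [kappa] gives charts of
    the orbit space ([orb_chart_atlas]), in which [kappa] is the identity; hence it is a
    diffeomorphism.

    In spherical coordinates the angular derivatives of r e are r times those of
    e, so the momenta dual to (beta, alpha) at v are the components of |v| p_v in
    the chart of the sphere bundle ([kappa_spherical]).  Conversely, spherical charts
    exist where v_0 is nonzero and determine the map there; this set is dense, and
    continuity gives uniqueness ([kappa_unique]). *)

(** * Differentials *)

Lemma continuous_near_eq (T T' : topologicalType) (f g : T -> T') x :
  (\forall y \near x, f y = g y) -> {for x, continuous f} -> {for x, continuous g}.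
Proof.
move=> fg cf; rewrite /prop_for /continuous_at -(nbhs_singleton fg).
by apply: cvg_trans cf; exact: near_eq_cvg.
Qed.

Section Differentials.
Context {R : realType}.
Implicit Types U V W : normedModType R.

(** The epsilon form of differentiability, with which inverses and local
    modifications of a map are checked. *)
Lemma is_diffP V W (f df : V -> W) x :
  is_diff x f df <->
  [/\ linear df, continuous df &
    forall e, 0 < e ->
      \forall h \near (0 : V), `|f (h + x) - f x - df h| <= e * `|h|].
Proof.
split=> [[dfx <-]|[ldf cdf dfe]].
  split; [exact: linearP | exact: diff_continuous|].
  have /diff_locally/eqaddoP fE := dfx.
  by move=> e e0; have := fE e e0; apply: filterS => h; rewrite /= opprD addrA.
pose Lm := GRing.isLinear.Build _ _ _ _ _ ldf.
pose L : {linear V -> W} := HB.pack df Lm.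
have fE : f \o shift x = cst (f x) + L +o_ 0 id.
  by apply/eqaddoP => e e0; have := dfe e e0; apply: filterS => h;
     rewrite /= opprD addrA.
have dfE : 'd f x = L :> (V -> W) by exact: diff_unique.
apply: DiffDef; last by rewrite dfE.
by apply/diff_locallyP; rewrite dfE.
Qed.

Lemma cvg_shift0 V (x : V) : (h + x) @[h --> (0 : V)] --> x.
Proof. by rewrite -{2}[x]add0r; apply: cvgD; [exact: cvg_id|exact: cvg_cst]. Qed.

Lemma is_diff_near V W (f g df : V -> W) x :
  (\forall y \near x, f y = g y) -> is_diff x f df -> is_diff x g df.
Proof.
move=> fg /is_diffP[ldf cdf dfe]; apply/is_diffP; split=> // e e0.
have fgx : f x = g x by exact: nbhs_singleton fg.
have fg0 : \forall h \near (0 : V), f (h + x) = g (h + x).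
  exact: (cvg_shift0 fg).
near=> h; rewrite -fgx -(_ : f (h + x) = g (h + x)).
  by near: h; exact: dfe.
by near: h.
Unshelve. all: by end_near. Qed.

Lemma is_diff_linear V W (f : V -> W) x :
  linear f -> continuous f -> is_diff x f f.
Proof.
move=> lf cf; apply/is_diffP; split=> // e e0; near=> h.
pose Lm := GRing.isLinear.Build _ _ _ _ _ lf.
pose L : {linear V -> W} := HB.pack f Lm.
rewrite -[f]/(L : _ -> _) linearD addrK subrr normr0 mulr_ge0 //; exact: ltW.
Unshelve. all: by end_near. Qed.

Lemma is_diff_chain U V W (f df : U -> V) (g dg : V -> W) x :
  is_diff x f df -> is_diff (f x) g dg ->
  is_diff x (fun y => g (f y)) (fun v => dg (df v)).
Proof. exact: is_diff_comp. Qed.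

Lemma diff_eq V W (f df : V -> W) x v : is_diff x f df -> 'd f x v = df v.
Proof. by move=> dfx; rewrite diff_val. Qed.

Lemma scale_is_bilinear W :
  bilinear_for
    (GRing.Scale.Law.clone _ _ *:%R _) (GRing.Scale.Law.clone _ _ *:%R _)
    (@GRing.scale R W).
Proof.
split=> [u'|u] a x y /=.
- by rewrite scalerDl scalerA.
- by rewrite scalerDr !scalerA mulrC.
Qed.
HB.instance Definition _ W :=
  bilinear_isBilinear.Build R R W W _ _ (@GRing.scale R W)
  (scale_is_bilinear W).

(** Scaling is bilinear and continuous, so this is the chain rule. *)
Lemma is_diff_scale V W (k dk : V -> R) (f df : V -> W) x :
  is_diff x k dk -> is_diff x f df ->
  is_diff x (fun y => k y *: f y) (fun v => k x *: df v + dk v *: f x).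
Proof.
move=> kx fx.
have sc (p : R * W) :
    is_diff p (fun q => q.1 *: q.2) (fun q => p.1 *: q.2 + q.1 *: p.2).
  apply: DiffDef; last by rewrite diff_bilin // => ?; apply: scale_continuous.
  by apply: differentiable_bilin =>?; apply: scale_continuous.
exact: (is_diff_chain (is_diff_pair kx fx) (sc (k x, f x))).
Qed.

Lemma is_diff_fst V W (p : V * W) : is_diff p fst fst.
Proof. by apply: is_diff_linear => // q; exact: cvg_fst. Qed.
Lemma is_diff_snd V W (p : V * W) : is_diff p snd snd.
Proof. by apply: is_diff_linear => // q; exact: cvg_snd. Qed.

Lemma is_diff_coord n (M : 'rV[R]_n) j :
  is_diff M (fun N : 'rV[R]_n => N 0 j) (fun N : 'rV[R]_n => N 0 j).
Proof.
apply: is_diff_linear; last exact: coord_continuous.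
by move=> a u v; rewrite !mxE.
Qed.

Lemma is_diff_sumr V W n (f df : 'I_n -> V -> W) x :
  (forall i, is_diff x (f i) (df i)) ->
  is_diff x (fun y => \sum_i f i y) (fun v => \sum_i df i v).
Proof.
elim: n f df => [|n IH] f df fx.
  rewrite (_ : (fun y => _) = cst 0); last by apply/funext => y; rewrite big_ord0.
  rewrite (_ : (fun v => _) = cst 0); last by apply/funext => y; rewrite big_ord0.
  exact: is_diff_cst.
have -> : (fun y => \sum_i f i y) =
    f ord0 + (fun y => \sum_i f (lift ord0 i) y).
  by apply/funext => y; rewrite big_ord_recl.
have -> : (fun y => \sum_i df i y) =
    df ord0 + (fun y => \sum_i df (lift ord0 i) y).
  by apply/funext => y; rewrite big_ord_recl.
by apply: is_diffD => //; apply: IH.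
Qed.

Lemma is_diff_row V n (f df : V -> 'rV[R]_n) x :
  (forall j, is_diff x (fun y => f y 0 j) (fun v => df v 0 j)) -> is_diff x f df.
Proof.
move=> fx.
rewrite (_ : f = fun y => \sum_j f y 0 j *: delta_mx 0 j); last first.
  by apply/funext => y; exact: row_sum_delta.
rewrite (_ : df = fun y => \sum_j df y 0 j *: delta_mx 0 j); last first.
  by apply/funext => y; exact: row_sum_delta.
apply: is_diff_sumr => j.
exact: (is_diff_chain (fx j) (is_diff_scalel _ _)).
Qed.

Lemma linear_rV_continuous n W (f : 'rV[R]_n -> W) : linear f -> continuous f.
Proof.
move=> lf.
pose Lm := GRing.isLinear.Build _ _ _ _ _ lf.
pose L : {linear _ -> W} := HB.pack f Lm.
rewrite (_ : f = fun y => \sum_j y 0 j *: f (delta_mx 0 j)); last first.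
  apply/funext => y; rewrite {1}[y]row_sum_delta -[f]/(L : _ -> _) linear_sum.
  by apply: eq_bigr => j _; rewrite linearZ.
move=> y; apply: differentiable_continuous.
have [] // : is_diff y (fun y => \sum_j y 0 j *: f (delta_mx 0 j))
                       (fun y => \sum_j y 0 j *: f (delta_mx 0 j)).
apply: is_diff_sumr => j.
exact: (is_diff_chain (is_diff_coord y j) (is_diff_scalel _ _)).
Qed.

End Differentials.

(** * Closure properties of smooth functions *)

Section SmoothFunctions.
Context {R : realType}.
Implicit Types V W : normedModType R.

Lemma Ck_onS V W k (U : set V) (f : V -> W) : Ck_on k.+1 U f -> Ck_on k U f.
Proof.
elim: k f => [|k IH] f [df Cf]; first by move=> x /df /differentiable_continuous.
by split=> // v; apply: IH.
Qed.

Lemma Ck_on_ext V W k (U : set V) (f g : V -> W) : open U ->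
  (forall x, U x -> f x = g x) -> Ck_on k U f -> Ck_on k U g.
Proof.
move=> oU.
have nfg (f' g' : V -> W) x : (forall x, U x -> f' x = g' x) -> U x ->
    \forall y \near x, f' y = g' y.
  by move=> fg Ux; near=> y; apply: fg; near: y; exact: open_nbhs_nbhs.
elim: k f g => [|k IH] f g fg /=.
  move=> cf x Ux; rewrite /prop_for /continuous_at -(fg x Ux).
  by apply: cvg_trans (cf x Ux); apply: near_eq_cvg; exact: nfg.
have dfg x : U x -> differentiable f x -> is_diff x g ('d f x).
  by move=> Ux dfx; apply: is_diff_near (differentiableP dfx); exact: nfg.
move=> [df Cf]; split=> [x Ux|v]; first by have [] := dfg x Ux (df x Ux).
apply: IH (Cf v) => x Ux; have dg := dfg x Ux (df x Ux).
by rewrite (diff_eq v dg).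
Unshelve. all: by end_near. Qed.

Lemma Ck_on_sub (V W : normedModType R) k (U U' : set V) (f : V -> W) :
  U `<=` U' -> Ck_on k U' f -> Ck_on k U f.
Proof.
move=> UU'; elim: k f => [|k IH] f; first by move=> cf x /UU'; exact: cf.
by move=> [df Cf]; split=> [x /UU'|v]; [exact: df|exact: IH (Cf v)].
Qed.

(** On an open set the iterated differentials of [f] may be replaced by any
    formula [df] for them: this is how C^k regularity propagates below, by
    induction on k. *)
Lemma Ck_on_step V W k (U : set V) (f : V -> W) (df : V -> V -> W) : open U ->
  (forall x, U x -> is_diff x f (df x)) ->
  (forall v, Ck_on k U (fun x => df x v)) -> Ck_on k.+1 U f.
Proof.
move=> oU dfU Cdf; split=> [x Ux|v]; first by have [] := dfU x Ux.
by apply: Ck_on_ext (Cdf v) => // x Ux; rewrite (diff_eq v (dfU x Ux)).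
Qed.

Section OnOpen.
Context {V : normedModType R} (U : set V).
Hypothesis oU : open U.

Lemma Ck_on_cst W k (c : W) : Ck_on k U (cst c).
Proof.
elim: k c => [|k IH] c; first by move=> x _; exact: cvg_cst.
apply: (@Ck_on_step _ _ k U (cst c) (fun _ => cst 0) oU) => v.
exact: IH.
Qed.

Lemma Ck_on_linear W k (f : V -> W) : linear f -> continuous f -> Ck_on k U f.
Proof.
move=> lf cf; case: k => [|k]; first by move=> x _; exact: cf.
apply: (@Ck_on_step _ _ _ _ _ (fun _ => f)) => [//|x _|v].
  exact: is_diff_linear.
exact: Ck_on_cst.
Qed.

Lemma Ck_on_comp_linear W W' k (l : W -> W') (f : V -> W) :
  linear l -> continuous l -> Ck_on k U f -> Ck_on k U (fun x => l (f x)).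
Proof.
move=> ll cl; elim: k f => [|k IH] f.
  by move=> cf x Ux; apply: continuous_comp; [exact: cf|exact: cl].
move=> [df Cf]; apply: (@Ck_on_step _ _ _ _ _ (fun x v => l ('d f x v))) => [//|x Ux|v].
  apply: is_diff_chain (differentiableP (df x Ux)) _; exact: is_diff_linear.
exact: IH (Cf v).
Qed.

Lemma Ck_onD W k (f g : V -> W) :
  Ck_on k U f -> Ck_on k U g -> Ck_on k U (fun x => f x + g x).
Proof.
elim: k f g => [|k IH] f g.
  by move=> cf cg x Ux; apply: cvgD; [exact: cf|exact: cg].
move=> [df Cf] [dg Cg].
apply: (@Ck_on_step _ _ _ _ _ (fun x v => 'd f x v + 'd g x v)) => [//|x Ux|v].
  by apply: is_diffD; apply: differentiableP; auto.
exact: IH (Cf v) (Cg v).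
Qed.

Lemma Ck_on_scale W k (f : V -> R) (g : V -> W) :
  Ck_on k U f -> Ck_on k U g -> Ck_on k U (fun x => f x *: g x).
Proof.
elim: k f g => [|k IH] f g.
  by move=> cf cg x Ux; apply: cvgZ; [exact: cf|exact: cg].
move=> [df Cf] [dg Cg].
apply: (@Ck_on_step _ _ _ _ _ (fun x v => f x *: 'd g x v + 'd f x v *: g x)) => [//|x Ux|v].
  by apply: is_diff_scale; apply: differentiableP; auto.
by apply: Ck_onD; apply: IH; do ?[exact: Cf|exact: Cg]; apply: Ck_onS.
Qed.

(** The derivative of [h] along [f] is [dh (f x)] times that of [f]; when [dh] is
    expressed through [h] itself, as for the inverse or the square root, or through
    functions treated at the same time, as for sin and cos, regularity follows by
    induction. *)
Lemma Ck_on_comp_real k (h dh : R -> R) (f : V -> R) :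
  (forall x, U x -> is_derive (f x) 1 h (dh (f x))) ->
  Ck_on k.+1 U f -> Ck_on k U (fun x => dh (f x)) ->
  Ck_on k.+1 U (fun x => h (f x)).
Proof.
move=> hd [df Cf] Ch.
apply: (@Ck_on_step _ _ _ _ _ (fun x v => dh (f x) *: 'd f x v)) => [//|x Ux|v].
  apply: is_diff_eq (is_diff_chain (differentiableP (df x Ux)) (differentiableP _)) _.
    by apply/derivable1_diffP; have [] := hd x Ux.
  apply/funext => v; rewrite deriv1E; last by have [] := hd x Ux.
  by rewrite derive1E; have [_ ->] := hd x Ux; exact: mulrC.
exact: (@Ck_on_scale _ _ (fun x => dh (f x)) (fun x => 'd f x v) Ch (Cf v)).
Qed.

Lemma smooth_cst W (c : W) : smooth_on U (fun _ => c).
Proof. by move=> k; exact: Ck_on_cst. Qed.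

Lemma smoothD W (f g : V -> W) :
  smooth_on U f -> smooth_on U g -> smooth_on U (fun x => f x + g x).
Proof. by move=> sf sg k; exact: Ck_onD. Qed.

Lemma smooth_comp_linear W W' (l : W -> W') (f : V -> W) :
  linear l -> continuous l -> smooth_on U f -> smooth_on U (fun x => l (f x)).
Proof. by move=> ll cl sf k; exact: Ck_on_comp_linear. Qed.

Lemma smooth_scale W (f : V -> R) (g : V -> W) :
  smooth_on U f -> smooth_on U g -> smooth_on U (fun x => f x *: g x).
Proof. by move=> sf sg k; exact: Ck_on_scale. Qed.

Lemma smoothM (f g : V -> R) :
  smooth_on U f -> smooth_on U g -> smooth_on U (fun x => f x * g x).
Proof. exact: smooth_scale. Qed.

Lemma smoothN W (f : V -> W) : smooth_on U f -> smooth_on U (fun x => - f x).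
Proof.
apply: smooth_comp_linear; first by move=> a u v; rewrite opprD scalerN.
exact: opp_continuous.
Qed.

Lemma smooth_sum W n (f : 'I_n -> V -> W) :
  (forall i, smooth_on U (f i)) -> smooth_on U (fun x => \sum_i f i x).
Proof.
elim: n f => [|n IH] f sf.
  rewrite (_ : (fun x => _) = cst 0); last by apply/funext => y; rewrite big_ord0.
  exact: smooth_cst.
have -> : (fun y => \sum_i f i y) = (fun y => f ord0 y + \sum_i f (lift ord0 i) y).
  by apply/funext => y; rewrite big_ord_recl.
by apply: smoothD => //; apply: IH.
Qed.

Lemma smooth_row n (f : V -> 'rV[R]_n) :
  (forall j, smooth_on U (fun x => f x 0 j)) -> smooth_on U f.
Proof.
move=> fx; rewrite (_ : f = fun y => \sum_j f y 0 j *: delta_mx 0 j); last first.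
  by apply/funext => y; exact: row_sum_delta.
apply: smooth_sum => j; apply: smooth_scale => //; exact: smooth_cst.
Qed.

Lemma smooth_coord n (f : V -> 'rV[R]_n) j :
  smooth_on U f -> smooth_on U (fun x => f x 0 j).
Proof.
apply: (@smooth_comp_linear _ _ (fun M : 'rV[R]_n => M 0 j)).
  by move=> a u v; rewrite !mxE.
exact: coord_continuous.
Qed.

Lemma smooth_fst W W' (f : V -> W * W') :
  smooth_on U f -> smooth_on U (fun x => (f x).1).
Proof. by apply: smooth_comp_linear => // q; exact: cvg_fst. Qed.

Lemma smooth_snd W W' (f : V -> W * W') :
  smooth_on U f -> smooth_on U (fun x => (f x).2).
Proof. by apply: smooth_comp_linear => // q; exact: cvg_snd. Qed.

Lemma smooth_pair W W' (f : V -> W) (g : V -> W') :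
  smooth_on U f -> smooth_on U g -> smooth_on U (fun x => (f x, g x)).
Proof.
move=> sf sg.
have -> : (fun x => (f x, g x)) = fun x => (f x, 0) + (0, g x).
  by apply/funext => x; rewrite -[RHS]/((f x + 0, 0 + g x)) addr0 add0r.
apply: smoothD.
- apply: (@smooth_comp_linear _ _ (fun w => (w, 0)) _ _ _ sf) => [a u v|x].
    by rewrite -[RHS]/((_, a *: 0 + 0)) scaler0 addr0.
  by apply: cvg_pair; [exact: cvg_id|exact: cvg_cst].
- apply: (@smooth_comp_linear _ _ (fun w => (0, w)) _ _ _ sg) => [a u v|x].
    by rewrite -[RHS]/((a *: 0 + 0, _)) scaler0 addr0.
  by apply: cvg_pair; [exact: cvg_cst|exact: cvg_id].
Qed.

Lemma smoothV (f : V -> R) : (forall x, U x -> f x != 0) ->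
  smooth_on U f -> smooth_on U (fun x => (f x)^-1).
Proof.
move=> f0 sf; elim=> [|k IH].
  move=> x Ux; apply: (@continuous_comp _ _ _ f GRing.inv).
    exact: (sf 0%N x Ux).
  by apply: inv_continuous; exact: f0.
apply: (@Ck_on_comp_real _ _ (fun y => - y^-1 * y^-1)) => [x Ux| |].
- apply: is_derive_eq (is_deriveV _ _) _; [exact: f0|].
  by rewrite scaler1 expr2 invfM mulNr.
- exact: sf.
- apply: (@Ck_on_scale _ _ (fun x => - (f x)^-1) (fun x => (f x)^-1)) => //.
  apply: Ck_on_comp_linear IH; last exact: opp_continuous.
  by move=> a u v; rewrite opprD scalerN.
Qed.

Lemma smooth_sqrt (f : V -> R) : (forall x, U x -> 0 < f x) ->
  smooth_on U f -> smooth_on U (fun x => Num.sqrt (f x)).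
Proof.
move=> f0 sf; suff sV k : Ck_on k U (fun x => (Num.sqrt (f x))^-1).
  move=> k.
  apply: (@Ck_on_ext _ _ _ _ (fun x => f x *: (Num.sqrt (f x))^-1)) => //.
    move=> x Ux; rewrite -{1}[f x]sqr_sqrtr ?ltW ?f0 // -[LHS]/(_ * _) expr2 mulfK //.
    by rewrite gt_eqF // sqrtr_gt0 f0.
  exact: Ck_on_scale.
elim: k => [|k IH].
  move=> x Ux; apply: (@continuous_comp _ _ _ (fun x => Num.sqrt (f x)) GRing.inv); last first.
    by apply: inv_continuous; rewrite gt_eqF // sqrtr_gt0 f0.
  apply: (@continuous_comp _ _ _ f Num.sqrt); first exact: (sf 0%N x Ux).
  exact: sqrt_continuous.
apply: (@Ck_on_comp_real _ (fun y => (Num.sqrt y)^-1)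
  (fun y => - 2^-1 * ((Num.sqrt y)^-1 * ((Num.sqrt y)^-1 * (Num.sqrt y)^-1)))) => [x Ux| |].
- have sx : 0 < Num.sqrt (f x) by rewrite sqrtr_gt0 f0.
  apply: is_derive_eq.
    apply: is_deriveV; first by rewrite gt_eqF.
    exact: is_derive1_sqrt (f0 x Ux).
  rewrite -[LHS]/(_ * _); move: (Num.sqrt (f x)) sx => s s0.
  by field; rewrite gt_eqF.
- exact: sf.
- apply: (@Ck_on_scale _ _ (fun=> - 2^-1)); first exact: Ck_on_cst.
  by apply: (@Ck_on_scale _ _ (fun x => (Num.sqrt (f x))^-1)) => //;
     apply: (@Ck_on_scale _ _ (fun x => (Num.sqrt (f x))^-1)).
Qed.

Lemma smooth_sin_cos (f : V -> R) : smooth_on U f ->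
  smooth_on U (fun x => sin (f x)) /\ smooth_on U (fun x => cos (f x)).
Proof.
move=> sf; suff sc k : Ck_on k U (fun x => sin (f x)) /\ Ck_on k U (fun x => cos (f x)).
  by split=> k; have [] := sc k.
elim: k => [|k [IHs IHc]].
  split=> x Ux; (apply: continuous_comp; first exact: (sf 0%N x Ux)).
    exact: continuous_sin.
  exact: continuous_cos.
split.
  exact: (@Ck_on_comp_real _ _ cos).
apply: (@Ck_on_comp_real _ _ (fun y => - sin y)) => //.
apply: Ck_on_comp_linear IHs; last exact: opp_continuous.
by move=> a u v; rewrite opprD scalerN.
Qed.

End OnOpen.
End SmoothFunctions.

(** * Symmetry of second derivatives *)

Section SecondDerivatives.
Context {R : realType} {V : normedModType R}.

(** The mean value theorem along [a] turns the second difference into an increment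
    of the derivative along [a], to which differentiability at [x] applies. *)
Lemma second_difference (f : V -> R) (x a b : V) :
  (\forall y \near x, differentiable f y) ->
  differentiable (fun y => 'd f y a) x ->
  (s ^- 2 * (f (s *: a + (s *: b + x)) - f (s *: a + x)
             - f (s *: b + x) + f x)) @[s --> 0^'+] -->
  'd (fun y => 'd f y a) x b.
Proof.
move=> ndf ddf; set L := 'd _ x.
have /is_diffP[linL _ epsL] := differentiableP ddf.
apply/cvgrPdist_le => e e0.
(* every point visited lies within [s * N] of [x] *)
pose N := `|a| + `|b| + 1.
have N0 : 0 < N by rewrite ltr_wpDl.
have := epsL (e / (2 * N)) (divr_gt0 e0 (mulr_gt0 _ N0)) => /(_ _)/= /[!ltr0n] /(_ isT).
move=> /nbhs_norm0P[d1 /= d10 Hd1].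
have /nbhs_normP[d2 /= d20 Hd2] := ndf.
near=> s.
have s0 : 0 < s by near: s; exact: nbhs_right_gt.
have sN : s * N < d1.
  rewrite -ltr_pdivlMr //; near: s; apply: nbhs_right_lt; exact: divr_gt0.
have sN2 : s * N < d2.
  rewrite -ltr_pdivlMr //; near: s; apply: nbhs_right_lt; exact: divr_gt0.
have small t c : 0 <= t <= s -> 0 <= c <= s -> `|t *: a + c *: b| <= s * N.
  move=> /andP[t0 ts] /andP[c0 cs]; apply: le_trans (ler_normD _ _) _.
  rewrite !normrZ !ger0_norm // /N 2!mulrDr mulr1.
  by apply: ler_wpDr; [exact: ltW|apply: lerD; apply: ler_wpM2r].
pose g t := f (t *: a + (s *: b + x)) - f (t *: a + x).
pose dg t := 'd f (t *: a + (s *: b + x)) a - 'd f (t *: a + x) a.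
have dline y t : differentiable f (t *: a + y) ->
    is_derive t 1 (fun t : R => f (t *: a + y)) ('d f (t *: a + y) a).
  move=> dfy.
  have dl : is_diff t (fun t : R => t *: a + y) ( *:%R^~ a).
    rewrite -[X in is_diff _ _ X]addr0.
    exact: (is_diffD (is_diff_scalel _ _) (is_diff_cst _ _)).
  have dc := is_diff_chain dl (differentiableP dfy).
  apply: DeriveDef; first by apply: diff_derivable; case: dc.
  by rewrite deriveE ?(diff_eq _ dc) ?scale1r //; case: dc.
have dft t c : 0 <= t <= s -> 0 <= c <= s -> differentiable f (t *: a + (c *: b + x)).
  move=> ts cs; apply: Hd2 => /=; rewrite addrA opprD addrCA subrr addr0 normrN.
  exact: le_lt_trans (small _ _ ts cs) sN2.
have s_s : 0 <= s <= s by rewrite lexx ltW.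
have z_s : 0 <= (0 : R) <= s by rewrite lexx ltW.
have dgt t : 0 <= t <= s -> is_derive t 1 g (dg t).
  move=> ts; apply: is_deriveB; apply: dline; first exact: dft.
  by have := dft t 0 ts z_s; rewrite scale0r add0r.
have [c cs gE] : exists2 c, c \in `]0, s[ & g s - g 0 = dg c * (s - 0).
  apply: MVT => //.
    by move=> t; rewrite in_itv => /andP[t0 ts]; apply: dgt; rewrite !ltW.
  apply: derivable_within_continuous => t; rewrite in_itv => ts.
  by have [] := dgt t ts.
have {}cs : 0 <= c <= s by move: cs; rewrite in_itv => /andP[? ?]; rewrite !ltW.
have -> : f (s *: a + (s *: b + x)) - f (s *: a + x) - f (s *: b + x) + f x =
    g s - g 0.
  by rewrite /g !scale0r !add0r; ring.
rewrite gE subr0.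
have P1 : `|dg c - s * L b| <= e * s.
  have near_d t : 0 <= t <= s -> `|'d f (c *: a + (t *: b + x)) a - 'd f x a - L (c *: a + t *: b)| <= e / (2 * N) * (s * N).
    move=> ts; rewrite addrA; apply: le_trans (Hd1 _ _) _ => /=.
      exact: le_lt_trans (small _ _ cs ts) sN.
    by apply: ler_wpM2l; [rewrite divr_ge0 ?mulr_ge0 ?ltW|exact: small].
  have := near_d _ z_s; rewrite scale0r add0r addr0 => h0.
  have := near_d _ s_s => h1.
  have LE : s * L b = L (c *: a + s *: b) - L (c *: a).
    by rewrite -[L]/('d _ x) linearD addrC addKr linearZ.
  have -> : dg c - s * L b =
     ('d f (c *: a + (s *: b + x)) a - 'd f x a - L (c *: a + s *: b))
     - ('d f (c *: a + x) a - 'd f x a - L (c *: a)).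
    by rewrite LE /dg; ring.
  apply: le_trans (ler_normB _ _) _; apply: le_trans (lerD h1 h0) _.
  rewrite le_eqVlt; apply/orP; left; apply/eqP; field; rewrite gt_eqF //.
have -> : L b - s ^- 2 * (dg c * s) = - (s^-1 * (dg c - s * L b)).
  by field; rewrite gt_eqF.
rewrite normrN normrM gtr0_norm ?invr_gt0 // mulrC ler_pdivrMr //.
Unshelve. all: by end_near. Qed.

(** The second difference is symmetric in [a] and [b]. *)
Lemma diff_diff_sym (f : V -> R) (x a b : V) :
  (\forall y \near x, differentiable f y) ->
  differentiable (fun y => 'd f y a) x -> differentiable (fun y => 'd f y b) x ->
  'd (fun y => 'd f y a) x b = 'd (fun y => 'd f y b) x a.
Proof.
move=> ndf da db.
have ca := second_difference (b := b) ndf da; have cb := second_difference (b := a) ndf db.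
rewrite -(cvg_lim _ ca) //; apply: cvg_lim => //; apply: cvg_trans cb; apply: near_eq_cvg; near=> s.
rewrite addrCA; congr (_ * (_ + _)); ring.
Unshelve. all: by end_near. Qed.

End SecondDerivatives.

(** * Differentiability of a continuous inverse *)

Section Inverse.
Context {R : realType}.
Implicit Types V W : normedModType R.

(** For a map with invertible differential at a point, continuity of the inverse
    improves to differentiability.  Changes of charts are of this kind, since the
    inverse of a chart is continuous by definition. *)
Lemma is_diff_inverse V W (f : V -> W) (g B : W -> V) (y : W) :
  {for y, continuous g} -> (\forall z \near y, f (g z) = z) ->
  differentiable f (g y) -> linear B -> continuous B -> cancel ('d f (g y)) B ->
  is_diff y g B.
Proof.
move=> cg fg dfx lB cB AB.
pose Lm := GRing.isLinear.Build _ _ _ _ _ lB.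
pose L : {linear _ -> _} := HB.pack B Lm.
have [k k0 kB] := linear_lipschitz (f := L) cB.
have /is_diffP[linA cA epsA] := differentiableP dfx.
set A := 'd f (g y) in linA cA epsA AB.
have fgy : f (g y) = y by exact: nbhs_singleton fg.
apply/is_diffP; split=> // e e0.
have cg0 : g (h + y) @[h --> (0 : W)] --> g y.
  apply: (@cvg_comp _ _ _ (fun h => h + y) g _ (nbhs y)); last exact: cg.
  exact: cvg_shift0.
have est d : 0 < d -> \forall h \near (0 : W),
    `|h - A (g (h + y) - g y)| <= d * `|g (h + y) - g y|.
  move=> d0; have E := epsA d d0.
  have c0 : g (h + y) - g y @[h --> (0 : W)] --> (0 : V).
    by rewrite -(subrr (g y)); apply: cvgB => //; exact: cvg_cst.
  have fgh : \forall h \near (0 : W), f (g (h + y)) = h + y.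
    exact: (cvg_shift0 fg).
  have := c0 _ E; apply: filterS2 fgh => h /= fgh.
  by rewrite subrK fgy fgh addrK.
have Bdiff h : g (h + y) - g y - B h = - B (h - A (g (h + y) - g y)).
  by rewrite -[B (h - _)]/(L (h - _)) linearB /= AB opprB.
(* A linear bound on the increment of [g] comes first: the error term in [f] is
   small compared with the increment of [g], and absorbing half of that
   increment bounds it by the increment of the argument. *)
have lip : \forall h \near (0 : W), `|g (h + y) - g y| <= 2 * k * `|h|.
  have := est ((2 * k)^-1); rewrite invr_gt0 mulr_gt0 // => /(_ isT) E.
  near=> h; have Eh : `|h - A (g (h + y) - g y)| <= (2 * k)^-1 * `|g (h + y) - g y|.
    by near: h.
  move: (g (h + y) - g y) Eh (Bdiff h) => w Eh BE.
  have Bw : `|w - B h| <= `|w| / 2.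
    rewrite BE normrN; apply: le_trans (kB _) _.
    apply: le_trans (ler_wpM2l (ltW k0) Eh) _.
    by rewrite le_eqVlt; apply/orP; left; apply/eqP; field; rewrite gt_eqF.
  have : `|w| <= `|w| / 2 + k * `|h|.
    rewrite -{1}(subrK (B h) w); apply: le_trans (ler_normD _ _) _.
    by apply: lerD => //; exact: kB.
  lra.
have dk : 0 < e / (2 * k * k) by rewrite divr_gt0 ?mulr_gt0.
near=> h; rewrite Bdiff normrN; apply: le_trans (kB _) _.
have E1 : `|h - A (g (h + y) - g y)| <= e / (2 * k * k) * `|g (h + y) - g y|.
  by near: h; exact: est.
have E2 : `|g (h + y) - g y| <= 2 * k * `|h| by near: h.
apply: le_trans (ler_wpM2l (ltW k0) (le_trans E1 (ler_wpM2l (ltW dk) E2))) _.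
rewrite le_eqVlt; apply/orP; left; apply/eqP; field; rewrite gt_eqF //.
Unshelve. all: by end_near. Qed.

Context {n : nat}.


Lemma injective_rV_inverse (f : 'rV[R]_n -> 'rV[R]_n) : linear f -> injective f ->
  exists g : 'rV[R]_n -> 'rV[R]_n, [/\ linear g, cancel f g & cancel g f].
Proof.
move=> lf inj.
pose Lm := GRing.isLinear.Build _ _ _ _ _ lf.
pose L : {linear _ -> _} := HB.pack f Lm.
pose M := lin1_mx L.
have fE u : f u = u *m M by rewrite mul_rV_lin1.
have uM : M \in unitmx.
  rewrite -row_free_unit; apply/row_freeP; apply/row_freeP.
  apply/inj_row_free => v vM; apply: inj; rewrite !fE vM mul0mx //.
exists (mulmx^~ (invmx M)); split=> [a u v|u|u].
- by rewrite mulmxDl scalemxAl.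
- by rewrite fE mulmxK.
- by rewrite fE mulmxKV.
Qed.

Lemma surjective_rV_injective (f : 'rV[R]_n -> 'rV[R]_n) : linear f ->
  (forall v, exists u, f u = v) -> injective f.
Proof.
move=> lf sur.
pose Lm := GRing.isLinear.Build _ _ _ _ _ lf.
pose L : {linear _ -> _} := HB.pack f Lm.
pose M := lin1_mx L.
have fE u : f u = u *m M by rewrite mul_rV_lin1.
have uM : M \in unitmx.
  rewrite -row_full_unit -sub1mx; apply/row_subP => i.
  by have [u <-] := sur (row i 1%:M); rewrite fE submxMl.
by move=> u v; rewrite !fE => /(congr1 (mulmx^~ (invmx M))); rewrite !mulmxK.
Qed.

End Inverse.

(** * Charts of submanifolds *)

Section ChartHomeo.
Context {R : realType} {M : topologicalType} {n : nat} (c : chart R n M).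
Hypothesis hc : chart_homeo c.

Lemma chart_fwdK m : dom c m -> bwd c (fwd c m) = m.
Proof. by have [[_ h _] _ _ _] := hc => /h[]. Qed.

Lemma chart_cod m : dom c m -> cod c (fwd c m).
Proof. by have [[_ h _] _ _ _] := hc => /h[]. Qed.

Lemma chart_bwdK u : cod c u -> fwd c (bwd c u) = u.
Proof. by have [[_ _ h] _ _ _] := hc => /h[]. Qed.

Lemma chart_dom u : cod c u -> dom c (bwd c u).
Proof. by have [[_ _ h] _ _ _] := hc => /h[]. Qed.

Lemma near_dom (T : topologicalType) (tau : T -> M) w :
  {for w, continuous tau} -> dom c (tau w) -> \forall z \near w, dom c (tau z).
Proof.
move=> ct dw; apply: ct; apply: open_nbhs_nbhs; split=> //.
by have [_ od _ _] := hc.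
Qed.

Lemma near_cod u : cod c u -> \forall z \near u, cod c z.
Proof. by move=> cu; apply: open_nbhs_nbhs; split=> //; have [[]] := hc. Qed.

Lemma chart_fwd_continuous m : dom c m -> {for m, continuous (fwd c)}.
Proof. by have [_ _ h _] := hc; exact: h. Qed.

Lemma chart_bwd_continuous u : cod c u -> {for u, continuous (bwd c)}.
Proof. by have [_ _ _ h] := hc; exact: h. Qed.

End ChartHomeo.

Section Submanifolds.
Context {R : realType}.
Implicit Types V W : normedModType R.

Lemma continuous_set_val (V : topologicalType) (X : set V) :
  continuous (set_val : X -> V).
Proof. exact: initial_continuous. Qed.

Lemma continuous_into (T V : topologicalType) (X : set V) (tau : T -> X) w :
  {for w, continuous (set_val \o tau)} -> {for w, continuous tau}.
Proof.
move=> ct P; rewrite nbhsE => -[B [[U oU UB] Bw] BP].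
rewrite nbhs_filterE; apply: filterS (BP) _.
have : nbhs (set_val (tau w)) U.
  by apply: open_nbhs_nbhs; split=> //; rewrite -UB in Bw.
by rewrite -UB => nU; exact: ct nU.
Qed.

(** [fwd c] lives on the subset [X], where differentiation makes no sense; [Phi]
    are the same coordinates on a neighbourhood in the ambient space. *)
Definition chart_extension V (X : set V) n (c : chart R n X)
    (Phi : V -> 'rV[R]_n) : Prop :=
  forall m, dom c m -> fwd c m = Phi (set_val m) /\
                       differentiable Phi (set_val m).

(** This says that [X] really is a submanifold, and is what makes all the charts
    of its atlas, which are mere parametrized pieces, compatible (see
    [chart_lift]). *)
Definition has_extended_charts V (X : set V) n : Prop :=
  forall m : X, exists c Phi,
    [/\ submanifold_atlas (X := X) (n := n) c, chart_extension c Phi & dom c m].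

(** The parametrization is an immersion because [Phi] inverts it from the left,
    and the coordinates are continuous because [Phi] is. *)
Lemma submanifold_atlas_extension V (X : set V) n (c : chart R n X)
    (Phi : V -> 'rV[R]_n) (O : set V) :
  open (cod c) -> open O -> (forall m, dom c m <-> O (set_val m)) ->
  chart_extension c Phi -> smooth_on (cod c) (set_val \o bwd c) ->
  (forall m, dom c m -> cod c (fwd c m) /\ bwd c (fwd c m) = m) ->
  (forall u, cod c u -> dom c (bwd c u) /\ fwd c (bwd c u) = u) ->
  submanifold_atlas (X := X) (n := n) c.
Proof.
move=> ocod oO domO ext smb fK bK.
have odom : open (dom c).
  rewrite (_ : dom c = set_val @^-1` O); last by apply/seteqP; split=> m /domO.
  by apply: open_comp oO => m _; exact: continuous_set_val.
have neardom m : dom c m -> \forall m' \near m, dom c m'.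
  by move=> dm; exact: open_nbhs_nbhs.
split; [split|by []|] => //.
  - move=> m dm; have [fE dPhi] := ext m dm.
    apply: continuous_near_eq (continuous_comp (continuous_set_val (x := m))
                                 (differentiable_continuous dPhi)).
    near=> m'; rewrite /= (ext m' _).1 //; near: m'; exact: neardom.
  - move=> u cu; apply: continuous_into; exact: (smb 0%N).
move=> u cu; have [du fu] := bK u cu; have [_ dPhi] := ext _ du.
have [dpsi _] := smb 1%N; have {}dpsi := dpsi u cu.
have : is_diff u id ('d Phi (set_val (bwd c u)) \o 'd (set_val \o bwd c) u).
  apply: is_diff_near (is_diff_chain (differentiableP dpsi) (differentiableP dPhi)).
  near=> u'; have cu' : cod c u' by near: u'; exact: open_nbhs_nbhs.
  by have [du' fu'] := bK u' cu'; rewrite /= -(ext _ du').1.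
move=> h a b ab.
have E z : z = 'd Phi (set_val (bwd c u)) ('d (set_val \o bwd c) u z).
  exact: etrans (esym (diff_eq z (is_diff_id u))) (diff_eq z h).
by rewrite [a]E [b]E ab.
Unshelve. all: by end_near. Qed.

(** A map [tau] into [X] that is differentiable as a map into the ambient space is
    differentiable in every chart [c] of the atlas.  This holds in an extended
    chart [e], by composition with [Phi].  The change of charts [f] from [c] to [e]
    is differentiable too, and its differential is injective since that of the
    parametrization [bwd c] factors through it; being square it is invertible,
    and the change of charts from [e] to [c] is the continuous inverse of [f]. *)
Lemma chart_lift V W (X : set V) n (c : chart R n X) (tau : W -> X) w :
  has_extended_charts X n -> submanifold_atlas (X := X) (n := n) c ->
  dom c (tau w) -> differentiable (set_val \o tau) w ->
  differentiable (fwd c \o tau) w /\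
  forall h, 'd (set_val \o bwd c) (fwd c (tau w)) ('d (fwd c \o tau) w h) =
            'd (set_val \o tau) w h.
Proof.
move=> /(_ (tau w))[e [Phi [[he sme inje] ext dew]]] [hc smc injc] dcw dtau.
have ct : {for w, continuous tau}.
  by apply: continuous_into; exact: differentiable_continuous.
set u0 := fwd c (tau w); set y0 := fwd e (tau w).
have cu0 : cod c u0 := chart_cod hc dcw.
have ey0 : cod e y0 := chart_cod he dew.
have bu0 : bwd c u0 = tau w := chart_fwdK hc dcw.
have by0 : bwd e y0 = tau w := chart_fwdK he dew.
have dpsic : differentiable (set_val \o bwd c) u0 by exact: (smc 1%N).1.
have dpsie : differentiable (set_val \o bwd e) y0 by exact: (sme 1%N).1.
pose f := Phi \o set_val \o bwd c.
have fE u : dom e (bwd c u) -> f u = fwd e (bwd c u).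
  by move=> /ext[->].
have fu0 : f u0 = y0 by rewrite fE bu0.
have df : differentiable f u0.
  by apply: differentiable_comp; rewrite ?bu0; [|have [] := ext _ dew].
have nde : \forall u \near u0, dom e (bwd c u).
  by apply: near_dom => //; [exact: chart_bwd_continuous|rewrite bu0].
have injf : injective ('d f u0).
  have : is_diff u0 (set_val \o bwd c) ('d (set_val \o bwd e) y0 \o 'd f u0).
    have De : is_diff (f u0) (set_val \o bwd e) ('d (set_val \o bwd e) y0).
      by rewrite fu0; exact: differentiableP.
    apply: is_diff_near (is_diff_chain (differentiableP df) De).
    near=> u; have deu : dom e (bwd c u) by near: u.
    by rewrite /= fE // chart_fwdK.
  move=> D a b ab; apply: (injc u0 cu0).
  by rewrite !(diff_eq _ D) /= ab.
have [B [linB AB _]] := injective_rV_inverse (linearP _) injf.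
have cB := linear_rV_continuous linB.
pose g := fwd c \o bwd e.
have gy0 : g y0 = u0 by rewrite /g /= by0.
have cg : {for y0, continuous g}.
  apply: continuous_comp; first exact: chart_bwd_continuous.
  by rewrite by0; exact: chart_fwd_continuous.
have ndc : \forall y \near y0, dom c (bwd e y).
  by apply: near_dom => //; [exact: chart_bwd_continuous|rewrite by0].
have fg : \forall y \near y0, f (g y) = y.
  near=> y; have dcy : dom c (bwd e y) by near: y.
  have ey : cod e y by near: y; exact: near_cod.
  by rewrite fE /g /= chart_fwdK // ?chart_bwdK //; exact: chart_dom.
have dg : is_diff y0 g B.
  have dfg : differentiable f (g y0) by rewrite gy0; exact: df.
  have ABg : cancel ('d f (g y0)) B by rewrite gy0; exact: AB.
  exact: (is_diff_inverse cg fg dfg linB cB ABg).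
have dPt : differentiable (Phi \o (set_val \o tau)) w.
  by apply: differentiable_comp; [exact: dtau|exact: (ext _ dew).2].
have [dct _] : is_diff w (fwd c \o tau) (B \o 'd (Phi \o (set_val \o tau)) w).
  have PE : (Phi \o (set_val \o tau)) w = y0 by rewrite /= -(ext _ dew).1.
  rewrite -PE in dg; apply: is_diff_near (is_diff_chain (differentiableP dPt) dg).
  near=> z; have dez : dom e (tau z) by near: z; exact: near_dom.
  by rewrite /g /= -(ext _ dez).1 chart_fwdK.
split; [exact: dct|move=> h].
have D := is_diff_chain (differentiableP dct) (differentiableP dpsic).
apply/esym; apply: (diff_eq h (is_diff_near _ D)).
near=> z; have dcz : dom c (tau z) by near: z; exact: near_dom.
by rewrite /= chart_fwdK.
Unshelve. all: by end_near. Qed.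

End Submanifolds.

(** * Row vectors *)

Section Dot.
Context {R : realType}.

Lemma dotC n (u v : 'rV[R]_n) : dot u v = dot v u.
Proof. by apply: eq_bigr => i _; rewrite mulrC. Qed.

Lemma dotDl n (u v w : 'rV[R]_n) : dot (u + v) w = dot u w + dot v w.
Proof. by rewrite -big_split; apply: eq_bigr => i _; rewrite !mxE mulrDl. Qed.

Lemma dotZl n k (u w : 'rV[R]_n) : dot (k *: u) w = k * dot u w.
Proof. by rewrite /dot mulr_sumr; apply: eq_bigr => i _; rewrite !mxE mulrA. Qed.

Lemma dotDr n (u v w : 'rV[R]_n) : dot w (u + v) = dot w u + dot w v.
Proof. by rewrite ![dot w _]dotC dotDl. Qed.

Lemma dotZr n k (u w : 'rV[R]_n) : dot w (k *: u) = k * dot w u.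
Proof. by rewrite ![dot w _]dotC dotZl. Qed.

Lemma dot0l n (u : 'rV[R]_n) : dot 0 u = 0.
Proof. by rewrite /dot big1 // => i _; rewrite mxE mul0r. Qed.

Lemma dot0r n (u : 'rV[R]_n) : dot u 0 = 0.
Proof. by rewrite dotC dot0l. Qed.

Lemma dotNl n (u w : 'rV[R]_n) : dot (- u) w = - dot u w.
Proof. by rewrite -scaleN1r dotZl mulN1r. Qed.

Lemma dot_delta n (u : 'rV[R]_n) j : dot u (delta_mx 0 j) = u 0 j.
Proof.
rewrite /dot (bigD1 j) //= big1 ?addr0 ?mxE ?eqxx ?mulr1 // => i ij.
by rewrite mxE (negbTE ij) andbF mulr0.
Qed.

Lemma dot_inj n (u v : 'rV[R]_n) : (forall a, dot u a = dot v a) -> u = v.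
Proof. by move=> uv; apply/rowP => j; rewrite -!dot_delta uv. Qed.

Lemma dot_row_mx m n (a c : 'rV[R]_m) (b d : 'rV[R]_n) :
  dot (row_mx a b) (row_mx c d) = dot a c + dot b d.
Proof.
rewrite /dot big_split_ord; congr (_ + _); apply: eq_bigr => i _.
  by rewrite !row_mxEl.
by rewrite !row_mxEr.
Qed.

Lemma dot_ge0 n (u : 'rV[R]_n) : 0 <= dot u u.
Proof. by apply: sumr_ge0 => i _; rewrite -expr2 sqr_ge0. Qed.

Lemma dot_gt0 n (u : 'rV[R]_n) : u != 0 -> 0 < dot u u.
Proof.
move=> u0; rewrite lt_neqAle dot_ge0 andbT eq_sym.
apply: contra u0 => /eqP u0; apply/eqP/rowP => j; rewrite mxE; apply/eqP.
rewrite -sqrf_eq0 expr2; apply/eqP; move: j (erefl true).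
apply: (psumr_eq0P (F := fun j => u 0 j * u 0 j)) => // j _.
by rewrite -expr2 sqr_ge0.
Qed.

Definition put n (i : 'I_n.+1) (a : R) (y : 'rV[R]_n) : 'rV[R]_n.+1 :=
  \row_k oapp (fun j => y 0 j) a (unlift i k).

Lemma put_i n (i : 'I_n.+1) a y : put i a y 0 i = a.
Proof. by rewrite mxE unlift_none. Qed.

Lemma put_lift n (i : 'I_n.+1) a y j : put i a y 0 (lift i j) = y 0 j.
Proof. by rewrite mxE liftK. Qed.

Lemma col'_put n (i : 'I_n.+1) a y : col' i (put i a y) = y.
Proof. by apply/rowP => j; rewrite mxE put_lift. Qed.

Lemma put_col' n (i : 'I_n.+1) (v : 'rV[R]_n.+1) : put i (v 0 i) (col' i v) = v.
Proof.
by apply/rowP => k; rewrite mxE; case: unliftP => [j ->|->] //=; rewrite mxE.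
Qed.

Lemma dot_put n (i : 'I_n.+1) a b y z :
  dot (put i a y) (put i b z) = a * b + dot y z.
Proof.
rewrite /dot (bigD1_ord i) //= !put_i; congr (_ + _).
by apply: eq_bigr => j _; rewrite !put_lift.
Qed.

Lemma putZ n (i : 'I_n.+1) k a y : k *: put i a y = put i (k * a) (k *: y).
Proof. by apply/rowP => j; rewrite !mxE; case: unlift => //= l; rewrite mxE. Qed.

Lemma putD n (i : 'I_n.+1) a b y z :
  put i a y + put i b z = put i (a + b) (y + z).
Proof. by apply/rowP => j; rewrite !mxE; case: unlift => //= l; rewrite mxE. Qed.

Lemma dot_split n (i : 'I_n.+1) (v w : 'rV[R]_n.+1) :
  dot v w = v 0 i * w 0 i + dot (col' i v) (col' i w).
Proof. by rewrite -{1}(put_col' i v) -{1}(put_col' i w) dot_put. Qed.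

End Dot.

Section DifferentialsOfRows.
Context {R : realType}.

Lemma is_diff_lsubmx m n (u : 'rV[R]_(m + n)) :
  is_diff u (fun u => lsubmx u) (fun u => lsubmx u).
Proof.
have lin : linear (fun u : 'rV[R]_(m + n) => lsubmx u) by move=> k x y; rewrite linearP.
exact: is_diff_linear lin (linear_rV_continuous lin).
Qed.

Lemma is_diff_rsubmx m n (u : 'rV[R]_(m + n)) :
  is_diff u (fun u => rsubmx u) (fun u => rsubmx u).
Proof.
have lin : linear (fun u : 'rV[R]_(m + n) => rsubmx u) by move=> k x y; rewrite linearP.
exact: is_diff_linear lin (linear_rV_continuous lin).
Qed.

Lemma is_diff_put1 n (i : 'I_n.+1) (y : 'rV[R]_n) : is_diff y (put i (1 : R)) (put i (0 : R)).
Proof.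
have lin : linear (put i (0 : R) : 'rV[R]_n -> _).
  by move=> k x z; rewrite putZ putD mulr0 addr0.
have -> : put i (1 : R) = cst (put i 1 (0 : 'rV[R]_n)) + put i (0 : R).
  by apply/funext => x; rewrite /= -[RHS]/(_ + _) putD addr0 add0r.
have D := is_diffD (is_diff_cst (put i 1 0) y)
                   (is_diff_linear y lin (linear_rV_continuous lin)).
by apply: (is_diff_eq D); rewrite add0r.
Qed.

Lemma is_diff_dot (T : normedModType R) n (F dF G dG : T -> 'rV[R]_n) w :
  is_diff w F dF -> is_diff w G dG ->
  is_diff w (fun t => dot (F t) (G t))
            (fun h => dot (F w) (dG h) + dot (dF h) (G w)).
Proof.
move=> DF DG.
have -> : (fun h => dot (F w) (dG h) + dot (dF h) (G w)) =
    fun h => \sum_(j < n) (F w 0 j *: dG h 0 j + dF h 0 j *: G w 0 j).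
  by apply/funext => h; rewrite big_split.
apply: is_diff_sumr => j.
have DFj := is_diff_chain DF (is_diff_coord (F w) j).
have DGj := is_diff_chain DG (is_diff_coord (G w) j).
exact: (is_diff_scale DFj DGj).
Qed.

End DifferentialsOfRows.

Section SmoothRows.
Context {R : realType} {V : normedModType R} (U : set V).
Hypothesis oU : open U.

Lemma smooth_id : smooth_on U (fun x : V => x).
Proof. by move=> k; apply: Ck_on_linear => // x; exact: cvg_id. Qed.

Lemma smooth_rV_linear n (W : normedModType R) (l : 'rV[R]_n -> W) (f : V -> 'rV[R]_n) :
  linear l -> smooth_on U f -> smooth_on U (fun x => l (f x)).
Proof.
by move=> ll; apply: smooth_comp_linear => //; exact: linear_rV_continuous.
Qed.

Lemma smooth_lsubmx m n (f : V -> 'rV[R]_(m + n)) :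
  smooth_on U f -> smooth_on U (fun x => lsubmx (f x)).
Proof. by apply: smooth_rV_linear => a u v; rewrite linearP. Qed.

Lemma smooth_rsubmx m n (f : V -> 'rV[R]_(m + n)) :
  smooth_on U f -> smooth_on U (fun x => rsubmx (f x)).
Proof. by apply: smooth_rV_linear => a u v; rewrite linearP. Qed.

Lemma smooth_row_mx m n (f : V -> 'rV[R]_m) (g : V -> 'rV[R]_n) :
  smooth_on U f -> smooth_on U g -> smooth_on U (fun x => row_mx (f x) (g x)).
Proof.
move=> sf sg; apply: smooth_row => // j.
case: (split_ordP j) => k ->.
  have -> : (fun x => row_mx (f x) (g x) 0 (lshift n k)) = fun x => f x 0 k.
    by apply/funext => x; rewrite row_mxEl.
  exact: smooth_coord.
have -> : (fun x => row_mx (f x) (g x) 0 (rshift m k)) = fun x => g x 0 k.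
  by apply/funext => x; rewrite row_mxEr.
exact: smooth_coord.
Qed.

Lemma smooth_col' n (i : 'I_n.+1) (f : V -> 'rV[R]_n.+1) :
  smooth_on U f -> smooth_on U (fun x => col' i (f x)).
Proof.
by apply: smooth_rV_linear => a u v; apply/rowP => j; rewrite !mxE.
Qed.

Lemma smooth_put n (i : 'I_n.+1) (a : V -> R) (f : V -> 'rV[R]_n) :
  smooth_on U a -> smooth_on U f -> smooth_on U (fun x => put i (a x) (f x)).
Proof.
move=> sa sf; apply: smooth_row => // k.
have [j ->|->] := unliftP i k.
  have -> : (fun x => put i (a x) (f x) 0 (lift i j)) = fun x => f x 0 j.
    by apply/funext => x; rewrite put_lift.
  exact: smooth_coord.
have -> // : (fun x => put i (a x) (f x) 0 i) = a.
by apply/funext => x; rewrite put_i.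
Qed.

Lemma smooth_dot n (f g : V -> 'rV[R]_n) :
  smooth_on U f -> smooth_on U g -> smooth_on U (fun x => dot (f x) (g x)).
Proof.
by move=> sf sg; apply: smooth_sum => // i; apply: smoothM => //; exact: smooth_coord.
Qed.

Lemma smooth_differentiable (W : normedModType R) (f : V -> W) x :
  smooth_on U f -> U x -> differentiable f x.
Proof. by move=> /(_ 1%N)[h _]; exact: h. Qed.

Lemma smooth_ext (W : normedModType R) (f g : V -> W) :
  (forall x, U x -> f x = g x) -> smooth_on U f -> smooth_on U g.
Proof. by move=> fg sf k; exact: Ck_on_ext fg (sf k). Qed.

End SmoothRows.

Section Into.
Context {V : Type} {X : set V}.

(** Parametrizations have to be total functions into a subset, so a default point
    is returned outside of it. *)
Definition into (x0 : X) (v : V) : X :=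
  if pselect (X v) is left Xv then SigSub (mem_set Xv) else x0.

Lemma intoK (x0 : X) v : X v -> set_val (into x0 v) = v.
Proof. by rewrite /into; case: pselect. Qed.

Lemma set_valK (x0 m : X) v : set_val m = v -> into x0 v = m.
Proof.
move=> <-; apply: val_inj; apply: intoK; exact: set_mem (valP m).
Qed.

Lemma set_valX (m : X) : X (set_val m).
Proof. exact: set_mem (valP m). Qed.
End Into.

(** * Gnomonic charts of the sphere bundle *)

Section OpenSets.
Context {R : realType} {V : normedModType R}.

Lemma open_pos (f : V -> R) : continuous f -> open [set x | 0 < f x].
Proof.
move=> cf; rewrite (_ : [set x | 0 < f x] = f @^-1` [set y | 0 < y]) //.
by apply: open_comp => //; exact: open_gt.
Qed.

Lemma open_neq0 (f : V -> R) : continuous f -> open [set x | f x != 0].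
Proof.
move=> cf; rewrite (_ : [set x | f x != 0] = f @^-1` [set y | y != 0]) //.
by apply: open_comp => //; exact: open_neq.
Qed.

End OpenSets.

Lemma sign_neq0 (R : realType) (e : R) : e * e = 1 -> e != 0.
Proof.
by move=> ee; apply: contra_eq_neq ee => ->; rewrite mul0r eq_sym oner_neq0.
Qed.

Section GnomonicCharts.
Context {R : realType}.
Local Notation E := ('rV[R]_3 * 'rV[R]_3)%type.

(** Central projection of the sphere onto the plane where the [i]-th entry is 1.
    These coordinates are homogeneous of degree 0 in the velocity, hence rational
    on all nonzero velocities and blind to the reparametrizations of time; this is
    why they are used rather than spherical ones, which moreover miss the poles. *)
Definition gno_map (i : 'I_3) (s : E) : 'rV[R]_5 :=
  row_mx s.1 ((s.2 0 i)^-1 *: col' i s.2).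

Definition gno_scale (e : R) (y : 'rV[R]_2) : R := e / Num.sqrt (1 + dot y y).

Definition gno_pt (i : 'I_3) (e : R) (u : 'rV[R]_5) : E :=
  (@lsubmx R 1 3 2 u,
   gno_scale e (@rsubmx R 1 3 2 u) *: put i 1 (@rsubmx R 1 3 2 u)).

(** [e] is 1 or -1 and selects the hemisphere. *)
Definition gno_chart (m0 : @sphere_bundle R) (i : 'I_3) (e : R) :
    chart R 5 (@sphere_bundle R) :=
  Chart [set m : @sphere_bundle R | 0 < e * (set_val m).2 0 i] setT
    (fun m : @sphere_bundle R => gno_map i (set_val m)) (fun u => into m0 (gno_pt i e u)).

Let one_plus_dot_gt0 (y : 'rV[R]_2) : 0 < 1 + dot y y.
Proof. by rewrite ltr_wpDr // dot_ge0. Qed.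

Let sqrt_pos (y : 'rV[R]_2) : 0 < Num.sqrt (1 + dot y y).
Proof. by rewrite sqrtr_gt0. Qed.

Lemma gno_pt_sphere i e u : e * e = 1 -> sphere_bundle (gno_pt i e u).
Proof.
move=> ee; rewrite /sphere_bundle /gno_pt /gno_scale /=; move: (rsubmx _) => y.
have sy := sqr_sqrtr (ltW (one_plus_dot_gt0 y)).
rewrite dotZl dotZr dot_put mulr1 -[X in _ * (_ * X)]sy.
have := sqrt_pos y; move: (Num.sqrt _) => r r0.
rewrite -[RHS]ee; field; rewrite gt_eqF //.
Qed.

Lemma gno_pt_pos i e u : e * e = 1 -> 0 < e * (gno_pt i e u).2 0 i.
Proof.
move=> ee; rewrite /= mxE put_i mulr1 mulrA ee mul1r invr_gt0 //.
Qed.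

Lemma gno_ptK i e u : e != 0 -> gno_map i (gno_pt i e u) = u.
Proof.
move=> e0; rewrite /gno_map /= mxE put_i mulr1.
have s0 : gno_scale e (@rsubmx R 1 3 2 u) != 0.
  by rewrite mulf_neq0 // invr_neq0 // gt_eqF.
rewrite (_ : col' i _ = gno_scale e (@rsubmx R 1 3 2 u) *: @rsubmx R 1 3 2 u).
  by rewrite scalerA mulVf // scale1r; exact: (@hsubmxK R 1 3 2).
by rewrite putZ col'_put.
Qed.

Lemma gno_mapK i e s : e * e = 1 -> sphere_bundle s -> 0 < e * s.2 0 i ->
  gno_pt i e (gno_map i s) = s.
Proof.
case: s => x v /= ee; rewrite /sphere_bundle /= => vv ev.
have v0 : v 0 i != 0.
  by apply: contraTneq ev => ->; rewrite mulr0 ltxx.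
rewrite /gno_pt /gno_map /=; congr (_, _); first exact: (@row_mxKl R 1 3 2).
rewrite (@row_mxKr R 1 3 2) /gno_scale dotZl dotZr.
rewrite (dot_split i) in vv.
have -> : 1 + (v 0 i)^-1 * ((v 0 i)^-1 * dot (col' i v) (col' i v)) =
    ((e * v 0 i)^-1) ^+ 2.
  have -> : dot (col' i v) (col' i v) = 1 - v 0 i * v 0 i by rewrite -vv addrC addKr.
  by rewrite exprVn expr2 mulrACA ee mul1r; field.
rewrite sqrtr_sqr gtr0_norm ?invr_gt0 // invrK mulrA ee mul1r putZ mulr1.
by rewrite scalerA divff // scale1r put_col'.
Qed.

Lemma continuous_entry2 i (e : R) : continuous (fun s : E => e * s.2 0 i).
Proof.
move=> s; apply: (@continuous_comp _ _ _ (fun s : E => s.2 0 i) ( *%R e)).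
  apply: (@continuous_comp _ _ _ snd (fun v : 'rV[R]_3 => v 0 i)); first exact: cvg_snd.
  exact: coord_continuous.
exact: mulrl_continuous.
Qed.

Lemma gno_map_smooth i (e : R) :
  smooth_on [set s : E | 0 < e * s.2 0 i] (gno_map i).
Proof.
set O := [set s | _]; have oO : open O by apply: open_pos; exact: continuous_entry2.
have s2 : smooth_on O (fun s : E => s.2) by apply: smooth_snd => //; exact: smooth_id.
apply: smooth_row_mx => //; first by apply: smooth_fst => //; exact: smooth_id.
apply: smooth_scale => //; last exact: smooth_col'.
apply: smoothV => //; last exact: smooth_coord.
by move=> s; apply: contraTneq => /= ->; rewrite mulr0 ltxx.
Qed.

Lemma gno_scale_smooth (e : R) :
  smooth_on setT (fun u : 'rV[R]_5 => gno_scale e (@rsubmx R 1 3 2 u)).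
Proof.
have oT := @openT 'rV[R]_5.
have sr := @smooth_rsubmx _ _ _ oT 3 2 _ (smooth_id oT).
apply: smoothM => //; first exact: smooth_cst.
apply: smoothV => //; first by move=> u _; rewrite gt_eqF.
apply: smooth_sqrt => //; apply: smoothD => //; first exact: smooth_cst.
exact: smooth_dot.
Qed.

Lemma gno_pt_smooth i e : smooth_on setT (gno_pt i e).
Proof.
have oT := @openT 'rV[R]_5; have sid := smooth_id oT.
have sr := @smooth_rsubmx _ _ _ oT 3 2 _ sid.
apply: smooth_pair => //; first exact: (@smooth_lsubmx _ _ _ oT 3 2).
apply: smooth_scale => //; first exact: gno_scale_smooth.
by apply: smooth_put => //; exact: smooth_cst.
Qed.

Lemma gno_chart_extension m0 i e : chart_extension (gno_chart m0 i e) (gno_map i).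
Proof.
move=> m /= dm; split=> //; exact: smooth_differentiable (@gno_map_smooth i e) dm.
Qed.

Lemma gno_chart_atlas m0 i e : e * e = 1 ->
  sphere_bundle_atlas R (gno_chart m0 i e).
Proof.
move=> ee; have e0 := sign_neq0 ee.
have valK u : set_val (into m0 (gno_pt i e u)) = gno_pt i e u.
  exact: intoK (gno_pt_sphere i u ee).
apply: (submanifold_atlas_extension (Phi := gno_map i)
          (O := [set s : E | 0 < e * s.2 0 i])) => //.
- exact: openT.
- by apply: open_pos; exact: continuous_entry2.
- exact: gno_chart_extension.
- apply: smooth_ext (@gno_pt_smooth i e); first exact: openT.
  by move=> u _; rewrite /= valK.
- move=> m /= dm; split=> //; apply: set_valK; apply/esym.
  exact: gno_mapK (set_valX m) dm.
- by move=> u _; rewrite /= valK; split; [exact: gno_pt_pos|exact: gno_ptK].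
Qed.

Lemma sphere_bundle_neq0 (m : sphere_bundle (R := R)) : (set_val m).2 != 0.
Proof.
have := set_valX m; rewrite /sphere_bundle /=; case: eqP => // -> /eqP.
by rewrite dot0l eq_sym oner_eq0.
Qed.

Lemma nonzero_entry (v : 'rV[R]_3) : v != 0 ->
  exists i e, e * e = 1 /\ 0 < e * v 0 i.
Proof.
move=> /rV0Pn[i vi]; exists i, (Num.sg (v 0 i)); split.
  by rewrite -expr2 sqr_sg vi.
by rewrite -normrEsg normr_gt0.
Qed.

Lemma sphere_bundle_charts : has_extended_charts (@sphere_bundle R) 5.
Proof.
move=> m; have [i [e [ee ev]]] := nonzero_entry (sphere_bundle_neq0 m).
exists (gno_chart m i e), (gno_map i); split=> //.
  exact: gno_chart_atlas.
exact: gno_chart_extension.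
Qed.

End GnomonicCharts.

(** * Charts of the zero level *)

Section ZeroLevelCharts.
Context {R : realType}.
Local Notation J := (jet R * jet R)%type.

(** On the zero level p_t vanishes and the [i]-th entry of p_v is determined by the
    others where v_i is nonzero: these 12 remaining coordinates are a linear map of
    the ambient space. *)
Definition zl_map (i : 'I_3) (z : J) : 'rV[R]_12 :=
  row_mx (const_mx z.1.1.1 : 'rV[R]_1)
    (row_mx z.1.1.2 (row_mx z.1.2 (row_mx z.2.1.2 (col' i z.2.2)))).

Definition zl_t (u : 'rV[R]_12) : R := (@lsubmx R 1 1 11 u) 0 0.
Definition zl_x (u : 'rV[R]_12) : 'rV[R]_3 := @lsubmx R 1 3 8 (@rsubmx R 1 1 11 u).
Definition zl_v (u : 'rV[R]_12) : 'rV[R]_3 :=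
  @lsubmx R 1 3 5 (@rsubmx R 1 3 8 (@rsubmx R 1 1 11 u)).
Definition zl_px (u : 'rV[R]_12) : 'rV[R]_3 :=
  @lsubmx R 1 3 2 (@rsubmx R 1 3 5 (@rsubmx R 1 3 8 (@rsubmx R 1 1 11 u))).
Definition zl_pv (u : 'rV[R]_12) : 'rV[R]_2 :=
  @rsubmx R 1 3 2 (@rsubmx R 1 3 5 (@rsubmx R 1 3 8 (@rsubmx R 1 1 11 u))).

(** The [i]-th entry is the one that makes this covector orthogonal to [v]. *)
Definition orth (i : 'I_3) (v : 'rV[R]_3) (w : 'rV[R]_2) : 'rV[R]_3 :=
  put i (- (v 0 i)^-1 * dot (col' i v) w) w.

Definition zl_pt (i : 'I_3) (u : 'rV[R]_12) : J :=
  ((zl_t u, zl_x u, zl_v u), (0, zl_px u, orth i (zl_v u) (zl_pv u))).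

Definition zl_chart (z0 : zero_level R) (i : 'I_3) : chart R 12 (zero_level R) :=
  Chart [set z : zero_level R | (set_val z).1.2 0 i != 0] [set u | zl_v u 0 i != 0]
    (fun z => zl_map i (set_val z)) (fun u => into z0 (zl_pt i u)).

Lemma orth_dot i (v : 'rV[R]_3) w : v 0 i != 0 -> dot (orth i v w) v = 0.
Proof.
by move=> v0; rewrite (dot_split i) put_i col'_put (dotC w); field.
Qed.

Lemma orth_col' i (v p : 'rV[R]_3) : v 0 i != 0 -> dot p v = 0 ->
  orth i v (col' i p) = p.
Proof.
move=> v0; rewrite (dot_split i) => /eqP; rewrite addr_eq0 => /eqP pv.
rewrite /orth -[RHS](put_col' i); congr put.
by rewrite (dotC (col' i v)) mulNr -mulrN -pv mulrC mulrK ?unitfE.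
Qed.

Lemma zl_pt_zero_level i u : zl_v u 0 i != 0 -> zero_level R (zl_pt i u).
Proof.
move=> v0; split; last by split=> //; exact: orth_dot.
by rewrite /cotangent_jet /jet_slit /=; apply/rV0Pn; exists i.
Qed.

Lemma zl_mapK i z : zero_level R z -> z.1.2 0 i != 0 -> zl_pt i (zl_map i z) = z.
Proof.
case: z => [[[t x] v] [[pt px] pv]] [_ /= [-> pv0]] v0.
rewrite /zl_pt /zl_t /zl_x /zl_v /zl_px /zl_pv /zl_map /=.
rewrite !(@row_mxKr R 1 1 11, @row_mxKl R 1 1 11, @row_mxKr R 1 3 8, @row_mxKl R 1 3 8).
rewrite !(@row_mxKr R 1 3 5, @row_mxKl R 1 3 5, @row_mxKr R 1 3 2, @row_mxKl R 1 3 2).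
by rewrite mxE orth_col'.
Qed.

Lemma zl_ptK i u : zl_map i (zl_pt i u) = u.
Proof.
rewrite /zl_map /= col'_put.
rewrite (@hsubmxK R 1 3 2) (@hsubmxK R 1 3 5) (@hsubmxK R 1 3 8).
have -> : const_mx (zl_t u) = @lsubmx R 1 1 11 u.
  by apply/rowP => j; rewrite mxE ord1.
exact: (@hsubmxK R 1 1 11).
Qed.

Lemma zl_map_smooth (U : set J) i : open U -> smooth_on U (zl_map i).
Proof.
move=> oU; have sid := smooth_id oU.
have s1 := smooth_fst oU sid; have s2 := smooth_snd oU sid.
have s11 := smooth_fst oU s1; have s21 := smooth_fst oU s2.
apply: (@smooth_row_mx _ _ _ oU 1 11).
  apply: smooth_row => // j.
  have -> : (fun z : J => (const_mx z.1.1.1 : 'rV[R]_1) 0 j) = fun z => z.1.1.1.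
    by apply/funext => z; rewrite mxE.
  exact: smooth_fst.
apply: (@smooth_row_mx _ _ _ oU 3 8); first exact: smooth_snd.
apply: (@smooth_row_mx _ _ _ oU 3 5); first exact: smooth_snd.
apply: (@smooth_row_mx _ _ _ oU 3 2); first exact: smooth_snd.
by apply: smooth_col' => //; exact: smooth_snd.
Qed.

Lemma smooth_orth (V : normedModType R) (U : set V) i
    (v : V -> 'rV[R]_3) (w : V -> 'rV[R]_2) : open U ->
  (forall x, U x -> v x 0 i != 0) ->
  smooth_on U v -> smooth_on U w -> smooth_on U (fun x => orth i (v x) (w x)).
Proof.
move=> oU v0 sv sw; apply: smooth_put => //; apply: smoothM => //.
  by apply: smoothN => //; apply: smoothV => //; exact: smooth_coord.
by apply: smooth_dot => //; exact: smooth_col'.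
Qed.

Lemma smooth_zl_coords (U : set 'rV[R]_12) : open U ->
  [/\ smooth_on U zl_t, smooth_on U zl_x, smooth_on U zl_v, smooth_on U zl_px
    & smooth_on U zl_pv].
Proof.
move=> oU; have sid := smooth_id oU.
have r1 : smooth_on U (fun u : 'rV[R]_12 => @rsubmx R 1 1 11 u).
  exact: (@smooth_rsubmx _ _ _ oU 1 11).
have r2 := @smooth_rsubmx _ _ _ oU 3 8 _ r1.
have r3 := @smooth_rsubmx _ _ _ oU 3 5 _ r2.
split.
- apply: smooth_coord => //; exact: (@smooth_lsubmx _ _ _ oU 1 11).
- exact: (@smooth_lsubmx _ _ _ oU 3 8).
- exact: (@smooth_lsubmx _ _ _ oU 3 5).
- exact: (@smooth_lsubmx _ _ _ oU 3 2).
- exact: (@smooth_rsubmx _ _ _ oU 3 2).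
Qed.

Lemma zl_chart_extension z0 i : chart_extension (zl_chart z0 i) (zl_map i).
Proof.
move=> m dm; split=> //.
exact: smooth_differentiable (@zl_map_smooth setT i openT) _.
Qed.

Lemma zl_chart_atlas z0 i : @zero_level_atlas R (zl_chart z0 i).
Proof.
have valK u : zl_v u 0 i != 0 -> set_val (into z0 (zl_pt i u)) = zl_pt i u.
  by move=> /zl_pt_zero_level; exact: intoK.
have ocod : open [set u : 'rV[R]_12 | zl_v u 0 i != 0].
  apply: open_neq0 => u; have [_ _ sv _ _] := smooth_zl_coords (@openT 'rV[R]_12).
  exact: (smooth_coord openT i sv 0%N).
apply: (submanifold_atlas_extension (Phi := zl_map i)
          (O := [set z : J | z.1.2 0 i != 0])) => //.
- have oT := @openT J.
  apply: open_neq0 => z; apply: (@smooth_coord _ J _ oT _ (fun z => z.1.2) i _ 0%N) => //.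
  by apply: smooth_snd => //; apply: smooth_fst => //; exact: smooth_id.
- exact: zl_chart_extension.
- apply: (@smooth_ext _ _ _ ocod _ (zl_pt i)) => //.
    by move=> u v0; rewrite /= valK.
  have [st sx sv spx spv] := smooth_zl_coords ocod.
  do !apply: smooth_pair => //; first exact: smooth_cst.
  exact: smooth_orth.
- move=> m /= dm; split.
    have := zl_mapK (set_valX m) dm => /(congr1 (fun z : J => z.1.2)) /= E.
    by rewrite E.
  by apply: set_valK; apply/esym; exact: zl_mapK (set_valX m) dm.
- by move=> u v0; rewrite /= valK //; split=> //; exact: zl_ptK.
Qed.

Lemma zero_level_charts : has_extended_charts (zero_level R) 12.
Proof.
move=> m; have [v0 _] := set_valX m; have /rV0Pn[i vi] := v0.
exists (zl_chart m i), (zl_map i); split=> //.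
  exact: zl_chart_atlas.
exact: zl_chart_extension.
Qed.

End ZeroLevelCharts.

(** * Orbits *)

Section Orbits.
Context {R : realType}.
Local Notation J := (jet R * jet R)%type.
Local Notation Z := (zero_level R).
Implicit Types z : Z.

Definition pos z : 'rV[R]_3 := (set_val z).1.1.2.
Definition vel z : 'rV[R]_3 := (set_val z).1.2.
Definition pos_mom z : 'rV[R]_3 := (set_val z).2.1.2.
Definition vel_mom z : 'rV[R]_3 := (set_val z).2.2.

Lemma vel_neq0 z : vel z != 0.
Proof. by have [v0 _] := set_valX z. Qed.

Lemma vel_mom_orth z : dot (vel_mom z) (vel z) = 0.
Proof. by have [_ []] := set_valX z. Qed.

Lemma time_mom0 z : (set_val z).2.1.1 = 0.
Proof. by have [_ []] := set_valX z. Qed.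

Lemma derive1_affine (s t k : R) : derive1 (fun y : R => s + (y - t) * k) = cst k.
Proof.
apply/funext => y; rewrite derive1E; apply: derive_val.
have D1 : is_derive y 1 (fun y : R => y - t) 1.
  by apply: is_derive_eq (is_deriveB _ _) _; rewrite subr0.
have D2 : is_derive y 1 (fun y : R => (y - t) * k) k.
  apply: is_derive_eq (is_deriveM _ _) _.
  by rewrite scaler0 add0r -[LHS]/(k * 1) mulr1.
by apply: is_derive_eq (is_deriveD _ _) _; rewrite add0r.
Qed.

Lemma diff_plus_affine (s t k : R) : 0 < k ->
  diff_plus (fun y : R => s + (y - t) * k).
Proof.
have sm a b c : smooth_on setT (fun y : R => a + (y - b) * c).
  have oT := @openT R; apply: smoothD => //; first exact: smooth_cst.
  apply: (@smoothM _ _ _ oT (fun y => y - b)); last exact: smooth_cst.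
  by apply: smoothD => //; [exact: smooth_id|exact: smooth_cst].
move=> k0; split; first exact: sm.
  by move=> y; rewrite derive1_affine.
exists (fun y => t + (y - s) * k^-1); split; last exact: sm.
  by move=> y; field; rewrite gt_eqF.
by move=> y; field; rewrite gt_eqF.
Qed.

(** Variations of position and velocity suffice to determine the lifted momenta,
    since p_t vanishes on the zero level; the second derivative of [phi] occurs only
    in the derivative with respect to time. *)
Lemma diff_diff_act (phi : R -> R) (q : jet R) (ax av : 'rV[R]_3) :
  smooth_on setT phi -> derive1 phi q.1.1 != 0 ->
  'd (diff_act phi) q (0, ax, av) = (0, ax, (derive1 phi q.1.1)^-1 *: av).
Proof.
move=> sphi phi0; have oT := @openT R.
have dphi y : differentiable phi y by exact: smooth_differentiable sphi _.
have phi'E : derive1 phi = fun y => 'd phi y 1 by apply/funext => y; exact: derive1E'.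
have dphi' y : differentiable (derive1 phi) y.
  by rewrite phi'E; apply: ((sphi 2%N).2 1).1.
have Dt : is_diff q (fun q : jet R => q.1.1) (fun q => q.1.1).
  exact: (is_diff_chain (is_diff_fst q) (is_diff_fst q.1)).
have Dx : is_diff q (fun q : jet R => q.1.2) (fun q => q.1.2).
  exact: (is_diff_chain (is_diff_fst q) (is_diff_snd q.1)).
have D1 := is_diff_chain Dt (differentiableP (dphi q.1.1)).
have Dk0 : differentiable (fun y => (derive1 phi y)^-1) q.1.1.
  exact: (differentiableV (dphi' _) phi0).
have Dk := is_diff_chain Dt (differentiableP Dk0).
have Dv := is_diff_scale Dk (is_diff_snd q).
have D := is_diff_pair (is_diff_pair D1 Dx) Dv.
rewrite (_ : diff_act phi = fun q : jet R =>
   (phi q.1.1, q.1.2, (derive1 phi q.1.1)^-1 *: q.2)) //.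
rewrite (diff_eq _ D) /=; congr (_, _, _); first exact: linear0.
rewrite [X in _ + X *: _](_ : _ = 0) ?scale0r ?addr0 //; exact: linear0.
Qed.

(** A diffeomorphism acts on the velocity through its derivative at one point, and
    conversely affine diffeomorphisms already realize every positive derivative and
    every change of time. *)
Lemma orbitP z z' : Defs.orbit z z' <->
  exists2 k, 0 < k & [/\ pos z' = pos z, vel z' = k *: vel z,
    pos_mom z' = pos_mom z & vel_mom z' = k^-1 *: vel_mom z].
Proof.
split=> [[phi [sphi phi0 _] [z'E pz]]|[k k0 [xE vE pxE pvE]]].
  set q := (set_val z).1 in z'E pz *.
  exists (derive1 phi q.1.1)^-1; first by rewrite invr_gt0.
  have k0 : derive1 phi q.1.1 != 0 by rewrite gt_eqF.
  have ax_av ax av : dot (pos_mom z') ax + (derive1 phi q.1.1)^-1 * dot (vel_mom z') av =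
      dot (pos_mom z) ax + dot (vel_mom z) av.
    have := pz (0, ax, av); rewrite diff_diff_act // /pairing /= !mulr0 !add0r.
    by rewrite dotZr.
  split; rewrite /pos /vel ?z'E //.
    by apply: dot_inj => a; have := ax_av a 0; rewrite !dot0r mulr0 !addr0.
  rewrite invrK; apply: dot_inj => a; rewrite dotZl.
  by have := ax_av 0 a; rewrite !dot0r !add0r => <-; rewrite mulrA divff ?mul1r.
pose t := (set_val z).1.1.1; pose t' := (set_val z').1.1.1.
exists (fun y => t' + (y - t) * k^-1).
  by apply: diff_plus_affine; rewrite invr_gt0.
have E : diff_act (fun y => t' + (y - t) * k^-1) =
    fun q : jet R => (t' + (q.1.1 - t) * k^-1, q.1.2, k *: q.2).
  by apply/funext => q; rewrite /diff_act derive1_affine invrK.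
split.
  rewrite E -/t subrr mul0r addr0 -/(pos z) -/(vel z) -xE -vE /pos /vel /t'.
  by case: (set_val z') => [[[]]].
move=> a; rewrite E; set q := (set_val z).1.
have Dt : is_diff q (fun q : jet R => q.1.1) (fun q => q.1.1).
  exact: (is_diff_chain (is_diff_fst q) (is_diff_fst q.1)).
have Dx : is_diff q (fun q : jet R => q.1.2) (fun q => q.1.2).
  exact: (is_diff_chain (is_diff_fst q) (is_diff_snd q.1)).
have Dv := is_diff_chain (is_diff_snd q) (is_diff_scaler k q.2).
have dphi : differentiable (fun y => t' + (y - t) * k^-1) q.1.1.
  have [sphi _ _] := @diff_plus_affine t' t k^-1 ltac:(by rewrite invr_gt0).
  exact: smooth_differentiable sphi _.
have D1 := is_diff_chain Dt (differentiableP dphi).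
rewrite (diff_eq _ (is_diff_pair (is_diff_pair D1 Dx) Dv)) /pairing /=.
rewrite !time_mom0 !mul0r -/(pos_mom z') -/(vel_mom z') pxE pvE dotZl dotZr.
by rewrite mulrA mulVf ?gt_eqF // mul1r.
Qed.

Lemma rho_eqP z z' : rho z = rho z' <->
  exists2 k, 0 < k & [/\ pos z' = pos z, vel z' = k *: vel z,
    pos_mom z' = pos_mom z & vel_mom z' = k^-1 *: vel_mom z].
Proof.
split=> [zz'|[k k0 [xE vE pxE pvE]]].
  apply/orbitP; have -> : Defs.orbit z = Defs.orbit z' by have := congr1 set_val zz'.
  by apply/orbitP; exists 1 => //; rewrite invr1 !scale1r.
apply: val_inj; apply/seteqP; split=> y /orbitP[l l0 [xyE vyE pxyE pvyE]]; apply/orbitP.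
  exists (l / k); first exact: divr_gt0.
  split; rewrite ?xyE ?xE ?vyE ?vE ?pxyE ?pxE ?pvyE ?pvE // scalerA.
    by rewrite divfK ?gt_eqF.
  by rewrite invf_div mulrAC divff ?gt_eqF // mul1r.
exists (l * k); first exact: mulr_gt0.
split; rewrite ?xyE ?xE ?vyE ?vE ?pxyE ?pxE ?pvyE ?pvE // scalerA //.
by rewrite invfM.
Qed.

Lemma rho_surj (o : orbit_space R) : exists z, rho z = o.
Proof.
have [z _ zo] := set_valX o; exists z; apply: val_inj; exact: zo.
Qed.

End Orbits.

(** * The Liouville form along a map to a cotangent bundle *)

(** The components of a covector in one chart determine those in all others. *)
Lemma cotangent_eq (R : realType) n (M : Type) (A : set (chart R n M))
    (s s' : cotangent A) c :
  (set_val s).1 = (set_val s').1 -> A c -> dom c (set_val s).1 ->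
  (set_val s).2 c = (set_val s').2 c -> s = s'.
Proof.
have [] := set_valX s; have [] := set_valX s'.
case: s => -[m p] ps; case: s' => -[m' p'] ps' /=.
rewrite /set_val /= => p'0 p'c p0 pc mm' Ac dc pcc'; apply: val_inj => /=.
rewrite -mm' in p'0 p'c *; congr pair; apply/funext => d.
have [[Ad dd]|nd] := pselect (A d /\ dom d m); last by rewrite p0 ?p'0.
by apply: dot_inj => a; rewrite (pc d c) // (p'c d c) // pcc'.
Qed.

Lemma dot_row_linear (R : realType) n (f : 'rV[R]_n -> R) a : linear f ->
  dot (\row_j f (delta_mx 0 j)) a = f a.
Proof.
move=> lf; pose Lm := GRing.isLinear.Build _ _ _ _ _ lf.
pose L : {linear _ -> _} := HB.pack f Lm.
rewrite [in RHS](row_sum_delta a) -[f]/(L : _ -> _) linear_sum.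
by apply: eq_bigr => j _; rewrite linearZ mxE mulrC.
Qed.

Section RestrictedCovectors.
Context {R : realType} {V : normedModType R} {X : set V} {n : nat}.
Local Notation A := (submanifold_atlas (X := X) (n := n)).
Hypothesis HX : has_extended_charts X n.

(** The restriction to the tangent space of [X] at [m] of a linear form on the
    ambient space: its components in a chart are its values on the columns of the
    differential of the parametrization, and 0 in the charts away from [m]. *)
Definition restrict (xi : V -> R) (m : X) (c : chart R n X) : 'rV[R]_n :=
  if pselect (A c /\ dom c m) is left _ then
    \row_j xi ('d (set_val \o bwd c) (fwd c m) (delta_mx 0 j))
  else 0.

Lemma dot_restrict (xi : V -> R) m c a : linear xi -> A c -> dom c m ->
  dot (restrict xi m c) a = xi ('d (set_val \o bwd c) (fwd c m) a).
Proof.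
move=> lxi Ac dc; rewrite /restrict; case: pselect => [h|[]//] {h}.
rewrite (@dot_row_linear _ _ (fun a => xi ('d (set_val \o bwd c) (fwd c m) a))) //.
by move=> k u v; rewrite linearP lxi.
Qed.

(** The chain rule for changes of charts, which [chart_lift] provides for
    arbitrary charts of the atlas. *)
Lemma restrict_is_covector xi m : linear xi -> is_covector A m (restrict xi m).
Proof.
move=> lxi; split=> [c nc|c d Ac Ad dc dd a].
  by rewrite /restrict; case: pselect.
rewrite (dot_restrict a lxi Ac dc) (dot_restrict _ lxi Ad dd); congr xi.
have [hc smc _] := Ac; have bK := chart_fwdK hc dc.
have dpsi : differentiable (set_val \o bwd c) (fwd c m).
  exact: ((smc 1%N).1 _ (chart_cod hc dc)).
have ddc : dom d (bwd c (fwd c m)) by rewrite bK.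
have [_ E] := chart_lift HX Ad ddc dpsi.
apply: etrans (esym (E a)) _.
exact: (congr1 (fun m' => 'd (set_val \o bwd d) (fwd d m') _) bK).
Qed.

Definition restrict_cotangent (xi : V -> R) (m : X) (lxi : linear xi) : cotangent A :=
  @SigSub _ _ [set mp : X * (chart R n X -> 'rV[R]_n) | is_covector A mp.1 mp.2]
    (m, restrict xi m) (mem_set (restrict_is_covector m lxi)).

End RestrictedCovectors.

Section LiouvilleAlongMaps.
Context {R : realType} {V W : normedModType R} {X : set V} {n : nat}.
Local Notation A := (submanifold_atlas (X := X) (n := n)).
Hypothesis HX : has_extended_charts X n.
Variable B : V -> V -> R.
Hypothesis linBr : forall p, linear (B p).
Hypothesis B0 : forall v, B 0 v = 0.
Hypothesis diffB : forall (T : normedModType R) (F dF G dG : T -> V) w,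
  is_diff w F dF -> is_diff w G dG ->
  is_diff w (fun z => B (F z) (G z)) (fun h => B (F w) (dG h) + B (dF h) (G w)).

Variables (tau : W -> X) (P : W -> V) (w : W).
Hypothesis dtau : differentiable (set_val \o tau) w.
Hypothesis dP : differentiable P w.
Variables (s : W -> cotangent A).
Hypothesis sE : forall z, set_val (s z) = (tau z, restrict (B (P z)) (tau z)).

(** The pullback of dp dq by a covector field [s] along [tau], when the covectors
    are restrictions of ambient forms [B (P z)].  In coordinates the momenta are
    [B (P z) (D psi (u z) .)] for the parametrization [psi], and differentiating
    them produces second derivatives of [psi], which cancel by symmetry; what
    remains involves ambient quantities only. *)
Lemma cotangent_symplectic_along D : @cotangent_atlas R n X A D -> dom D (s w) ->
  differentiable (fwd D \o s) w /\
  forall a b, cotangent_symplectic D (fwd D (s w)) ('d (fwd D \o s) w a)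
                                     ('d (fwd D \o s) w b) =
    B ('d P w a) ('d (set_val \o tau) w b) -
    B ('d P w b) ('d (set_val \o tau) w a).
Proof.
move=> [bijD [c Ac [domD codD coordD]]] dDs.
have [hc smc _] := Ac.
have dc : dom c (tau w) by have := dDs; rewrite domD /= sE.
have [du Eu] := chart_lift HX Ac dc dtau.
set u := fwd c \o tau in du Eu *; set psi := set_val \o bwd c in Eu.
have cuw : cod c (u w) := chart_cod hc dc.
have ct : {for w, continuous tau}.
  by apply: continuous_into; exact: differentiable_continuous.
pose p z : 'rV[R]_n := restrict (B (P z)) (tau z) c.
have pE z a : dom c (tau z) -> dot (p z) a = B (P z) ('d psi (u z) a).
  by move=> dz; exact: dot_restrict.
have ndc : \forall z \near w, dom c (tau z) by exact: near_dom.
have dpsi a : differentiable (fun x => 'd psi x a) (u w).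
  exact: ((smc 2%N).2 a).1.
pose dp h a := B (P w) ('d (fun x => 'd psi x a) (u w) ('d u w h)) +
               B ('d P w h) ('d psi (u w) a).
have Dp a : is_diff w (fun z => dot (p z) a) (fun h => dp h a).
  have D1 := is_diff_chain (differentiableP du) (differentiableP (dpsi a)).
  apply: is_diff_near (diffB (differentiableP dP) D1).
  by near=> z; rewrite pE //; near: z.
have Dprow : is_diff w p (fun h => \row_j dp h (delta_mx 0 j)).
  apply: is_diff_row => j.
  have -> : (fun z => p z 0 j) = fun z => dot (p z) (delta_mx 0 j).
    by apply/funext => z; rewrite dot_delta.
  have -> : (fun v => (\row_j0 dp v (delta_mx 0 j0)) 0 j) = fun v => dp v (delta_mx 0 j).
    by apply/funext => v; rewrite mxE.
  exact: Dp.
have DK : is_diff w (fwd D \o s) (fun h => row_mx ('d u w h) (\row_j dp h (delta_mx 0 j))).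
  apply: (@is_diff_near _ _ _ (fun z => row_mx (u z) (p z))).
    near=> z; have dz : dom c (tau z) by near: z.
    have dDz : dom D (s z) by rewrite domD /= sE.
    have [_ fE mE] := coordD _ dDz.
    by rewrite /= -[RHS]hsubmxK -fE -mE sE.
  apply: is_diff_row => j; case: (split_ordP j) => k ->.
    have -> : (fun z => row_mx (u z) (p z) 0 (lshift n k)) = fun z => u z 0 k.
      by apply/funext => z; rewrite row_mxEl.
    have -> : (fun h => row_mx ('d u w h) (\row_j0 dp h (delta_mx 0 j0)) 0 (lshift n k)) =
       fun h => 'd u w h 0 k by apply/funext => z; rewrite row_mxEl.
    exact: (is_diff_chain (differentiableP du) (is_diff_coord _ k)).
  have -> : (fun z => row_mx (u z) (p z) 0 (rshift n k)) = fun z => p z 0 k.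
    by apply/funext => z; rewrite row_mxEr.
  have -> : (fun h => row_mx ('d u w h) (\row_j0 dp h (delta_mx 0 j0)) 0 (rshift n k)) =
     fun h => (\row_j0 dp h (delta_mx 0 j0)) 0 k by apply/funext => z; rewrite row_mxEr.
  exact: (is_diff_chain Dprow (is_diff_coord _ k)).
split; first by have [] := DK.
move=> a b; rewrite !(diff_eq _ DK).
have dot_dp h v : dot (\row_j dp h (delta_mx 0 j)) v = dp h v.
  have := diff_eq h (Dp v) => <-.
  have Dd : is_diff w (fun z => dot (p z) v)
     (fun h => dot (\row_j dp h (delta_mx 0 j)) v).
    have lin : linear (fun y : 'rV[R]_n => dot y v) by move=> k x y; rewrite dotDl dotZl.
    exact: (is_diff_chain Dprow (is_diff_linear (p w) lin (linear_rV_continuous lin))).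
  by rewrite (diff_eq h Dd).
have derL h x : 'D_h (fun u' : 'rV[R]_(n + n) => @liouville R n X A D u' x) (fwd D (s w)) =
    dot (rsubmx h) (lsubmx x).
  have lin : linear (fun u' : 'rV[R]_(n + n) => dot (rsubmx u') (lsubmx x)).
    by move=> k y z; rewrite linearP dotDl dotZl.
  have Dl := is_diff_linear (fwd D (s w)) lin (linear_rV_continuous lin).
  by rewrite deriveE ?(diff_eq h Dl) //; have [] := Dl.
pose Q h k := B (P w) ('d (fun x => 'd psi x ('d u w k)) (u w) ('d u w h)).
have dpE h k : dp h ('d u w k) = Q h k + B ('d P w h) ('d (set_val \o tau) w k).
  by congr (_ + B _ _); exact: Eu.
rewrite /cotangent_symplectic /ext_d !derL !row_mxKl !row_mxKr !dot_dp.
rewrite (dpE a b) (dpE b a).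
(* [Q] collects the second derivatives of the parametrization, contracted with
   the momentum at [w]: they are those of the real function [g]. *)
have sym : Q a b = Q b a.
  rewrite /Q.
  pose g x := B (P w) (psi x).
  have dg x : cod c x -> is_diff x g (fun h => B (P w) ('d psi x h)).
    move=> cx; have dx : differentiable psi x by exact: ((smc 1%N).1 _ cx).
    have := diffB (is_diff_cst (P w) x) (differentiableP dx).
    rewrite (_ : (fun h => _ + _) = fun h => B (P w) ('d psi x h)) //.
    apply/funext => h; rewrite [X in _ + X](_ : _ = 0) ?addr0 //; exact: B0.
  have dgh h : \forall x \near u w, 'd g x h = B (P w) ('d psi x h).
    near=> x; have cx : cod c x by near: x; exact: near_cod.
    exact: diff_eq h (dg x cx).
  have dBh h : is_diff (u w) (fun x => 'd g x h)
     (fun k => B (P w) ('d (fun x => 'd psi x h) (u w) k)).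
    apply: (@is_diff_near _ _ _ (fun x => B (P w) ('d psi x h))).
      by apply: filterS (dgh h).
    have := diffB (is_diff_cst (P w) (u w)) (differentiableP (dpsi h)).
    rewrite (_ : (fun h => _ + _) = fun k => B (P w) ('d (fun x => 'd psi x h) (u w) k)) //.
    apply/funext => k; rewrite [X in _ + X](_ : _ = 0) ?addr0 //; exact: B0.
  rewrite -(diff_eq _ (dBh ('d u w b))) -(diff_eq _ (dBh ('d u w a))).
  apply: diff_diff_sym.
  - near=> x; have cx : cod c x by near: x; exact: near_cod.
    by have [] := dg x cx.
  - by have [] := dBh ('d u w b).
  - by have [] := dBh ('d u w a).
rewrite sym; ring.
Unshelve. all: by end_near. Qed.

End LiouvilleAlongMaps.

(** * The map from the zero level to the cotangent bundle *)

Section Kappa.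
Context {R : realType}.
Local Notation E := ('rV[R]_3 * 'rV[R]_3)%type.
Local Notation J := (jet R * jet R)%type.
Local Notation Z := (zero_level R).
Local Notation S := (@sphere_bundle R).
Local Notation AS := (sphere_bundle_atlas R).
Implicit Types z : Z.

Definition pair_dot (p v : E) : R := dot p.1 v.1 + dot p.2 v.2.

Lemma pair_dot_linear p : linear (pair_dot p).
Proof.
move=> k u v; rewrite /pair_dot /= !dotDr !dotZr -[k *: _]/(k * _).
by rewrite mulrDr addrACA.
Qed.

Lemma pair_dot0 v : pair_dot 0 v = 0.
Proof. by rewrite /pair_dot /= !dot0l addr0. Qed.

Lemma is_diff_pair_dot (T : normedModType R) (F dF G dG : T -> E) w :
  is_diff w F dF -> is_diff w G dG ->
  is_diff w (fun t => pair_dot (F t) (G t))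
            (fun h => pair_dot (F w) (dG h) + pair_dot (dF h) (G w)).
Proof.
move=> DF DG.
have D1 := is_diff_dot (is_diff_chain DF (is_diff_fst (F w)))
                       (is_diff_chain DG (is_diff_fst (G w))).
have D2 := is_diff_dot (is_diff_chain DF (is_diff_snd (F w)))
                       (is_diff_chain DG (is_diff_snd (G w))).
have D : is_diff w (fun t => pair_dot (F t) (G t)) _ := is_diffD D1 D2.
apply: (is_diff_eq D).
by apply/funext => h; rewrite /pair_dot -[LHS]/(_ + _ + (_ + _)) addrACA.
Qed.

Definition speed z : R := Num.sqrt (dot (vel z) (vel z)).

Lemma speed_gt0 z : 0 < speed z.
Proof. by rewrite sqrtr_gt0 dot_gt0 // vel_neq0. Qed.

Lemma speed_neq0 z : speed z != 0.
Proof. by rewrite gt_eqF // speed_gt0. Qed.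

Lemma speedK z : speed z * speed z = dot (vel z) (vel z).
Proof. by rewrite -expr2 sqr_sqrtr // dot_ge0. Qed.

Lemma base_subproof z : sphere_bundle (pos z, (speed z)^-1 *: vel z).
Proof.
rewrite /sphere_bundle /= dotZl dotZr -speedK.
by have := speed_neq0 z => s0; field.
Qed.

Definition base z : S := SigSub (mem_set (base_subproof z)).

Lemma baseE z : set_val (base z) = (pos z, (speed z)^-1 *: vel z).
Proof. by []. Qed.

(** Scaling the velocity by k scales p_v by 1/k, so that |v| p_v is a function on
    the orbit space, and p_v dv = |v| p_v d(v/|v|) because p_v is orthogonal to v. *)
Definition cov z : E := (pos_mom z, speed z *: vel_mom z).

(** The covector p_x dx + |v| p_v de at (x, e), where e = v/|v|. *)
Definition kap z : cotangent AS :=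
  restrict_cotangent sphere_bundle_charts (base z) (pair_dot_linear (cov z)).

Lemma kapE z : set_val (kap z) = (base z, restrict (pair_dot (cov z)) (base z)).
Proof. by []. Qed.

Lemma kap_orbit z z' : rho z = rho z' -> kap z = kap z'.
Proof.
move=> /rho_eqP[k k0 [xE vE pxE pvE]].
have sE : speed z' = k * speed z.
  rewrite /speed vE dotZl dotZr mulrA sqrtrM ?mulr_ge0 ?ltW //.
  by rewrite -expr2 sqrtr_sqr gtr0_norm.
have bE : base z' = base z.
  apply: val_inj; rewrite /= xE vE sE scalerA; congr (_, _ *: _).
  by have := speed_neq0 z => s0; field; rewrite s0 gt_eqF.
have cE : cov z' = cov z.
  rewrite /cov pxE pvE sE scalerA; congr (_, _ *: _).
  by field; rewrite gt_eqF.
by apply: val_inj; rewrite /= bE cE.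
Qed.

Lemma gno_mapZ i (x v : 'rV[R]_3) k : k != 0 ->
  gno_map i (x, k *: v) = gno_map i (x, v).
Proof.
move=> k0; rewrite /gno_map /=.
have -> : (k *: v) 0 i = k * v 0 i by rewrite mxE.
have -> : col' i (k *: v) = k *: col' i v by apply/rowP => j; rewrite !mxE.
by rewrite scalerA invfM mulrAC mulVf // mul1r.
Qed.

Lemma gno_map_base i z : gno_map i (set_val (base z)) = gno_map i (pos z, vel z).
Proof. by rewrite baseE gno_mapZ // invr_neq0 // speed_neq0. Qed.

Lemma gno_dom_base m0 i e z :
  dom (gno_chart m0 i e) (base z) = is_true (0 < e * vel z 0 i).
Proof.
have -> : dom (gno_chart m0 i e) (base z) =
  is_true (0 < e * (set_val (base z)).2 0 i) by [].
by rewrite baseE [X in _ * X]mxE mulrCA pmulr_rgt0 // invr_gt0 speed_gt0.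
Qed.

(** The derivative of the normalizing factor is left unspecified: it multiplies a
    vector parallel to the velocity, which the momentum annihilates. *)
Lemma diff_gno_pt i e (u a : 'rV[R]_5) : exists d : R,
  'd (gno_pt i e) u a =
  (@lsubmx R 1 3 2 a,
   gno_scale e (@rsubmx R 1 3 2 u) *: put i 0 (@rsubmx R 1 3 2 a) +
   d *: put i 1 (@rsubmx R 1 3 2 u)).
Proof.
have Dr := @is_diff_rsubmx R 3 2 u.
have dsc : differentiable (fun u : 'rV[R]_5 => gno_scale e (@rsubmx R 1 3 2 u)) u.
  exact: smooth_differentiable (gno_scale_smooth e) _.
exists ('d (fun u : 'rV[R]_5 => gno_scale e (@rsubmx R 1 3 2 u)) u a).
have D2 := is_diff_scale (differentiableP dsc) (is_diff_chain Dr (is_diff_put1 i _)).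
exact: (diff_eq a (is_diff_pair (@is_diff_lsubmx R 3 2 u) D2)).
Qed.

(** In slopes y the velocity is v = v_i (1, y), and p_v annihilates v; hence
    p_v dv = v_i p_v dy, a formula without square roots. *)
Lemma restrict_gno m0 i e z : e * e = 1 -> 0 < e * vel z 0 i ->
  restrict (pair_dot (cov z)) (base z) (gno_chart m0 i e) =
  row_mx (pos_mom z) (vel z 0 i *: col' i (vel_mom z)) :> 'rV[R]_(3 + 2).
Proof.
move=> ee ev; set c := gno_chart m0 i e.
have Ac : AS c by exact: gno_chart_atlas.
have dc : dom c (base z) by rewrite gno_dom_base.
apply: dot_inj => a; apply: etrans (dot_restrict a (pair_dot_linear _) Ac dc) _.
have psiE : set_val \o bwd c = gno_pt i e.
  by apply/funext => u /=; rewrite intoK //; exact: gno_pt_sphere.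
rewrite psiE; set u := fwd c (base z).
have [d ->] := diff_gno_pt i e u a.
have gu : gno_pt i e u = set_val (base z).
  exact: gno_mapK ee (set_valX (base z)) dc.
have [_ gv] : gno_pt i e u = (pos z, (speed z)^-1 *: vel z) by [].
move: gv; set y := @rsubmx R 1 3 2 u => gv.
have gvi : gno_scale e y = (speed z)^-1 * vel z 0 i.
  by have := congr1 (fun w : 'rV[R]_3 => w 0 i) gv; rewrite /= [LHS]mxE [RHS]mxE put_i mulr1.
have g0 : gno_scale e y != 0.
  by rewrite gvi mulf_neq0 ?invr_neq0 ?speed_neq0 //; apply: contraTneq ev => ->; rewrite mulr0 ltxx.
have orth1 : dot (vel_mom z) (put i 1 y) = 0.
  have := congr1 (dot (vel_mom z)) gv; rewrite !dotZr vel_mom_orth mulr0 => /eqP.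
  by rewrite mulf_eq0 (negbTE g0) => /eqP.
rewrite /pair_dot /= dotDr !dotZl !dotZr orth1 !mulr0 addr0 gvi.
rewrite -[in RHS](@hsubmxK R 1 3 2 a) dot_row_mx; congr (_ + _).
rewrite (dot_split i) put_i col'_put mulr0 add0r dotZl.
by rewrite !mulrA divff ?mul1r // speed_neq0.
Qed.

End Kappa.

(** * Coordinates and sections of the reduction *)

Section Sections.
Context {R : realType}.
Local Notation J := (jet R * jet R)%type.
Local Notation Z := (zero_level R).
Local Notation S := (@sphere_bundle R).
Local Notation AS := (sphere_bundle_atlas R).
Implicit Types z : Z.

(** The image under [kap] in gnomonic coordinates: (x, v_j / v_i, p_x, v_i p_j) with
    j different from i.  It is rational in the ambient coordinates. *)
Definition red_map (i : 'I_3) (q : J) : 'rV[R]_(5 + 5) :=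
  row_mx (gno_map i (q.1.1.2, q.1.2))
         (row_mx q.2.1.2 (q.1.2 0 i *: col' i q.2.2) : 'rV[R]_(3 + 2)).

(** For each [t] and [w], a polynomial section of [red_map]; [w] is the [i]-th entry
    of the velocity.  Letting [t] and [w] vary, every point of the zero level lies on
    such a section ([sec_red_map]). *)
Definition sec (i : 'I_3) (t w : R) (u : 'rV[R]_(5 + 5)) : J :=
  let y := @rsubmx R 1 3 2 (lsubmx u) in let p := @rsubmx R 1 3 2 (rsubmx u) in
  ((t, @lsubmx R 1 3 2 (lsubmx u), w *: put i 1 y),
   (0, @lsubmx R 1 3 2 (rsubmx u), w^-1 *: put i (- dot y p) p)).

Lemma sec_zero_level i t w u : w != 0 -> zero_level R (sec i t w u).
Proof.
move=> w0; split.
  apply/rV0Pn; exists i => /=.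
  by rewrite [X in X != _]mxE put_i mulr1.
split=> //=; rewrite dotZl dotZr dot_put (dotC (rsubmx _)) mulr1 addNr.
by rewrite !mulr0.
Qed.

Lemma red_map_sec i t w u : w != 0 -> red_map i (sec i t w u) = u.
Proof.
move=> w0; rewrite /red_map /sec /= gno_mapZ //.
have -> : (w *: put i 1 (@rsubmx R 1 3 2 (lsubmx u))) 0 i = w.
  by rewrite mxE put_i mulr1.
have -> v p a : col' i (v *: put i a p) = v *: p :> 'rV[R]_2.
  by rewrite putZ col'_put.
rewrite scalerA divff // scale1r /gno_map /= put_i col'_put invr1 scale1r.
by rewrite (@hsubmxK R 1 3 2) (@hsubmxK R 1 3 2) hsubmxK.
Qed.

Lemma sec_red_map i q : zero_level R q -> q.1.2 0 i != 0 ->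
  sec i q.1.1.1 (q.1.2 0 i) (red_map i q) = q.
Proof.
case: q => [[[t x] v] [[pt px] pv]] [_ /= [-> pv0]] v0.
rewrite /sec /red_map /= !row_mxKl !row_mxKr /gno_map /=.
rewrite ?(@row_mxKl R 1 3 2) ?(@row_mxKr R 1 3 2).
rewrite !putZ mulr1 !scalerA divff // mulVf // !scale1r put_col'.
congr (_, (_, _)).
rewrite -[RHS](orth_col' v0 pv0) /orth; congr put.
by rewrite dotZl dotZr; field.
Qed.

Lemma sec_smooth i t w : smooth_on setT (sec i t w).
Proof.
have oT := @openT 'rV[R]_(5 + 5); have sid := smooth_id oT.
have sl := smooth_lsubmx oT sid; have sr := smooth_rsubmx oT sid.
have sll := @smooth_lsubmx _ _ _ oT 3 2 _ sl.
have slr := @smooth_rsubmx _ _ _ oT 3 2 _ sl.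
have srl := @smooth_lsubmx _ _ _ oT 3 2 _ sr.
have srr := @smooth_rsubmx _ _ _ oT 3 2 _ sr.
apply: smooth_pair => //; apply: smooth_pair => //.
- by apply: smooth_pair => //; exact: smooth_cst.
- apply: smooth_scale => //; first exact: smooth_cst.
  by apply: smooth_put => //; exact: smooth_cst.
- by apply: smooth_pair => //; exact: smooth_cst.
- apply: smooth_scale => //; first exact: smooth_cst.
  by apply: smooth_put => //; apply: smoothN => //; exact: smooth_dot.
Qed.

Lemma red_map_smooth (V : normedModType R) (U : set V) (q : V -> J) i :
  open U -> (forall x, U x -> (q x).1.2 0 i != 0) -> smooth_on U q ->
  smooth_on U (fun x => red_map i (q x)).
Proof.
move=> oU v0 sq.
have s1 := smooth_fst oU sq; have s2 := smooth_snd oU sq.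
have s11 := smooth_fst oU s1; have s21 := smooth_fst oU s2.
have sv := smooth_snd oU s1; have sx := smooth_snd oU s11.
have spv := smooth_snd oU s2; have spx := smooth_snd oU s21.
have svi := smooth_coord oU i sv.
apply: smooth_row_mx => //.
  apply: (@smooth_row_mx _ _ _ oU 3 2) => //.
  by apply: smooth_scale => //; [exact: smoothV|exact: smooth_col'].
apply: (@smooth_row_mx _ _ _ oU 3 2) => //.
by apply: smooth_scale => //; exact: smooth_col'.
Qed.

Lemma kap_coords m0 i e z : e * e = 1 -> 0 < e * vel z 0 i ->
  row_mx (fwd (gno_chart m0 i e) (set_val (kap z)).1)
         ((set_val (kap z)).2 (gno_chart m0 i e)) = red_map i (set_val z).
Proof.
move=> ee ev; rewrite kapE /red_map -(restrict_gno m0 ee ev).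
by congr row_mx; exact: gno_map_base.
Qed.

(** Equal images have proportional velocities, with factor k the quotient of the
    speeds.  The gnomonic momenta v_i p_j then agree, which scales the momenta
    by 1/k; the remaining entry of p_v is determined by orthogonality to v. *)
Lemma kap_inj z z' : kap z = kap z' -> rho z = rho z'.
Proof.
move=> kk.
have bb : base z = base z' by have := congr1 (fun s => (set_val s).1) kk.
have [xx vv] : pos z = pos z' /\ (speed z)^-1 *: vel z = (speed z')^-1 *: vel z'.
  by have := congr1 set_val bb; rewrite !baseE => -[-> ->].
pose k := speed z' / speed z.
have k0 : 0 < k by rewrite divr_gt0 // speed_gt0.
have kn0 : k != 0 by rewrite gt_eqF.
have vE : vel z' = k *: vel z.
  by rewrite -scalerA vv scalerA divff ?scale1r // speed_neq0.
have [i [e [ee ev]]] := nonzero_entry (vel_neq0 z).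
have ev' : 0 < e * vel z' 0 i by rewrite vE mxE mulrCA mulr_gt0.
have vi0 : vel z 0 i != 0 by apply: contraTneq ev => ->; rewrite mulr0 ltxx.
have vi0' : vel z' 0 i != 0 by apply: contraTneq ev' => ->; rewrite mulr0 ltxx.
have := congr1 (fun s => (set_val s).2 (gno_chart (base z) i e)) kk.
rewrite !kapE /= (restrict_gno (base z) ee ev) (restrict_gno (base z) ee ev').
move=> /(@eq_row_mx _ _ 3 2 _ _ _ _)[pxx pvv].
apply/rho_eqP; exists k => //; split=> //.
have o' : dot (k^-1 *: vel_mom z) (vel z') = 0.
  by rewrite vE dotZl dotZr vel_mom_orth !mulr0.
rewrite -(orth_col' vi0' (vel_mom_orth z')) -(orth_col' vi0' o'); congr orth.
have -> : col' i (k^-1 *: vel_mom z) = k^-1 *: col' i (vel_mom z).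
  by apply/rowP => j; rewrite !mxE.
apply: (scalerI vi0'); rewrite -pvv vE mxE scalerA; congr (_ *: _).
by field.
Qed.

Definition kappa (o : orbit_space R) : cotangent AS := kap (projT1 (cid (rho_surj o))).

Lemma kappa_rho z : kappa (rho z) = kap z.
Proof. by rewrite /kappa; case: cid => z' /= /kap_orbit. Qed.

Lemma kappa_inj : injective kappa.
Proof.
move=> o o'; have [z <-] := rho_surj o; have [z' <-] := rho_surj o'.
by rewrite !kappa_rho; exact: kap_inj.
Qed.

End Sections.

Section GnomonicOrbitCharts.
Context {R : realType}.
Local Notation J := (jet R * jet R)%type.
Local Notation Z := (zero_level R).
Local Notation S := (@sphere_bundle R).
Local Notation AS := (sphere_bundle_atlas R).
Variables (z0 : Z) (i : 'I_3) (e : R).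
Hypothesis ee : e * e = 1.

Let e0 := sign_neq0 ee.

Local Notation c := (gno_chart (base z0) i e).

Definition zsec t w (u : 'rV[R]_(5 + 5)) : Z := into z0 (sec i t w u).

Lemma zsecE t w u : w != 0 -> set_val (zsec t w u) = sec i t w u.
Proof. by move=> w0; apply: intoK; exact: sec_zero_level. Qed.

Lemma vel_zsec t w u : w != 0 -> vel (zsec t w u) 0 i = w.
Proof. by move=> w0; rewrite /vel zsecE //= mxE put_i mulr1. Qed.

Definition cot_chart : chart R (5 + 5) (cotangent AS) :=
  Chart [set s : cotangent AS | dom c (set_val s).1] setT
    (fun s => row_mx (fwd c (set_val s).1) ((set_val s).2 c))
    (fun u => kap (zsec 0 e u)).

Lemma cot_chart_dom z : dom cot_chart (kap z) = is_true (0 < e * vel z 0 i).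
Proof. exact: gno_dom_base. Qed.

Lemma cot_chart_kap z : 0 < e * vel z 0 i ->
  fwd cot_chart (kap z) = red_map i (set_val z).
Proof. exact: kap_coords. Qed.

(** The section gives a right inverse; it is a left inverse as well because a
    covector is determined by its base point and its components in one chart. *)
Lemma cot_chart_bij : chart_bij cot_chart.
Proof.
have eu u : 0 < e * vel (zsec 0 e u) 0 i by rewrite vel_zsec // ee.
have bK u : fwd cot_chart (bwd cot_chart u) = u.
  by rewrite [bwd _ _]/= cot_chart_kap // zsecE // red_map_sec.
have bd u : dom cot_chart (bwd cot_chart u) by rewrite [bwd _ _]/= cot_chart_dom.
split=> [|s ds|u _]; [exact: openT| |by split].
split=> //; have Ac : AS c by exact: gno_chart_atlas.
have [hc _ _] := Ac.
have /eq_row_mx[fE pE] := bK (fwd cot_chart s).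
apply: (cotangent_eq (c := c)) => //.
  by rewrite -(chart_fwdK hc ds) -fE chart_fwdK //; exact: bd.
exact: bd.
Qed.

Lemma cot_chart_atlas : cotangent_atlas (A := AS) cot_chart.
Proof.
split; first exact: cot_chart_bij.
exists c; first exact: gno_chart_atlas.
split=> //.
by move=> s ds; split=> //=; rewrite ?row_mxKl ?row_mxKr.
Qed.

(** A chart of the cotangent bundle transported by [kappa]; its inverse is computed
    through a section, which makes it continuous for the quotient topology. *)
Definition orb_chart : chart R 10 (orbit_space R) :=
  Chart [set o | dom cot_chart (kappa o)] setT
    (fun o => fwd cot_chart (kappa o)) (fun u => rho (zsec 0 e u)).

Lemma orb_chart_dom z : dom orb_chart (rho z) = is_true (0 < e * vel z 0 i).
Proof. by rewrite -cot_chart_dom -kappa_rho. Qed.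

Lemma orb_chart_rho z : 0 < e * vel z 0 i ->
  fwd orb_chart (rho z) = red_map i (set_val z).
Proof. by move=> ev; rewrite -cot_chart_kap // -kappa_rho. Qed.

End GnomonicOrbitCharts.

(** * Charts of the orbit space *)

Section OrbitSpaceTopology.
Context {R : realType}.
Local Notation J := (jet R * jet R)%type.
Local Notation Z := (zero_level R).
Local Notation AZ := (@zero_level_atlas R).

Lemma rho_continuous : continuous (@rho R).
Proof. by apply/continuousP => O oO; exact: oO. Qed.

Lemma continuous_from_quotient (T : topologicalType) (D : set (orbit_space R))
    (f : orbit_space R -> T) (z : Z) :
  open D -> (forall z, D (rho z) -> {for z, continuous (f \o @rho R)}) ->
  D (rho z) -> {for rho z, continuous f}.
Proof.
move=> oD cf Dz P; rewrite nbhsE => -[Q [oQ Qz] QP].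
suff : nbhs (rho z) (f @^-1` Q) by apply: filterS => o /QP.
rewrite nbhsE; exists (D `&` f @^-1` Q) => [|o []//].
split=> //.
suff : open (@rho R @^-1` (D `&` f @^-1` Q)) by [].
rewrite openE => z' [Dz' Qz'].
have nD : \forall y \near z', D (rho y).
  by apply: open_nbhs_nbhs; split=> //; exact: oD.
have nQ : \forall y \near z', Q (f (rho y)).
  by apply: (cf z' Dz'); apply: open_nbhs_nbhs.
by apply: filterS2 nD nQ => y.
Qed.

Lemma vel_continuous i e : continuous (fun z : Z => e * vel z 0 i).
Proof.
move=> z; apply: (@continuous_comp _ _ _ (fun z : Z => vel z 0 i) ( *%R e)).
  apply: (@continuous_comp _ _ _ (set_val : Z -> J) (fun q : J => q.1.2 0 i)).
    exact: continuous_set_val.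
  apply: (@continuous_comp _ _ _ (fun q : J => q.1.2) (fun v : 'rV[R]_3 => v 0 i)).
    apply: (@continuous_comp _ _ _ (fun q : J => q.1) snd); first exact: cvg_fst.
    exact: cvg_snd.
  exact: coord_continuous.
exact: mulrl_continuous.
Qed.

Lemma open_vel_pos i e : open [set z : Z | 0 < e * vel z 0 i].
Proof.
rewrite (_ : [set z : Z | _] = (fun z => e * vel z 0 i) @^-1` [set y | 0 < y]) //.
apply: open_comp; last exact: open_gt.
by move=> z _; exact: vel_continuous.
Qed.

Section Chart.
Variables (z0 : Z) (i : 'I_3) (e : R).
Hypothesis ee : e * e = 1.
Let e0 := sign_neq0 ee.
Local Notation OC := (orb_chart z0 i e).

Let vel_neq z : 0 < e * vel z 0 i -> vel z 0 i != 0.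
Proof. by apply: contraTneq => ->; rewrite mulr0 ltxx. Qed.

Let eu u : 0 < e * vel (zsec z0 i 0 e u) 0 i.
Proof. by rewrite vel_zsec // ee. Qed.

Let open_dom : open (dom OC).
Proof.
suff : open (@rho R @^-1` dom OC) by [].
rewrite (_ : _ @^-1` _ = [set z : Z | 0 < e * vel z 0 i]); first exact: open_vel_pos.
by apply/funext => z; exact: orb_chart_dom.
Qed.

Lemma orb_chart_bwdK u : dom OC (bwd OC u) /\ fwd OC (bwd OC u) = u.
Proof.
rewrite [bwd _ _]/=; split; first by rewrite orb_chart_dom.
by rewrite orb_chart_rho // zsecE // red_map_sec.
Qed.

Let orb_chart_rho_continuous z :
  dom OC (rho z) -> {for z, continuous (fwd OC \o @rho R)}.
Proof.
rewrite orb_chart_dom => ev.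
have nev : \forall y \near z, 0 < e * vel y 0 i.
  by apply: open_nbhs_nbhs; split=> //; exact: open_vel_pos.
apply: (@continuous_near_eq _ _ (red_map i \o (set_val : Z -> J))).
  by apply: filterS nev => y ey; exact: esym (orb_chart_rho z0 ee ey).
apply: continuous_comp; first exact: continuous_set_val.
have oU : open [set q : J | q.1.2 0 i != 0].
  have oT := @openT J.
  apply: open_neq0 => q; apply: (@smooth_coord _ J _ oT _ (fun z => z.1.2) i _ 0%N) => //.
  by apply: smooth_snd => //; apply: smooth_fst => //; exact: smooth_id.
apply: (@red_map_smooth _ J _ id i oU _ _ 0%N) => //; first exact: smooth_id.
exact: vel_neq.
Qed.

Lemma orb_chart_homeo : chart_homeo OC.
Proof.
split; [split|exact: open_dom| |].
- exact: openT.
- move=> o do_; split=> //; apply: kappa_inj.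
  rewrite [bwd _ _]/= kappa_rho.
  by have [_ /(_ _ do_)[]] := cot_chart_bij z0 i ee.
- by move=> u _; exact: orb_chart_bwdK.
- move=> o; have [z <-] := rho_surj o => dz.
  exact: (continuous_from_quotient open_dom orb_chart_rho_continuous dz).
- move=> u _; apply: (@continuous_comp _ _ _ (zsec z0 i 0 e) (@rho R)).
    apply: continuous_into; rewrite (_ : _ \o _ = sec i 0 e).
      exact: (@sec_smooth R i 0 e 0%N).
    by apply/funext => u'; rewrite /= zsecE.
  exact: rho_continuous.
Qed.

(** In the charts of the zero level [orb_chart] is read through the rational map
    [red_map]. *)
Lemma orb_chart_along d : AZ d ->
  let U := cod d `&` [set u | dom OC (rho (bwd d u))] in
  [/\ open U, smooth_on U (fwd OC \o @rho R \o bwd d)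
    & forall u, U u -> fwd OC (rho (bwd d u)) = red_map i (set_val (bwd d u))].
Proof.
move=> [hd smd _] U.
have UE u : U u -> 0 < e * vel (bwd d u) 0 i by case=> _ du; rewrite -(orb_chart_dom z0).
have oU : open U.
  rewrite openE => u [cu du]; have cb := chart_bwd_continuous hd cu.
  have n1 := near_cod hd cu.
  have n2 : \forall y \near u, dom OC (rho (bwd d y)).
    apply: (near_dom orb_chart_homeo (tau := @rho R \o bwd d)) => //.
    by apply: continuous_comp => //; exact: rho_continuous.
  by apply: filterS2 n1 n2 => y.
have E u : U u -> fwd OC (rho (bwd d u)) = red_map i (set_val (bwd d u)).
  by move=> /UE ev; rewrite orb_chart_rho.
split=> //; apply: (@smooth_ext _ _ _ oU _ (fun u => red_map i (set_val (bwd d u)))).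
  by move=> u Uu; exact: esym (E u Uu).
apply: (@red_map_smooth _ _ _ (fun u => set_val (bwd d u)) i) => //.
  by move=> u /UE /vel_neq.
by move=> k; apply: Ck_on_sub (smd k) => u [].
Qed.

(** Sections through every point, not only through a slice, are what shows that
    the projection is a submersion at every point. *)
Lemma orb_chart_section z : 0 < e * vel z 0 i ->
  let tau := zsec z0 i (set_val z).1.1.1 (vel z 0 i) in
  [/\ tau (fwd OC (rho z)) = z, set_val \o tau = sec i (set_val z).1.1.1 (vel z 0 i)
    & forall u, dom OC (rho (tau u)) /\ fwd OC (rho (tau u)) = u].
Proof.
move=> ev tau; have v0 := vel_neq ev.
have tE u : set_val (tau u) = sec i (set_val z).1.1.1 (vel z 0 i) u by exact: zsecE.
split.
- apply: val_inj; rewrite -[LHS]/(set_val _) tE orb_chart_rho //.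
  exact: sec_red_map (set_valX z) v0.
- by apply/funext => u; exact: tE.
- move=> u; have ev' : 0 < e * vel (tau u) 0 i by rewrite vel_zsec.
  split; first by rewrite orb_chart_dom.
  by rewrite orb_chart_rho // tE red_map_sec.
Qed.

(** Smoothness is that of [red_map]; the differential is surjective because the
    section through the given point, read in the chart [d] by [chart_lift], is a
    differentiable right inverse. *)
Lemma orb_chart_atlas : orbit_space_atlas R OC.
Proof.
split; first exact: orb_chart_homeo.
move=> d Ad U; have [oU sU EU] := orb_chart_along Ad.
split=> // u Uu; have [cu du] := Uu; have [hd smd _] := Ad.
apply/seteqP; split=> // h _.
set z := bwd d u in du *.
have ev : 0 < e * vel z 0 i by rewrite -(orb_chart_dom z0).
have [tz tE ts] := orb_chart_section ev.
set tau := zsec _ _ _ _ in tz tE ts; set y := fwd OC (rho z) in tz *.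
have dF : differentiable (fwd OC \o @rho R \o bwd d) u.
  by have [df _] := sU 1%N; exact: df.
have dtau : differentiable (set_val \o tau) y.
  by rewrite tE; exact: smooth_differentiable (@sec_smooth R _ _ _) _.
have ddt : dom d (tau y) by rewrite tz; have := chart_dom hd cu.
have [dt _] := chart_lift zero_level_charts Ad ddt dtau.
have ft : (fwd d \o tau) y = u by rewrite /comp tz; have := chart_bwdK hd cu.
exists ('d (fwd d \o tau) y h) => //.
have ct : {for y, continuous tau}.
  by apply: continuous_into; exact: differentiable_continuous.
have ndt : \forall x \near y, dom d (tau x) by exact: (near_dom hd ct ddt).
rewrite -ft in dF; have D := is_diff_chain (differentiableP dt) (differentiableP dF).
rewrite ft in D.
have Did : is_diff y id (fun v => 'd (fwd OC \o @rho R \o bwd d) u ('d (fwd d \o tau) y v)).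
  apply: is_diff_near D; near=> x; have dx : dom d (tau x) by near: x.
  exact: etrans (congr1 (fun m => fwd OC (rho m)) (chart_fwdK hd dx)) (ts x).2.
exact: etrans (esym (diff_eq h Did)) (diff_eq h (is_diff_id y)).
Unshelve. all: by end_near. Qed.

End Chart.
End OrbitSpaceTopology.

(** * Pulling back the symplectic form *)

Section KappaSymplectic.
Context {R : realType}.
Local Notation E := ('rV[R]_3 * 'rV[R]_3)%type.
Local Notation J := (jet R * jet R)%type.
Local Notation Z := (zero_level R).
Local Notation S := (@sphere_bundle R).
Local Notation AS := (sphere_bundle_atlas R).
Local Notation AZ := (@zero_level_atlas R).
Local Notation OA := (orbit_space_atlas R).
Local Notation CA := (cotangent_atlas (A := AS)).

Lemma differentiable_sqrt (y : R) : 0 < y -> differentiable (@Num.sqrt R) y.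
Proof.
by move=> y0; apply/derivable1_diffP; case: (is_derive1_sqrt y0).
Qed.

(** The reason why the reduction is symplectic: with r = |v|, e = v/r and q = r p_v,
    the difference between dq de and dp_v dv consists of terms in dr multiplied by
    p_v v, which is 0, or by p_v dv = - v dp_v, and these cancel after
    antisymmetrization. *)
Lemma kap_along (W : normedModType R) (sigma : W -> Z) (w : W) D :
  differentiable (set_val \o sigma) w -> CA D -> dom D (kap (sigma w)) ->
  differentiable (fwd D \o kap \o sigma) w /\
  forall a b, cotangent_symplectic D (fwd D (kap (sigma w)))
     ('d (fwd D \o kap \o sigma) w a) ('d (fwd D \o kap \o sigma) w b) =
   omega ('d (set_val \o sigma) w a) ('d (set_val \o sigma) w b).
Proof.
move=> dsigma AD dD; set T := set_val \o sigma in dsigma *.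
have DT : is_diff w T ('d T w) := differentiableP dsigma.
move: ('d T w : W -> J) DT => dT DT.
have D1 := is_diff_chain DT (is_diff_fst (T w)).
have D2 := is_diff_chain DT (is_diff_snd (T w)).
have D11 := is_diff_chain D1 (is_diff_fst (T w).1).
have Dv := is_diff_chain D1 (is_diff_snd (T w).1).
have D21 := is_diff_chain D2 (is_diff_fst (T w).2).
have Dpv := is_diff_chain D2 (is_diff_snd (T w).2).
have Dx := is_diff_chain D11 (is_diff_snd (T w).1.1).
have Dpt := is_diff_chain D21 (is_diff_fst (T w).2.1).
have Dpx := is_diff_chain D21 (is_diff_snd (T w).2.1).
have vE y : (T y).1.2 = vel (sigma y) by [].
pose r y := speed (sigma y).
have dr : differentiable r w.
  have Dvv := is_diff_dot Dv Dv.
  have dvv : differentiable (fun y => dot (T y).1.2 (T y).1.2) w by have [] := Dvv.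
  apply: (differentiable_comp dvv); apply: differentiable_sqrt.
  by rewrite vE dot_gt0 // vel_neq0.
have r0 : r w != 0 by exact: speed_neq0.
have Dr : is_diff w r ('d r w) := differentiableP dr.
have Dk : is_diff w (fun y => (r y)^-1) (fun h => - (r w) ^- 2 * 'd r w h).
  by apply: DiffDef; [exact: differentiableV dr r0|rewrite diffV].
move: ('d r w : W -> R) Dr Dk => dr' Dr Dk.
have Dbase : is_diff w (set_val \o (base \o sigma)) _ :=
  is_diff_pair Dx (is_diff_scale Dk Dv).
have DP : is_diff w (cov \o sigma) _ := is_diff_pair Dpx (is_diff_scale Dr Dpv).
have dbase : differentiable (set_val \o (base \o sigma)) w by have [] := Dbase.
have dP : differentiable (cov \o sigma) w by have [] := DP.
have pt0 h : (dT h).2.1.1 = 0.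
  have D0 : is_diff w (cst 0 : W -> R) (fun h => (dT h).2.1.1).
    by apply: is_diff_near Dpt; apply: nearW => y; exact: time_mom0.
  by rewrite -(diff_eq h D0) diff_cst.
have orth0 h : dot (T w).2.2 (dT h).1.2 + dot (dT h).2.2 (T w).1.2 = 0.
  have D0 : is_diff w (cst 0 : W -> R)
      (fun h => dot (T w).2.2 (dT h).1.2 + dot (dT h).2.2 (T w).1.2).
    by apply: is_diff_near (is_diff_dot Dpv Dv); apply: nearW => y; exact: vel_mom_orth.
  by rewrite -(diff_eq h D0) diff_cst.
have sE y : set_val ((kap \o sigma) y) =
  ((base \o sigma) y, restrict (pair_dot ((cov \o sigma) y)) ((base \o sigma) y)).
  by [].
have [dK EK] := cotangent_symplectic_along sphere_bundle_charts
  pair_dot_linear pair_dot0 is_diff_pair_dot dbase dP sE AD dD.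
split; first exact: dK.
move=> a b; apply: etrans (EK a b) _.
have EP := diff_eq _ DP; have Eb := diff_eq _ Dbase.
apply: etrans (congr2 (fun x y => x - y) (congr2 pair_dot (EP a) (Eb b))
                                         (congr2 pair_dot (EP b) (Eb a))) _.
have pta := pt0 a; have ptb := pt0 b.
have oa := orth0 a; have ob := orth0 b.
have ow : dot (T w).2.2 (T w).1.2 = 0 by exact: vel_mom_orth.
move: (dT a) (dT b) (dr' a) (dr' b) oa ob pta ptb {pt0 orth0 DT D1 D2 D11 Dv D21 Dpv Dx Dpt Dpx Dbase DP EK EP Eb} => A B ra rb oa ob pta ptb.
rewrite /r in r0 *.
move: (T w) ow oa ob => q ow oa ob.
rewrite /omega /pairing /pair_dot /= pta ptb.
rewrite !dotDl !dotDr !dotZl !dotZr !ow.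
have ea : dot A.2.2 q.1.2 = - dot q.2.2 A.1.2.
  by apply/eqP; rewrite -addr_eq0 addrC oa.
have eb : dot B.2.2 q.1.2 = - dot q.2.2 B.1.2.
  by apply/eqP; rewrite -addr_eq0 addrC ob.
rewrite ea eb.
move: (dot A.2.2 B.1.2) (dot B.2.2 A.1.2) (dot q.2.2 A.1.2) (dot q.2.2 B.1.2)
  (dot A.2.1.2 B.1.1.2) (dot B.2.1.2 A.1.1.2) ra rb => x1 x2 x3 x4 x5 x6 x7 x8.
move: (speed (sigma w)) r0 => k k0.
by field.
Qed.

Lemma zero_level_point_subproof :
  zero_level R ((0, 0, const_mx 1), (0, 0, 0)).
Proof.
split; last by rewrite /= dot0l.
by apply/rV0Pn; exists 0; rewrite mxE oner_neq0.
Qed.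

Definition zero_level_point : Z := SigSub (mem_set zero_level_point_subproof).

Lemma cotangent_gno_chart (s : cotangent AS) : exists z0 i e,
  e * e = 1 /\ dom (cot_chart z0 i e) s.
Proof.
have [i [e [ee ev]]] := nonzero_entry (sphere_bundle_neq0 (set_val s).1).
by exists zero_level_point, i, e.
Qed.

Lemma kappa_surj (s : cotangent AS) : exists o, kappa o = s.
Proof.
have [z0 [i [e [ee ds]]]] := cotangent_gno_chart s.
have [_ /(_ s ds)[_ bK] _] := cot_chart_bij z0 i ee.
by exists (rho (zsec z0 i 0 e (fwd (cot_chart z0 i e) s))); rewrite kappa_rho.
Qed.

(** The charts of the orbit space are only assumed to make the projection a
    smooth submersion.  The change of charts [T1] from [orb_chart] to [c] is
    differentiable, as [bwd orb_chart] is the projection of a smooth section, and its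
    differential is surjective, since the differential of the projection read in
    [c] factors through it; so it is invertible and its continuous inverse is
    differentiable. *)
Lemma orbit_transition c o z0 i e : OA c -> dom c o -> e * e = 1 ->
  dom (orb_chart z0 i e) o ->
  differentiable (fwd (orb_chart z0 i e) \o bwd c) (fwd c o).
Proof.
move=> [hc smc] dc ee dO; set OC := orb_chart z0 i e in dO *.
have hO : chart_homeo OC := orb_chart_homeo z0 i ee.
have AO : OA OC := orb_chart_atlas z0 i ee.
set u0 := fwd OC o.
have bu0 : bwd OC u0 = o := chart_fwdK hO dO.
pose sigma : 'rV[R]_10 -> Z := zsec z0 i 0 e.
have e0 := sign_neq0 ee.
have sigmaE : set_val \o sigma = sec i 0 e by apply/funext => u; exact: zsecE.
have bOE u : bwd OC u = rho (sigma u) by [].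
have dsigma : differentiable (set_val \o sigma) u0.
  by rewrite sigmaE; exact: smooth_differentiable (@sec_smooth R i 0 e) _.
have csigma : {for u0, continuous sigma}.
  by apply: continuous_into; exact: differentiable_continuous.
have [e1 [Phi [Ae1 ext de1]]] := zero_level_charts (sigma u0).
have [he1 _ _] := Ae1.
have [dlift _] := chart_lift zero_level_charts Ae1 de1 dsigma.
set w1 := fwd e1 (sigma u0).
have bw1 : bwd e1 w1 = sigma u0 := chart_fwdK he1 de1.
have cw1 : cod e1 w1 := chart_cod he1 de1.
have Uw1 : cod e1 w1 /\ dom c (rho (bwd e1 w1)) by rewrite bw1 -bOE bu0.
have Vw1 : cod e1 w1 /\ dom OC (rho (bwd e1 w1)) by rewrite bw1 -bOE bu0.
have [smH surH] := smc e1 Ae1.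
have {}surH := surH w1 Uw1.
have dH : differentiable (fwd c \o @rho R \o bwd e1) w1 by exact: (smH 1%N).1.
have [smF _] := AO.2 e1 Ae1.
have dF : differentiable (fwd OC \o @rho R \o bwd e1) w1 by exact: (smF 1%N).1.
pose T1 := fwd c \o bwd OC.
have nde1 : \forall u \near u0, dom e1 (sigma u) by exact: near_dom.
have dT1 : differentiable T1 u0.
  have [dT1 _] : is_diff u0 T1 ('d (fwd c \o @rho R \o bwd e1) w1 \o 'd (fwd e1 \o sigma) u0).
    apply: is_diff_near (is_diff_chain (differentiableP dlift) (differentiableP dH)).
    near=> u; have du : dom e1 (sigma u) by near: u.
    exact: (congr1 (fun m => fwd c (rho m)) (chart_fwdK he1 du)).
  exact: dT1.
have Fw1 : (fwd OC \o @rho R \o bwd e1) w1 = u0.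
  by rewrite /comp bw1 -bOE bu0.
have surT1 v : exists u, 'd T1 u0 u = v.
  have : [set: 'rV[R]_10] v by [].
  rewrite -surH => -[h _ hv]; exists ('d (fwd OC \o @rho R \o bwd e1) w1 h).
  rewrite -hv; apply/esym.
  have DT1 : is_diff ((fwd OC \o @rho R \o bwd e1) w1) T1 ('d T1 u0).
    by rewrite Fw1; exact: differentiableP.
  apply: (diff_eq h (is_diff_near _ (is_diff_chain (differentiableP dF) DT1))).
  have cr : {for w1, continuous (@rho R \o bwd e1)}.
    by apply: continuous_comp; [exact: chart_bwd_continuous|exact: rho_continuous].
  have nO : \forall x \near w1, dom OC ((@rho R \o bwd e1) x).
    by apply: (near_dom hO cr); exact: Vw1.2.
  near=> x; have dx : dom OC (rho (bwd e1 x)) by near: x.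
  exact: (congr1 (fwd c) (chart_fwdK hO dx)).
have [B [linB AB _]] := injective_rV_inverse (linearP _)
   (surjective_rV_injective (linearP _) surT1).
set y0 := fwd c o.
have by0 : bwd c y0 = o := chart_fwdK hc dc.
have cy0 : cod c y0 := chart_cod hc dc.
pose g := fwd OC \o bwd c.
have gy0 : g y0 = u0 by rewrite /g /comp by0.
have cb : {for y0, continuous (bwd c)} := chart_bwd_continuous hc cy0.
have cg : {for y0, continuous g}.
  by apply: (continuous_comp cb); rewrite by0; exact: chart_fwd_continuous.
have Tg : \forall y \near y0, T1 (g y) = y.
  have nO : \forall y \near y0, dom OC (bwd c y).
    by apply: (near_dom hO cb); rewrite by0.
  near=> y; have dy : dom OC (bwd c y) by near: y.
  have cy : cod c y by near: y; exact: near_cod.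
  exact: etrans (congr1 (fwd c) (chart_fwdK hO dy)) (chart_bwdK hc cy).
have dTg : differentiable T1 (g y0) by rewrite gy0; exact: dT1.
have ABg : cancel ('d T1 (g y0)) B by rewrite gy0; exact: AB.
by have [] := is_diff_inverse cg Tg dTg linB (linear_rV_continuous linB) ABg.
Unshelve. all: by end_near. Qed.

Lemma orbit_gno_chart (o : orbit_space R) :
  exists z0 i e, [/\ e * e = 1, dom (orb_chart z0 i e) o & dom (cot_chart z0 i e) (kappa o)].
Proof.
have [z <-] := rho_surj o.
have [i [e [ee ev]]] := nonzero_entry (vel_neq0 z).
exists z, i, e; split=> //; first by rewrite orb_chart_dom.
by rewrite kappa_rho cot_chart_dom.
Qed.

(** In [orb_chart] this is the differentiability of [kap] along a section. *)
Lemma kappa_chart_differentiable c D o : OA c -> CA D -> dom c o -> dom D (kappa o) ->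
  differentiable (fwd D \o kappa \o bwd c) (fwd c o).
Proof.
move=> Ac AD dc dD; have [hc _] := Ac.
have [z0 [i [e [ee dO _]]]] := orbit_gno_chart o.
have dt := orbit_transition Ac dc ee dO.
set OC := orb_chart z0 i e in dO dt.
have hO : chart_homeo OC := orb_chart_homeo z0 i ee.
have e0 := sign_neq0 ee.
pose sigma : 'rV[R]_10 -> Z := zsec z0 i 0 e.
have sigmaE : set_val \o sigma = sec i 0 e by apply/funext => u; exact: zsecE.
set y0 := fwd c o in dt *.
have by0 : bwd c y0 = o := chart_fwdK hc dc.
have tE : (fwd OC \o bwd c) y0 = fwd OC o by rewrite /comp by0.
have dsigma : differentiable (set_val \o sigma) (fwd OC o).
  by rewrite sigmaE; exact: smooth_differentiable (@sec_smooth R i 0 e) _.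
have so : kap (sigma (fwd OC o)) = kappa o.
  by rewrite -kappa_rho; exact: (congr1 kappa (chart_fwdK hO dO)).
have dDs : dom D (kap (sigma (fwd OC o))) by rewrite so.
have [dK _] := kap_along dsigma AD dDs.
rewrite -tE in dK.
have cb : {for y0, continuous (bwd c)} := chart_bwd_continuous hc (chart_cod hc dc).
have nO : \forall y \near y0, dom OC (bwd c y).
  by apply: (near_dom hO cb); rewrite by0.
have nE : \forall y \near y0, (fwd D \o kap \o sigma) ((fwd OC \o bwd c) y) =
    (fwd D \o kappa \o bwd c) y.
  near=> y; have dy : dom OC (bwd c y) by near: y.
  rewrite /comp -kappa_rho.
  exact: (congr1 (fun m => fwd D (kappa m)) (chart_fwdK hO dy)).
by have [] := is_diff_near nE (is_diff_chain (differentiableP dt) (differentiableP dK)).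
Unshelve. all: by end_near. Qed.

End KappaSymplectic.

Section KappaSymplectomorphism.
Context {R : realType}.
Local Notation J := (jet R * jet R)%type.
Local Notation Z := (zero_level R).
Local Notation AS := (sphere_bundle_atlas R).
Local Notation AZ := (@zero_level_atlas R).
Local Notation OA := (orbit_space_atlas R).
Local Notation CA := (cotangent_atlas (A := AS)).

(** In corresponding gnomonic charts [kappa] and its inverse are the identity. *)
Lemma kappa_diffeomorphism : diffeomorphism OA CA (@kappa R).
Proof.
pose g (s : cotangent AS) : orbit_space R := projT1 (cid (kappa_surj s)).
have kg s : kappa (g s) = s by exact: projT2 (cid (kappa_surj s)).
have oT := @openT 'rV[R]_10.
exists g; split.
- by move=> o; apply: kappa_inj; rewrite kg.
- exact: kg.
- move=> o; have [z0 [i [e [ee dO dC]]]] := orbit_gno_chart o.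
  exists (orb_chart z0 i e), (cot_chart z0 i e), setT; split=> //.
  + by split=> //; exact: orb_chart_atlas.
  + by split=> //; exact: cot_chart_atlas.
  + by move=> u _; split=> //; exact: (orb_chart_bwdK z0 i ee u).1.
  + apply: smooth_ext (smooth_id oT) => // u _.
    exact: esym (orb_chart_bwdK z0 i ee u).2.
- move=> s; have [z0 [i [e [ee dC]]]] := cotangent_gno_chart s.
  have [_ bF bK] := cot_chart_bij z0 i ee.
  have gd s' : dom (cot_chart z0 i e) s' -> dom (orb_chart z0 i e) (g s').
    by rewrite -{1}(kg s').
  exists (cot_chart z0 i e), (orb_chart z0 i e), setT; split=> //.
  + by split=> //; exact: cot_chart_atlas.
  + by split; [exact: orb_chart_atlas|exact: gd].
  + by move=> u _; split=> //; apply: gd; exact: (bK u I).1.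
  + apply: smooth_ext (smooth_id oT) => // u _.
    exact: esym (etrans (congr1 (fwd (cot_chart z0 i e)) (kg _)) (bK u I).2).
Qed.

(** Tangent vectors of the orbit space lift to the zero level since the projection
    is a submersion, and there [kap_along] compares both forms with the
    restriction of the canonical one. *)
Lemma kappa_pullback omegaR :
  is_pullback AZ OA (@rho R) omegaR (@iota_omega R) ->
  is_pullback OA CA (@kappa R) (cotangent_symplectic (A := AS)) omegaR.
Proof.
move=> pb c D o Ac AD dc dD a b.
have dG := kappa_chart_differentiable Ac AD dc dD.
have [hc smc] := Ac.
have [z zo] := rho_surj o.
have [e1 [Phi [Ae1 ext de1]]] := zero_level_charts z.
have [he1 sme1 _] := Ae1.
set w1 := fwd e1 z.
have bw1 : bwd e1 w1 = z := chart_fwdK he1 de1.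
have cw1 : cod e1 w1 := chart_cod he1 de1.
have Uw1 : cod e1 w1 /\ dom c (rho (bwd e1 w1)) by rewrite bw1 zo.
have [smH surH] := smc e1 Ae1.
have {}surH := surH w1 Uw1.
have dH : differentiable (fwd c \o @rho R \o bwd e1) w1 by exact: (smH 1%N).1.
have Hw1 : (fwd c \o @rho R \o bwd e1) w1 = fwd c o by rewrite /comp bw1 zo.
have dpsi : differentiable (set_val \o bwd e1) w1 by exact: ((sme1 1%N).1 w1 cw1).
have dDk : dom D (kap (bwd e1 w1)) by rewrite bw1 -kappa_rho zo.
have [dK EK] := kap_along dpsi AD dDk.
have DK : is_diff w1 (fwd D \o kap \o bwd e1)
   ('d (fwd D \o kappa \o bwd c) (fwd c o) \o 'd (fwd c \o @rho R \o bwd e1) w1).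
  have DG : is_diff ((fwd c \o @rho R \o bwd e1) w1) (fwd D \o kappa \o bwd c)
    ('d (fwd D \o kappa \o bwd c) (fwd c o)) by rewrite Hw1; exact: differentiableP.
  have cr : {for w1, continuous (@rho R \o bwd e1)}.
    by apply: continuous_comp; [exact: chart_bwd_continuous|exact: rho_continuous].
  have nc : \forall x \near w1, dom c ((@rho R \o bwd e1) x).
    by apply: (near_dom hc cr); exact: Uw1.2.
  apply: is_diff_near (is_diff_chain (differentiableP dH) DG).
  near=> x; have dx : dom c (rho (bwd e1 x)) by near: x.
  apply: etrans (congr1 (fun m => fwd D (kappa m)) (chart_fwdK hc dx)) _.
  by rewrite kappa_rho.
have [a' _ <-] : range ('d (fwd c \o @rho R \o bwd e1) w1) a by rewrite surH.
have [b' _ <-] : range ('d (fwd c \o @rho R \o bwd e1) w1) b by rewrite surH.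
have dcz : dom c (rho z) by rewrite zo.
have := pb e1 c z Ae1 Ac de1 dcz a' b'; rewrite zo => <-.
have EKab := EK a' b'.
apply: etrans (esym EKab) _.
rewrite [in LHS]bw1 -kappa_rho zo.
exact: (congr2 (cotangent_symplectic D (fwd D (kappa o))) (diff_eq a' DK) (diff_eq b' DK)).
Unshelve. all: by end_near. Qed.

End KappaSymplectomorphism.

(** * Spherical coordinates *)

Section SphericalCoordinates.
Context {R : realType}.
Local Notation Z := (zero_level R).
Local Notation AS := (sphere_bundle_atlas R).

Definition direction (q : R * R) : 'rV[R]_3 := spherical (1, q.1, q.2).

Lemma sphericalE r b a : spherical (r, b, a) = r *: direction (b, a).
Proof.
apply/rowP => j; rewrite !mxE /=.
by case: j => [[|[|[|j]]] Hj] //=; rewrite ?mul1r ?mulrA.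
Qed.

Lemma direction_unit q : dot (direction q) (direction q) = 1.
Proof.
rewrite /dot !big_ord_recl big_ord0 !mxE /= !mul1r addr0.
rewrite -[RHS](cos2Dsin2 q.1) -[X in _ = _ + X]mulr1 -[X in _ = _ + _ * X](cos2Dsin2 q.2).
by ring.
Qed.

Lemma direction_smooth (V : normedModType R) (U : set V) (f g : V -> R) :
  open U -> smooth_on U f -> smooth_on U g ->
  smooth_on U (fun x => direction (f x, g x)).
Proof.
move=> oU sf sg; have [sinf cosf] := smooth_sin_cos oU sf.
have [sing cosg] := smooth_sin_cos oU sg.
apply: smooth_row => // j.
case: j => [[|[|[|j]]] Hj] //.
- have -> : (fun x => direction (f x, g x) 0 (Ordinal Hj)) = fun x => sin (f x) * cos (g x).
    by apply/funext => x; rewrite mxE /= mul1r.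
  exact: smoothM.
- have -> : (fun x => direction (f x, g x) 0 (Ordinal Hj)) = fun x => sin (f x) * sin (g x).
    by apply/funext => x; rewrite mxE /= mul1r.
  exact: smoothM.
- have -> // : (fun x => direction (f x, g x) 0 (Ordinal Hj)) = fun x => cos (f x).
  by apply/funext => x; rewrite mxE /= mul1r.
Qed.

Lemma direction_differentiable q : differentiable direction q.
Proof.
have oT := @openT (R * R)%type.
have sid := smooth_id oT.
have -> : direction = fun q => direction (q.1, q.2) by apply/funext => -[].
apply: (@smooth_differentiable _ _ setT) => //.
by apply: direction_smooth => //; [exact: smooth_fst|exact: smooth_snd].
Qed.

(** Angular derivatives are homogeneous in the radius: this turns the momenta dual
    to (beta, alpha) at radius r into the components of |v| p_v on the unit sphere. *)
Lemma diff_spherical (r b a db da : R) :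
  'd spherical (r, b, a) (0, db, da) = r *: 'd direction (b, a) (db, da).
Proof.
set w := (r, b, a).
have D1 := is_diff_chain (is_diff_fst w) (is_diff_fst w.1).
have D2 := is_diff_chain (is_diff_fst w) (is_diff_snd w.1).
have D23 := is_diff_pair D2 (is_diff_snd w).
have Dd := is_diff_chain D23 (differentiableP (direction_differentiable (b, a))).
have D := is_diff_scale D1 Dd.
have -> : @spherical R = fun w => w.1.1 *: direction (w.1.2, w.2).
  by apply/funext => -[[r' b'] a']; exact: sphericalE.
by apply: etrans (diff_eq _ D) _; rewrite /= scale0r addr0.
Qed.

Lemma row2_eta (y : 'rV[R]_2) : row2 (y 0 0) (y 0 1) = y.
Proof.
apply/rowP => j; rewrite mxE; case: j => [[|[|j]] Hj] //=; congr (y _ _).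
  by apply: val_inj.
by apply: val_inj.
Qed.

Lemma kappa_spherical (z : Z) (t : R) (x v px pv : 'rV[R]_3) :
  set_val z = ((t, x, v), (0, px, pv)) ->
  forall (c : chart R 5 (@sphere_bundle R)) (r beta alpha pr pbeta palpha : R),
  spherical_chart c -> cod c (row_mx x (row2 beta alpha)) ->
  0 < r -> v = spherical (r, beta, alpha) ->
  spherical_momenta (r, beta, alpha) pv pr pbeta palpha ->
  has_coords c (kappa (rho z)) (row_mx x (row2 beta alpha))
                               (row_mx px (row2 pbeta palpha)).
Proof.
move=> zE c r b a pr pb pa [Ac sc] cu r0 vE mE.
set u : 'rV[R]_5 := row_mx x (row2 b a) in cu *.
have [hc smc _] := Ac.
have xz : pos z = x by rewrite /pos zE.
have vz : vel z = v by rewrite /vel zE.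
have pxz : pos_mom z = px by rewrite /pos_mom zE.
have pvz : vel_mom z = pv by rewrite /vel_mom zE.
have sz : speed z = r.
  rewrite /speed vz vE sphericalE dotZl dotZr direction_unit mulr1 -expr2.
  by rewrite sqrtr_sqr gtr0_norm.
have rn0 : r != 0 by rewrite gt_eqF.
have bz : base z = bwd c u.
  apply: val_inj; rewrite -[LHS]/(set_val (base z)) -[RHS]/(set_val (bwd c u)).
  rewrite baseE sc // xz vz sz vE [spherical (r, _, _)]sphericalE.
  by rewrite scalerA mulVf // scale1r.
have dc : dom c (base z) by rewrite bz; have := chart_dom hc cu.
have fc : fwd c (base z) = u by rewrite bz; have := chart_bwdK hc cu.
rewrite kappa_rho; split; [exact: dc|exact: fc|].
rewrite kapE /=; apply: dot_inj => h.
apply: etrans (dot_restrict h (pair_dot_linear _) Ac dc) _.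
rewrite fc.
(* near [u] the parametrization is given by spherical coordinates *)
have Dr := @is_diff_rsubmx R 3 2 u.
have D0 := is_diff_chain Dr (is_diff_coord _ 0).
have D1 := is_diff_chain Dr (is_diff_coord _ 1).
have Dd := is_diff_chain (is_diff_pair D0 D1) (differentiableP (direction_differentiable _)).
have D := is_diff_pair (@is_diff_lsubmx R 3 2 u) Dd.
have nE : \forall y \near u, (@lsubmx R 1 3 2 y,
    direction (@rsubmx R 1 3 2 y 0 0, @rsubmx R 1 3 2 y 0 1)) = (set_val \o bwd c) y.
  near=> y; have cy : cod c y by near: y; exact: near_cod.
  have := sc (@lsubmx R 1 3 2 y) (@rsubmx R 1 3 2 y 0 0) (@rsubmx R 1 3 2 y 0 1).
  by rewrite row2_eta (@hsubmxK R 1 3 2) => /(_ cy) E; exact: esym E.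
apply: etrans (congr1 (pair_dot (cov z)) (diff_eq h (is_diff_near nE D))) _.
rewrite /pair_dot /= pxz pvz sz.
rewrite -[in RHS](@hsubmxK R 1 3 2 h) (@dot_row_mx R 3 2); congr (_ + _).
have ru : @rsubmx R 1 3 2 u = row2 b a by exact: (@row_mxKr R 1 3 2).
set y := @rsubmx R 1 3 2 h.
have := mE (0, y 0 0, y 0 1); rewrite diff_spherical /= mulr0 add0r dotZr.
have -> : (@rsubmx R 1 3 2 u 0 0, @rsubmx R 1 3 2 u 0 1) = (b, a).
  by rewrite ru !mxE.
rewrite dotZl => ->.
clearbody y.
by rewrite /dot !big_ord_recl big_ord0 !mxE /= addr0; congr (_ * _ + _ * _);
   congr (y _ _); apply: val_inj.
Unshelve. all: by end_near. Qed.

End SphericalCoordinates.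

Section SphericalCharts.
Context {R : realType}.
Local Notation E := ('rV[R]_3 * 'rV[R]_3)%type.
Local Notation S := (@sphere_bundle R).
Local Notation AS := (sphere_bundle_atlas R).

Lemma smooth_atan (V : normedModType R) (U : set V) (f : V -> R) : open U ->
  smooth_on U f -> smooth_on U (fun x => atan (f x)).
Proof.
move=> oU sf; case=> [|k].
  by move=> x Ux; apply: continuous_comp; [exact: (sf 0%N x Ux)|exact: continuous_atan].
apply: (@Ck_on_comp_real _ _ _ oU k atan (fun y => (1 + y ^+ 2)^-1)); first exact: sf.
apply: (smoothV oU) => [x _|].
  by rewrite gt_eqF // ltr_wpDr // sqr_ge0.
apply: smoothD => //; first exact: smooth_cst.
exact: (smoothM oU sf sf).
Qed.

Let i0 : 'I_3 := ord0.
Let i1 : 'I_3 := lift ord0 ord0.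
Let i2 : 'I_3 := lift ord0 (lift ord0 ord0).

Definition azimuth (v : 'rV[R]_3) : R := atan (v 0 i1 / v 0 i0).

(** The polar angle is taken in ]0, pi[ or ]-pi, 0[ according to the sign [e], so
    that the azimuth can be kept in ]-pi/2, pi/2[ on both sides.  The argument of
    [atan] is the cotangent of the angle. *)
Definition polar (e : R) (v : 'rV[R]_3) : R :=
  e * (pi / 2 - atan (v 0 i2 * cos (azimuth v) / (e * v 0 i0))).

Definition sph_map (e : R) (s : E) : 'rV[R]_5 :=
  row_mx s.1 (row2 (polar e s.2) (azimuth s.2)).

Definition sph_pt (u : 'rV[R]_5) : E :=
  (@lsubmx R 1 3 2 u, direction (@rsubmx R 1 3 2 u 0 0, @rsubmx R 1 3 2 u 0 1)).

Definition sph_cod (e : R) : set 'rV[R]_5 :=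
  [set u | let b := e * @rsubmx R 1 3 2 u 0 0 in let a := @rsubmx R 1 3 2 u 0 1 in
           [/\ 0 < b, 0 < pi - b, 0 < a + pi / 2 & 0 < pi / 2 - a]].

Definition sph_chart (m0 : S) (e : R) : chart R 5 S :=
  Chart [set m : S | 0 < e * (set_val m).2 0 i0] (sph_cod e)
    (fun m : S => sph_map e (set_val m)) (fun u => into m0 (sph_pt u)).

Lemma sph_pt_sphere u : sphere_bundle (sph_pt u).
Proof. exact: direction_unit. Qed.

Lemma open_sph_cod e : open (sph_cod e).
Proof.
have oT := @openT 'rV[R]_5.
have sr := @smooth_rsubmx _ _ _ oT 3 2 _ (smooth_id oT).
have sb := smooth_coord oT 0 sr; have sa := smooth_coord oT 1 sr.
have seb := smoothM oT (smooth_cst oT e) sb.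
have cont (f : 'rV[R]_5 -> R) : smooth_on setT f -> continuous f.
  by move=> sf u; exact: (sf 0%N).
have o1 := open_pos (cont _ seb).
have o2 := open_pos (cont _ (smoothD oT (smooth_cst oT pi) (smoothN oT seb))).
have o3 := open_pos (cont _ (smoothD oT sa (smooth_cst oT (pi / 2)))).
have o4 := open_pos (cont _ (smoothD oT (smooth_cst oT (pi / 2)) (smoothN oT sa))).
have := openI (openI o1 o2) (openI o3 o4).
congr open; apply/seteqP; split=> u; first by case=> -[? ?] [].
by case.
Qed.

Lemma sign_cases (e : R) : e * e = 1 -> e = 1 \/ e = -1.
Proof.
move=> ee; have : e ^+ 2 == 1 by rewrite expr2 ee.
by rewrite sqrf_eq1 => /orP[] /eqP; [left|right].
Qed.

Lemma sin_sign e x : e * e = 1 -> sin (e * x) = e * sin x :> R.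
Proof.
by move=> /sign_cases[] ->; rewrite ?mul1r // !mulN1r sinN.
Qed.

Lemma cos_sign e x : e * e = 1 -> cos (e * x) = cos x :> R.
Proof. by move=> /sign_cases[] ->; rewrite ?mul1r // mulN1r cosN. Qed.

Lemma direction_polar e b a : e * e = 1 -> 0 < e * b -> 0 < pi - e * b ->
  0 < a + pi / 2 -> 0 < pi / 2 - a ->
  azimuth (direction (b, a)) = a /\ polar e (direction (b, a)) = b.
Proof.
move=> ee b0 b1 a0 a1.
have e0 := sign_neq0 ee.
have sb : 0 < sin (e * b) by apply: sin_gt0_pi; rewrite b0 -subr_gt0.
have ca : 0 < cos a by apply: cos_gt0_pihalf; rewrite -subr_gt0 opprK a0 -subr_gt0.
have sbn : sin b != 0.
  by apply: contraTneq sb => sb0; rewrite sin_sign // sb0 mulr0 ltxx.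
have can : cos a != 0 by rewrite gt_eqF.
have v0 : direction (b, a) 0 i0 = sin b * cos a by rewrite mxE /= mul1r.
have v1 : direction (b, a) 0 i1 = sin b * sin a by rewrite mxE /= mul1r.
have v2 : direction (b, a) 0 i2 = cos b by rewrite mxE /= mul1r.
have azE : azimuth (direction (b, a)) = a.
  rewrite /azimuth v0 v1.
  have -> : sin b * sin a / (sin b * cos a) = tan a by rewrite /tan; field; rewrite sbn can.
  by rewrite tanK // in_itv /= -subr_gt0 opprK a0 -subr_gt0.
split=> //; rewrite /polar azE v0 v2.
have -> : cos b * cos a / (e * (sin b * cos a)) = tan (pi / 2 - e * b).
  rewrite /tan.
  have -> : sin (pi / 2 - e * b) = cos b by rewrite sinB sin_pihalf cos_pihalf mul0r subr0 mul1r cos_sign.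
  have -> : cos (pi / 2 - e * b) = e * sin b by rewrite cosB sin_pihalf cos_pihalf mul0r add0r mul1r sin_sign.
  by field; rewrite sbn can e0.
rewrite tanK; last by rewrite in_itv /=; apply/andP; split; lra.
by rewrite subKr mulrA ee mul1r.
Qed.

Lemma sin_atan (x : R) : sin (atan x) = x * cos (atan x).
Proof.
have ca : cos (atan x) != 0.
  by rewrite gt_eqF // cos_gt0_pihalf // atan_gtNpi2 atan_ltpi2.
by rewrite -{2}(atanK x) /tan divfK.
Qed.

Lemma cos_atan_gt0 (x : R) : 0 < cos (atan x).
Proof. by apply: cos_gt0_pihalf; rewrite atan_gtNpi2 atan_ltpi2. Qed.

(** With G and C the cosines of the two arctangents, the norm condition gives
    G^2 = v_0^2 + v_1^2 and G^2 C^2 = v_0^2; signs then give G C = e v_0, from which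
    the three entries follow. *)
Lemma polar_direction e v : e * e = 1 -> dot v v = 1 -> 0 < e * v 0 i0 ->
  direction (polar e v, azimuth v) = v.
Proof.
move=> ee vv ev.
have e0 := sign_neq0 ee.
have v0 : v 0 i0 != 0 by apply: contraTneq ev => ->; rewrite mulr0 ltxx.
rewrite /polar; set a := azimuth v; set g := atan _.
have sa : sin a = v 0 i1 / v 0 i0 * cos a by exact: sin_atan.
have sg : sin g = v 0 i2 * cos a / (e * v 0 i0) * cos g by exact: sin_atan.
have ca : 0 < cos a := cos_atan_gt0 _; have cg : 0 < cos g := cos_atan_gt0 _.
have sp : sin (e * (pi / 2 - g)) = e * cos g.
  by rewrite sin_sign // sinB sin_pihalf cos_pihalf mul0r subr0 mul1r.
have cp : cos (e * (pi / 2 - g)) = sin g.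
  by rewrite cos_sign // cosB sin_pihalf cos_pihalf mul0r add0r mul1r.
have vvE : v 0 i0 * v 0 i0 + (v 0 i1 * v 0 i1 + v 0 i2 * v 0 i2) = 1.
  by rewrite -vv /dot !big_ord_recl big_ord0 addr0.
have C2 : cos a ^+ 2 * (v 0 i0 ^+ 2 + v 0 i1 ^+ 2) = v 0 i0 ^+ 2.
  rewrite -[RHS]mulr1 -(cos2Dsin2 a) sa; field; exact: v0.
have G2 : cos g ^+ 2 * (v 0 i0 ^+ 2 + (v 0 i2 * cos a) ^+ 2) = v 0 i0 ^+ 2.
  have := cos2Dsin2 g; rewrite sg.
  have -> : (v 0 i2 * cos a / (e * v 0 i0) * cos g) ^+ 2 =
    (e * e)^-1 * (v 0 i2 * cos a / v 0 i0 * cos g) ^+ 2.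
    by field; rewrite e0 v0.
  rewrite ee invr1 mul1r => H; rewrite -[RHS]mulr1 -H; field; exact: v0.
have GC : cos g * cos a = e * v 0 i0.
  have GC2 : (cos g * cos a) ^+ 2 = (e * v 0 i0) ^+ 2.
    have -> : (e * v 0 i0) ^+ 2 = v 0 i0 ^+ 2 by rewrite exprMn expr2 ee mul1r.
    have G2' : cos g ^+ 2 = v 0 i0 ^+ 2 + v 0 i1 ^+ 2.
      apply: (mulfI (x := v 0 i0 ^+ 2)); first by rewrite sqrf_eq0.
      have := congr1 ( *%R^~ (v 0 i0 ^+ 2 + v 0 i1 ^+ 2)) G2.
      rewrite /= => <-.
      have -> : cos g ^+ 2 * (v 0 i0 ^+ 2 + (v 0 i2 * cos a) ^+ 2) *
         (v 0 i0 ^+ 2 + v 0 i1 ^+ 2) =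
         cos g ^+ 2 * (v 0 i0 ^+ 2 * (v 0 i0 ^+ 2 + v 0 i1 ^+ 2) +
          v 0 i2 ^+ 2 * (cos a ^+ 2 * (v 0 i0 ^+ 2 + v 0 i1 ^+ 2))) by ring.
      rewrite C2 -[LHS]mulr1 -vvE; ring.
    by rewrite exprMn G2' mulrC C2.
  by apply/eqP; rewrite -(eqrXn2 (n := 2)) ?GC2 //; apply: ltW => //; exact: mulr_gt0.
apply/rowP => j; rewrite mxE /= !mul1r sp cp.
have ej : (j == i0) || (j == i1) || (j == i2) by case: j => [[|[|[|j]]] Hj].
case/orP: ej => [/orP[]|] /eqP -> /=.
- by rewrite -mulrA GC mulrA ee mul1r.
- have -> : e * cos g * sin a = e * (v 0 i1 / v 0 i0 * (cos g * cos a)) by rewrite sa; ring.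
  rewrite GC; have -> : e * (v 0 i1 / v 0 i0 * (e * v 0 i0)) = e * e * v 0 i1 by field.
  by rewrite ee mul1r.
- have -> : sin g = v 0 i2 / (e * v 0 i0) * (cos g * cos a) by rewrite sg; ring.
  by rewrite GC; field; rewrite e0 v0.
Qed.

Lemma sph_map_smooth e : e != 0 ->
  smooth_on [set s : E | 0 < e * s.2 0 i0] (sph_map e).
Proof.
move=> e0; set O := [set s | _].
have oO : open O by apply: open_pos; exact: continuous_entry2.
have sid := smooth_id oO; have s2 := smooth_snd oO sid.
have v0 (s : E) : O s -> s.2 0 i0 != 0.
  by apply: contraTneq => ->; rewrite mulr0 ltxx.
have saz : smooth_on O (fun s : E => azimuth s.2).
  apply: smooth_atan => //; apply: smoothM => //; first exact: smooth_coord.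
  by apply: smoothV => //; exact: smooth_coord.
have spol : smooth_on O (fun s : E => polar e s.2).
  apply: smoothM => //; first exact: smooth_cst.
  apply: smoothD => //; first exact: smooth_cst.
  apply: smoothN => //; apply: smooth_atan => //; apply: smoothM => //.
    apply: smoothM => //; first exact: smooth_coord.
    by have [] := smooth_sin_cos oO saz.
  apply: smoothV => // [s Os|]; first by rewrite mulf_neq0 // v0.
  by apply: smoothM => //; [exact: smooth_cst|exact: smooth_coord].
apply: (@smooth_row_mx _ _ _ oO 3 2) => //; first exact: smooth_fst.
apply: smooth_row => // j; case: j => [[|[|j]] Hj] //.
  have -> // : (fun s : E => row2 (polar e s.2) (azimuth s.2) 0 (Ordinal Hj)) =
    fun s => polar e s.2 by apply/funext => s; rewrite mxE.
have -> // : (fun s : E => row2 (polar e s.2) (azimuth s.2) 0 (Ordinal Hj)) =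
  fun s => azimuth s.2 by apply/funext => s; rewrite mxE.
Qed.

Lemma row2_0 (b a : R) : row2 b a 0 0 = b. Proof. by rewrite mxE. Qed.
Lemma row2_1 (b a : R) : row2 b a 0 1 = a. Proof. by rewrite mxE. Qed.

Lemma sph_map_cod e s : e * e = 1 -> sph_cod e (sph_map e s).
Proof.
move=> ee; rewrite /sph_cod /sph_map /= (@row_mxKr R 1 3 2) row2_0 row2_1 /polar.
set g := atan _; have g1 := atan_gtNpi2 (s.2 0 i2 * cos (azimuth s.2) / (e * s.2 0 i0)).
have g2 := atan_ltpi2 (s.2 0 i2 * cos (azimuth s.2) / (e * s.2 0 i0)).
rewrite -/g in g1 g2; have a1 := atan_gtNpi2 (s.2 0 i1 / s.2 0 i0).
have a2 := atan_ltpi2 (s.2 0 i1 / s.2 0 i0); rewrite -/(azimuth s.2) in a1 a2.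
by rewrite mulrA ee mul1r; split; lra.
Qed.

(** Together the two signs cover the velocities with nonzero first entry, a dense
    set, which is enough to determine [kappa]. *)
Lemma sph_chart_atlas m0 e : e * e = 1 -> spherical_chart (sph_chart m0 e).
Proof.
move=> ee.
have e0 := sign_neq0 ee.
have valK u : set_val (into m0 (sph_pt u)) = sph_pt u by exact: intoK (sph_pt_sphere u).
split; last first.
  move=> x b a _; rewrite [bwd _ _]/= valK /sph_pt (@row_mxKl R 1 3 2) (@row_mxKr R 1 3 2).
  by rewrite row2_0 row2_1.
apply: (submanifold_atlas_extension (Phi := sph_map e)
          (O := [set s : E | 0 < e * s.2 0 i0])) => //.
- exact: open_sph_cod.
- by apply: open_pos; exact: continuous_entry2.
- move=> m dm; split=> //; exact: smooth_differentiable (sph_map_smooth e0) dm.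
- have oC : open (sph_cod e) by exact: open_sph_cod.
  apply: (@smooth_ext _ _ _ oC _ sph_pt); first by move=> u _; rewrite /= valK.
  have sid := smooth_id oC; have sr := @smooth_rsubmx _ _ _ oC 3 2 _ sid.
  apply: smooth_pair => //; first exact: (@smooth_lsubmx _ _ _ oC 3 2).
  by apply: direction_smooth => //; exact: smooth_coord.
- move=> m dm; split; first exact: sph_map_cod.
  apply: set_valK; apply/esym; rewrite /sph_pt /sph_map (@row_mxKl R 1 3 2) (@row_mxKr R 1 3 2).
  rewrite row2_0 row2_1 (polar_direction ee (set_valX m) dm).
  by case: (set_val m).
- move=> u [b0 b1 a0 a1]; rewrite [bwd _ _]/=.
  have [azE poE] := direction_polar ee b0 b1 a0 a1.
  have sb : 0 < sin (e * @rsubmx R 1 3 2 u 0 0) by apply: sin_gt0_pi; rewrite b0 -subr_gt0.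
  have ca : 0 < cos (@rsubmx R 1 3 2 u 0 1).
    by apply: cos_gt0_pihalf; rewrite -subr_gt0 opprK a0 -subr_gt0.
  split; rewrite /= valK.
    rewrite /sph_pt /= mxE /= mul1r mulrA -(sin_sign _ ee); exact: mulr_gt0.
  by rewrite /sph_map /= azE poE row2_eta (@hsubmxK R 1 3 2).
Qed.

End SphericalCharts.

(** * Uniqueness *)

Section Uniqueness.
Context {R : realType}.
Local Notation J := (jet R * jet R)%type.
Local Notation Z := (zero_level R).
Local Notation AS := (sphere_bundle_atlas R).
Local Notation OA := (orbit_space_atlas R).
Local Notation CA := (cotangent_atlas (A := AS)).

Variable kappa' : orbit_space R -> cotangent AS.
Hypothesis smooth_kappa' : smooth_map OA CA kappa'.
Hypothesis spherical_kappa' : forall (z : Z) (t : R) (x v px pv : 'rV[R]_3),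
  set_val z = ((t, x, v), (0, px, pv)) ->
  forall (c : chart R 5 (@sphere_bundle R)) (r beta alpha pr pbeta palpha : R),
  spherical_chart c -> cod c (row_mx x (row2 beta alpha)) ->
  0 < r -> v = spherical (r, beta, alpha) ->
  spherical_momenta (r, beta, alpha) pv pr pbeta palpha ->
  has_coords c (kappa' (rho z)) (row_mx x (row2 beta alpha))
                                (row_mx px (row2 pbeta palpha)).

Lemma spherical_momenta_exist (w : R * R * R) (pv : 'rV[R]_3) :
  exists pr pb pa, spherical_momenta w pv pr pb pa.
Proof.
exists (dot pv ('d spherical w (1, 0, 0))), (dot pv ('d spherical w (0, 1, 0))),
  (dot pv ('d spherical w (0, 0, 1))) => -[[ar ab] aa] /=.
have -> : (ar, ab, aa) = ar *: (1, 0, 0) + (ab *: (0, 1, 0) + aa *: (0, 0, 1)) :> R * R * R.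
  rewrite -[RHS]/((ar * 1 + (ab * 0 + aa * 0), ar * 0 + (ab * 1 + aa * 0),
     ar * 0 + (ab * 0 + aa * 1))).
  by rewrite !mulr0 !mulr1 !addr0 !add0r.
rewrite linearD linearD !linearZ !dotDr !dotZr; ring.
Qed.

(** Where v_0 is nonzero a spherical chart is available, and the condition on
    spherical coordinates determines the image. *)
Lemma kappa'_eq z : vel z 0 ord0 != 0 -> kappa' (rho z) = kappa (rho z).
Proof.
move=> v0; pose e := Num.sg (vel z 0 ord0).
have ee : e * e = 1 by rewrite -expr2 sqr_sg v0.
have ev : 0 < e * vel z 0 ord0 by rewrite -normrEsg normr_gt0.
have sc := sph_chart_atlas (base z) ee; set c := sph_chart _ _ in sc.
have [Ac scE] := sc; have [hc _ _] := Ac.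
have dc : dom c (base z).
  have -> : dom c (base z) = is_true (0 < e * (set_val (base z)).2 0 ord0) by [].
  by rewrite baseE [X in _ * X]mxE mulrCA pmulr_rgt0 // invr_gt0 speed_gt0.
have cu := chart_cod hc dc; have bu := chart_fwdK hc dc.
move: cu bu; set u := fwd c (base z) => cu bu.
pose x := @lsubmx R 1 3 2 u; pose y := @rsubmx R 1 3 2 u.
have uE : u = row_mx x (row2 (y 0 0) (y 0 1)) by rewrite row2_eta (@hsubmxK R 1 3 2).
have bE : (pos z, (speed z)^-1 *: vel z) = (x, spherical (1, y 0 0, y 0 1)).
  by rewrite -scE -?uE // bu -baseE.
have [xE vE] := bE.
have vE' : vel z = spherical (speed z, y 0 0, y 0 1).
  by rewrite sphericalE /direction /= -vE scalerA divff ?scale1r // speed_neq0.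
have [pr [pb [pa mom]]] := spherical_momenta_exist (speed z, y 0 0, y 0 1) (vel_mom z).
have zE : set_val z = (((set_val z).1.1.1, x, vel z), (0, pos_mom z, vel_mom z)).
  rewrite -xE -[X in (_, (X, _, _))](time_mom0 z) /pos /vel /pos_mom /vel_mom.
  by case: (set_val z) => [[[? ?] ?] [[? ?] ?]].
rewrite uE in cu.
have [d1 f1 p1] := spherical_kappa' zE sc cu (speed_gt0 z) vE' mom.
have [d2 f2 p2] := kappa_spherical zE sc cu (speed_gt0 z) vE' mom.
apply: (cotangent_eq (c := c)) => //.
- by rewrite -(chart_fwdK hc d1) f1 -f2 chart_fwdK.
- by rewrite p1 p2.
Qed.

Lemma continuous_punctured_eq (V : normedModType R) (f g : R -> V) :
  {for 0, continuous f} -> {for 0, continuous g} ->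
  (\forall s \near 0^', f s = g s) -> f 0 = g 0.
Proof.
move=> cf cg fg.
have cf' : f @ 0^' --> f 0 by exact: cvg_within_filter cf.
have cg' : g @ 0^' --> g 0 by exact: cvg_within_filter cg.
rewrite -(cvg_lim _ cf') //; apply: cvg_lim => //; apply: cvg_trans cg'.
by apply: near_eq_cvg; apply: filterS fg => s ->.
Qed.

(** When v_0 = 0, a line of velocities along which v_0 is nonzero except at 0. *)
Definition leave_vel z (s : R) : 'rV[R]_3 := vel z + s *: delta_mx 0 ord0.

(** The momentum is projected orthogonally to the velocity, so as to stay in the
    zero level. *)
Definition leave_pt z (s : R) : J :=
  let v := leave_vel z s in
  (((set_val z).1.1.1, pos z, v),
   (0, pos_mom z, vel_mom z - (dot (vel_mom z) v / dot v v) *: v)).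

Lemma leave_vel_neq0 z s : vel z 0 ord0 = 0 -> dot (leave_vel z s) (leave_vel z s) != 0.
Proof.
move=> v0; rewrite /leave_vel dotDl !dotDr !dotZl !dotZr !(dotC (delta_mx _ _)) !dot_delta.
rewrite v0 mxE /= !mulr0 addr0 add0r mulr1 gt_eqF // ltr_pwDl ?dot_gt0 ?vel_neq0 //.
by rewrite -expr2 sqr_ge0.
Qed.

Lemma leave_pt_zero_level z s : vel z 0 ord0 = 0 -> zero_level R (leave_pt z s).
Proof.
move=> v0; have vv := leave_vel_neq0 s v0; split.
  by apply: contraNneq vv => /= ->; rewrite dot0l.
by split=> //=; rewrite dotDl dotNl dotZl divfK // subrr.
Qed.

Lemma leave_pt0 z : leave_pt z 0 = set_val z.
Proof.
rewrite /leave_pt /leave_vel scale0r addr0 vel_mom_orth mul0r scale0r subr0.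
rewrite -[X in (_, (X, _, _))](time_mom0 z) /pos /vel /pos_mom /vel_mom.
by case: (set_val z) => [[[? ?] ?] [[? ?] ?]].
Qed.

Lemma leave_pt_smooth z : vel z 0 ord0 = 0 -> smooth_on setT (leave_pt z).
Proof.
move=> v0; have oT := @openT R; have sid := smooth_id oT.
have sc (W : normedModType R) (k : W) := smooth_cst oT k.
have sv : smooth_on setT (leave_vel z).
  by apply: smoothD => //; apply: smooth_scale.
apply: smooth_pair => //; first by apply: smooth_pair.
apply: smooth_pair => //.
apply: smoothD => //; apply: smoothN => //; apply: smooth_scale => //.
apply: smoothM => //; first exact: smooth_dot.
apply: smoothV => //; last exact: smooth_dot.
by move=> s _; exact: leave_vel_neq0.
Qed.

(** Where v_0 = 0 the two maps agree along a curve, except possibly at its origin.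
    Covectors carry no topology, so continuity is used in charts: it first gives
    the equality of the base points, hence a common chart, and then that of
    the momenta. *)
Lemma kappa_unique o : kappa' o = kappa o.
Proof.
have [z <-] := rho_surj o.
have [v0|] := eqVneq (vel z 0 ord0) 0; last exact: kappa'_eq.
pose gam s : Z := into z (leave_pt z s).
have gamE s : set_val (gam s) = leave_pt z s by apply: intoK; exact: leave_pt_zero_level.
have gam0 : gam 0 = z by apply: val_inj; rewrite -[LHS]/(set_val _) gamE leave_pt0.
have sgam : set_val \o gam = leave_pt z by apply/funext => s; exact: gamE.
have dgam : differentiable (set_val \o gam) 0.
  by rewrite sgam; exact: smooth_differentiable (leave_pt_smooth v0) _.
have cgam : {for 0, continuous gam}.
  by apply: continuous_into; exact: differentiable_continuous.
have keq : \forall s \near 0^', kappa' (rho (gam s)) = kap (gam s).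
  near=> s; rewrite -kappa_rho; apply: kappa'_eq.
  rewrite /vel gamE /leave_pt /leave_vel /= !mxE v0 add0r mulr1.
  by near: s; exact: nbhs_dnbhs_neq.
have [c [d [U [[Ac dc] [Ad dd] [oU Uc] domU smU]]]] := smooth_kappa' (rho z).
have [hc _] := Ac; have [bijd [cs Acs [domd codd coordd]]] := Ad.
have [hs _ _] := Acs.
pose n s := fwd d (kappa' (rho (gam s))).
have crg : {for 0, continuous (@rho R \o gam)}.
  by apply: (continuous_comp cgam); exact: rho_continuous.
have dc0 : dom c ((@rho R \o gam) 0) by rewrite /comp gam0.
have ndc : \forall s \near 0, dom c ((@rho R \o gam) s) by exact: (near_dom hc crg dc0).
have cfc : {for 0, continuous (fwd c \o (@rho R \o gam))}.
  by apply: (continuous_comp crg); exact: (chart_fwd_continuous hc dc0).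
have nU : \forall s \near 0, U (fwd c (rho (gam s))).
  by apply: cfc; apply: open_nbhs_nbhs; split=> //; rewrite /comp gam0.
have cn : {for 0, continuous n}.
  apply: (@continuous_near_eq _ _ ((fwd d \o kappa' \o bwd c) \o (fwd c \o (@rho R \o gam)))).
    near=> s; have ds : dom c (rho (gam s)) by near: s.
    exact: (congr1 (fun m => fwd d (kappa' m)) (chart_fwdK hc ds)).
  apply: (continuous_comp cfc); apply: (smU 0%N); by rewrite /comp gam0.
have ndd : \forall s \near 0, dom d (kappa' (rho (gam s))).
  near=> s; have ds : dom c (rho (gam s)) by near: s.
  have Us : U (fwd c (rho (gam s))) by near: s.
  by have [_] := domU _ Us; rewrite (chart_fwdK hc ds).
(* continuity of the base points, as points of the ambient space *)
pose b1 s := set_val (set_val (kappa' (rho (gam s)))).1.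
pose b2 s := set_val (base (gam s)).
have cb2 : {for 0, continuous b2}.
  have oT := @openT R; have sid := smooth_id oT.
  have sv : smooth_on setT (leave_vel z).
    apply: smoothD => //; first exact: smooth_cst.
    by apply: smooth_scale => //; exact: smooth_cst.
  have vv0 s : 0 < dot (leave_vel z s) (leave_vel z s).
    by rewrite lt_neqAle dot_ge0 andbT eq_sym leave_vel_neq0.
  have -> : b2 = fun s => (pos z,
      (Num.sqrt (dot (leave_vel z s) (leave_vel z s)))^-1 *: leave_vel z s).
    by apply/funext => s; rewrite /b2 baseE /speed /pos /vel gamE.
  apply: (smooth_pair oT (smooth_cst oT _) _ 0%N) => //.
  apply: smooth_scale => //; apply: smoothV => //.
    by move=> s _; rewrite gt_eqF // sqrtr_gt0.
  by apply: smooth_sqrt => //; exact: smooth_dot.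
have coords s : dom d (kappa' (rho (gam s))) ->
    dom cs (set_val (kappa' (rho (gam s)))).1 /\
    bwd cs (lsubmx (n s)) = (set_val (kappa' (rho (gam s)))).1.
  by move=> ds; have [dcs fE _] := coordd _ ds; rewrite /n -fE (chart_fwdK hs dcs).
have dd0 : dom d (kappa' (rho (gam 0))) by rewrite gam0.
have cb1 : {for 0, continuous b1}.
  apply: (@continuous_near_eq _ _ (fun s => set_val (bwd cs (lsubmx (n s))))).
    near=> s; have ds : dom d (kappa' (rho (gam s))) by near: s.
    by rewrite (coords s ds).2.
  apply: (@continuous_comp _ _ _ (fun s => lsubmx (n s)) (set_val \o bwd cs)).
    apply: (@continuous_comp _ _ _ n (@lsubmx R 1 5 5) 0 cn).
    exact: continuous_lsubmx.
  have [_ smcs _] := Acs; apply: (smcs 0%N).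
  by have [dcs fE _] := coordd _ dd0; rewrite /n -fE; exact: (chart_cod hs dcs).
have bb : base z = (set_val (kappa' (rho z))).1.
  have b12 : b1 0 = b2 0.
    apply: (continuous_punctured_eq cb1 cb2).
    by apply: filterS keq => s ks; rewrite /b1 /b2 ks kapE.
  by move: b12; rewrite /b1 /b2 gam0 => b12; apply: val_inj; exact: esym b12.
(* the base points being equal, [d] is also a chart at [kap z] *)
have ddk : dom d (kap (gam 0)).
  by rewrite domd gam0 /= bb; have := dd; rewrite domd.
have [dk _] := kap_along dgam Ad ddk.
have n0 : n 0 = (fwd d \o kap \o gam) 0.
  apply: (continuous_punctured_eq cn (differentiable_continuous dk)).
  by apply: filterS keq => s ks; rewrite /n ks.
move: n0; rewrite /n /comp gam0 => n0; rewrite gam0 in ddk.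
have [_ bijK _] := bijd.
by rewrite kappa_rho -(bijK _ dd).2 n0 (bijK _ ddk).2.
Unshelve. all: by end_near. Qed.

End Uniqueness.

Theorem proposition4p6 (R : realType) (omegaR : form2 10 (orbit_space R)) :
  reduced_form omegaR ->
  exists! kappa : orbit_space R -> cotangent (sphere_bundle_atlas R),
    symplectomorphism (orbit_space_atlas R)
      (cotangent_atlas (A := sphere_bundle_atlas R))
      omegaR (cotangent_symplectic (A := sphere_bundle_atlas R)) kappa /\
    forall (z : zero_level R) (t : R) (x v px pv : 'rV[R]_3),
      set_val z = ((t, x, v), (0, px, pv)) ->
    forall (c : chart R 5 sphere_bundle) (r beta alpha pr pbeta palpha : R),
      spherical_chart c -> cod c (row_mx x (row2 beta alpha)) ->
      0 < r -> v = spherical (r, beta, alpha) ->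
      spherical_momenta (r, beta, alpha) pv pr pbeta palpha ->
      has_coords c (kappa (rho z)) (row_mx x (row2 beta alpha))
                                   (row_mx px (row2 pbeta palpha)).
Proof.
move=> [_ pb]; exists (@kappa R); split.
  split; last exact: kappa_spherical.
  by split; [exact: kappa_diffeomorphism|exact: kappa_pullback].
move=> kappa' [[[g [_ _ smk _]] _] sphk]; apply/funext => o.
apply/esym; exact: kappa_unique.
Qed.
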